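(* Let $T$ be the complete $L_{\mathrm{Pres}}$-theory of a regular ordered abelian group, $\mathfrak U$ a monster model, and $p,q$ invariant global types in possibly infinitely (but small) many variables. Then $p\geq_{\mathrm D}q$ if and only if (1) $\mathcal H(p)\supseteq\mathcal H(q)$, and (2) for every prime $\mathfrak p$, $\kappa_{\mathfrak p}(p)\geq\kappa_{\mathfrak p}(q)$. Hence the $\sim_{\mathrm D}$-class of $q$ is determined by $\mathcal H(q)$ and the function $\mathfrak p\mapsto\kappa_{\mathfrak p}(q)$.
   Context: $L_{\mathrm{Pres}}=\{+,0,-,<,1,\equiv_n\ (n\in\omega)\}$, $1$ the least positive element if the group is discrete and $0$ otherwise, $\equiv_n$ congruence modulo $n$; an ordered abelian group is regular if it eliminates quantifiers in $L_{\mathrm{Pres}}$. A global type $p$ is invariant if for some small $A\subseteq\mathfrak U$, $d\equiv_A d'$ implies ($\varphi(x,d)\in p\iff\varphi(x,d')\in p$). $p\geq_{\mathrm D}q$ iff there are a small $A$ and a complete type $r(x,y)$ over $A$ extending $(p\restriction A)(x)\cup(q\restriction A)(y)$ with $p(x)\cup r(x,y)\vdash q(y)$; $\sim_{\mathrm D}$ is the induced equivalence. For $c\models q$ (in a bigger monster), $\langle\mathfrak U c\rangle$ is the group generated by $\mathfrak U\cup c$; $\mathcal H(q)$ is the set of (cuts of) convex subgroups $H$ of $\mathfrak U$ such that some element of $\langle\mathfrak U c\rangle$ fills the cut of $H$, i.e. is greater than every element of $H$ and smaller than every element of $\mathfrak U$ greater than $H$. For a prime $\mathfrak p$, $\kappa_{\mathfrak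 p}(q)=\dim_{\mathbb F_{\mathfrak p}}\bigl((D/\mathfrak pD)/(\mathfrak U/\mathfrak p\mathfrak U)\bigr)$ where $D=\mathrm{dcl}(\mathfrak U c)$. These do not depend on the choice of $c$. *)

(* Defs.v *)
From HB Require Import structures.
From mathcomp Require Import all_boot all_order all_algebra.
From mathcomp Require Import mathcomp_extra boolp classical_sets functions.
From mathcomp Require Import cardinality.

Set Implicit Arguments.
Unset Strict Implicit.
Unset Printing Implicit Defensive.

Import Order.TTheory GRing.Theory Num.Theory.
Local Open Scope classical_set_scope.
Local Open Scope ring_scope.
Local Open Scope card_scope.

HB.mixin Record POrderedZmodule_isOAG G of Num.POrderedZmodule G := {
  oag_le_total : forall x y : G, (x <= y) || (y <= x);
  oag_lerD2 : forall x y z : G, x <= y -> x + z <= y + z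
}.

#[short(type="oagType")]
HB.structure Definition OAG :=
  { G of Num.POrderedZmodule G & POrderedZmodule_isOAG G }.

(** * The language {+, 0, -, <, 1, ≡_n} *)

Inductive term (V : Type) : Type :=
| TVar of V
| TZero
| TOne
| TOpp of term V
| TAdd of term V & term V.

Arguments TZero {V}.
Arguments TOne {V}.

(* [formula V] has its free variables in the arbitrary type [V]; a quantifier
   binds the variable [None] of a formula over [option V].  A formula with
   variables in [I] and parameters in [W] is a [formula (I + W)]. *)
Inductive formula (V : Type) : Type :=
| FEq of term V & term V
| FLt of term V & term V
| FCong of nat & term V & term V
| FNot of formula V
| FAnd of formula V & formula V
| FEx of formula (option V).

Fixpoint qfree V (phi : formula V) : bool :=
  match phi with
  | FNot a => qfree a
  | FAnd a b => qfree a && qfree b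
  | FEx _ => false
  | _ => true
  end.

Fixpoint trename V W (s : V -> W) (t : term V) : term W :=
  match t with
  | TVar x => TVar (s x)
  | TZero => TZero
  | TOne => TOne
  | TOpp a => TOpp (trename s a)
  | TAdd a b => TAdd (trename s a) (trename s b)
  end.

Fixpoint frename V W (s : V -> W) (phi : formula V) {struct phi} : formula W :=
  match phi with
  | FEq a b => FEq (trename s a) (trename s b)
  | FLt a b => FLt (trename s a) (trename s b)
  | FCong n a b => FCong n (trename s a) (trename s b)
  | FNot a => FNot (frename s a)
  | FAnd a b => FAnd (frename s a) (frename s b)
  | FEx a => FEx (frename (omap s) a)
  end.

(* The least positive element if there is one, and 0 otherwise. *)
Definition pres_one (M : oagType) : M :=
  xget 0 [set x : M | 0 < x /\ forall y : M, 0 < y -> x <= y].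

Definition ocons T V (x : T) (v : V -> T) (o : option V) : T :=
  if o is Some i then v i else x.

Definition sjoin T I J (a : I -> T) (b : J -> T) (k : I + J) : T :=
  match k with inl i => a i | inr j => b j end.

Fixpoint teval (M : oagType) V (v : V -> M) (t : term V) : M :=
  match t with
  | TVar x => v x
  | TZero => 0
  | TOne => pres_one M
  | TOpp a => - teval v a
  | TAdd a b => teval v a + teval v b
  end.

Fixpoint holds (M : oagType) V (v : V -> M) (phi : formula V) {struct phi} :
    Prop :=
  match phi with
  | FEq a b => teval v a = teval v b
  | FLt a b => teval v a < teval v b
  | FCong n a b => exists z : M, teval v a - teval v b = z *+ n
  | FNot a => ~ holds v a
  | FAnd a b => holds v a /\ holds v b
  | FEx a => exists x : M, holds (ocons x v) a
  end.

(* The tuples [v] and [w] have the same type over the empty set.  For [V] empty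
   this is elementary equivalence of [M] and [N]; for [V] a subset of [M] and
   [v] the inclusion it says that [w] is a (partial) elementary map. *)
Definition elem_eq (M N : oagType) V (v : V -> M) (w : V -> N) : Prop :=
  forall phi : formula V, holds v phi <-> holds w phi.

Definition elem_equiv (M N : oagType) : Prop :=
  elem_eq (@of_void M) (@of_void N).

(* Quantifier elimination for the complete theory of [G]; [n = 0] is allowed, as
   the language has constants. *)
Definition regular (G : oagType) : Prop :=
  forall (n : nat) (phi : formula 'I_n),
    exists2 psi : formula 'I_n, qfree psi &
      forall v : 'I_n -> G, holds v phi <-> holds v psi.

Record elemext (U : oagType) := ElemExt {
  ext :> oagType;
  emb : U -> ext;
  _ : elem_eq (fun u : U => u) emb
}.

(** * Types *)

(* Sets of formulas in the variables [I] with parameters named by [W]; an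
   interpretation of [W] in a model is given separately.  Types over a subset
   [A] of [U] are sets of [formula (I + A)], interpreted through [val]; types
   over [U] are sets of [formula (I + U)]. *)
Definition ftype (I W : Type) := set (formula (I + W)).

Definition realizes (M : oagType) I W (e : W -> M) (c : I -> M)
    (p : ftype I W) : Prop :=
  forall phi, p phi -> holds (sjoin c e) phi.

Definition complete_type (M : oagType) I W (e : W -> M) (p : ftype I W) : Prop :=
  (forall (n : nat) (phi : 'I_n -> formula (I + W)), (forall k, p (phi k)) ->
     exists c : I -> M, forall k, holds (sjoin c e) (phi k)) /\
  (forall phi, p phi \/ p (FNot phi)).

Definition global_type (U : oagType) I (p : ftype I U) : Prop :=
  complete_type (fun u : U => u) p.

(* φ(x, w) ↦ φ(x, d w) *)
Definition inst I W W' (d : W -> W') (phi : formula (I + W)) :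
    formula (I + W') :=
  frename (sjoin inl (fun w => inr (d w))) phi.

Definition restr (U : oagType) I (A : set U) (p : ftype I U) : ftype I A :=
  [set phi | p (inst (fun a : A => val a) phi)].

Arguments restr {U I} A p.

(** * Monster models *)

(* [small K A] says |A| < |K|; the type [K] stands for a cardinal. *)
Definition small (K : Type) T (A : set T) : Prop :=
  A #<= [set: K] /\ ~ ([set: K] #<= A).

Definition strong_limit (K : Type) : Prop :=
  small K [set: nat] /\
  forall X : set K, small K X -> small K [set: set X].

Definition saturated (K : Type) (U : oagType) : Prop :=
  forall (A : set U) (p : ftype unit A), small K A ->
    complete_type (fun a : A => val a) p ->
    exists c : unit -> U, realizes (fun a : A => val a) c p.

Definition automorphism (U : oagType) (s : U -> U) : Prop :=
  [/\ bijective s, {morph s : x y / x + y} & {mono s : x y / x <= y}].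

Definition strongly_homogeneous (K : Type) (U : oagType) : Prop :=
  forall (A : set U) (f : A -> U), small K A ->
    elem_eq (fun a : A => val a) f ->
    exists2 s : U -> U, automorphism s & forall a : A, s (val a) = f a.

Definition monster (K : Type) (U : oagType) : Prop :=
  [/\ strong_limit K, saturated K U & strongly_homogeneous K U].

(** * Invariant types and domination *)

Definition equiv_over (U : oagType) (A : set U) n (d d' : 'I_n -> U) : Prop :=
  elem_eq (sjoin d (fun a : A => val a)) (sjoin d' (fun a : A => val a)).

Definition invariant_type (K : Type) (U : oagType) I (p : ftype I U) : Prop :=
  exists2 A : set U, small K A &
    forall (n : nat) (d d' : 'I_n -> U), equiv_over A d d' ->
      forall phi : formula (I + 'I_n), p (inst d phi) <-> p (inst d' phi).

(* p(x) ∪ r(x, y) ⊢ q(y) modulo the elementary diagram of [U]. *)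
Definition entails (U : oagType) I J (A : set U) (p : ftype I U)
    (r : ftype (I + J) A) (q : ftype J U) : Prop :=
  forall (V : elemext U) (a : I -> V) (b : J -> V),
    realizes (@emb U V) a p ->
    realizes (fun u : A => emb V (val u)) (sjoin a b) r ->
    realizes (@emb U V) b q.

Definition dominates (K : Type) (U : oagType) I J
    (p : ftype I U) (q : ftype J U) : Prop :=
  exists2 A : set U, small K A &
    exists r : ftype (I + J) A,
      [/\ complete_type (fun a : A => val a) r,
          forall phi, restr A p phi ->
            r (frename (sjoin (fun i => inl (inl i)) inr) phi),
          forall phi, restr A q phi ->
            r (frename (sjoin (fun j => inl (inr j)) inr) phi)
        & entails p r q].

Definition dom_equiv (K : Type) (U : oagType) I J
    (p : ftype I U) (q : ftype J U) : Prop :=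
  dominates K p q /\ dominates K q p.

(** * The invariants H and κ *)

Record realization (U : oagType) I (q : ftype I U) := Realization {
  rext :> elemext U;
  rtup : I -> rext;
  _ : realizes (@emb U rext) rtup q
}.

Definition subgroup (M : oagType) (H : set M) : Prop :=
  H 0 /\ forall x y, H x -> H y -> H (x - y).

Definition convex_subgroup (M : oagType) (H : set M) : Prop :=
  subgroup H /\ forall x y z, H x -> H z -> x <= y -> y <= z -> H y.

Definition fills (U : oagType) (V : elemext U) (H : set U) (x : V) : Prop :=
  (forall h, H h -> emb V h < x) /\
  (forall u, (forall h, H h -> h < u) -> x < emb V u).

(* U ∪ c *)
Definition base (U : oagType) I (q : ftype I U) (c : realization q) : set c :=
  range (@emb U c) `|` range (@rtup U I q c).

Arguments base {U I q} c.

Definition Hset (U : oagType) I (q : ftype I U) : set (set U) :=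
  [set H | convex_subgroup H /\
     exists (c : realization q) (x : c),
       smallest (@subgroup c) (base c) x /\ fills H x].

Definition dcl (M : oagType) (S : set M) : set M :=
  [set x | exists phi : formula (option S),
     forall y : M, holds (ocons y (fun s : S => val s)) phi <-> y = x].

(* ℓD + U; it contains ℓD, and (D/ℓD)/(U/ℓU) = D/(ℓD + U). *)
Definition kappa_sub (U : oagType) I (q : ftype I U) (l : nat)
    (c : realization q) : set c :=
  [set x | exists d : c, dcl (base c) d /\ exists u : U, x = d *+ l + emb c u].

Arguments kappa_sub {U I q} l c.

(* [B] is a set of representatives, one for each vector, of a basis of the
   'F_l-vector space D/(ℓD + U). *)
Definition kappa_basis (U : oagType) I (q : ftype I U) (l : nat)
    (c : realization q) (B : set c) : Prop :=
  [/\ B `<=` dcl (base c),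
      forall (n : nat) (b : 'I_n -> c) (k : 'I_n -> 'F_l),
        injective b -> (forall i, B (b i)) ->
        kappa_sub l c (\sum_(i < n) b i *+ k i) -> forall i, k i = 0
    & forall x : c, dcl (base c) x ->
        exists (n : nat) (b : 'I_n -> c) (k : 'I_n -> 'F_l),
          (forall i, B (b i)) /\ kappa_sub l c (x - \sum_(i < n) b i *+ k i)].

(* κ_ℓ(q) ≤ κ_ℓ(p) and κ_ℓ(p) = κ_ℓ(q); the cardinal κ_ℓ(q) does not depend on
   the realization or on the basis. *)
Definition kappa_le (U : oagType) I J (l : nat) (q : ftype J U)
    (p : ftype I U) : Prop :=
  exists (c : realization q) (B : set c) (d : realization p) (C : set d),
    [/\ kappa_basis l B, kappa_basis l C & B #<= C].

Definition kappa_eq (U : oagType) I J (l : nat) (p : ftype I U)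
    (q : ftype J U) : Prop :=
  exists (c : realization p) (B : set c) (d : realization q) (C : set d),
    [/\ kappa_basis l B, kappa_basis l C & B #= C].

(* Main.v *)
Require Import Defs.
From Stdlib Require List.
From HB Require Import structures.
From mathcomp Require Import all_boot all_order all_algebra.
From mathcomp Require Import boolp classical_sets functions cardinality filter.
From mathcomp Require Import zify.

(** Fix realizations c of q and b of p.  By quantifier elimination a type over U
    is given by the cuts in U and the congruence classes modulo the cosets of U
    of the integer combinations t(c).

    If p dominates q through r over A, the type of (b, c) over A determines q
    modulo p.  An element t(c) filling a convex subgroup H that no element of
    ⟨U b⟩ fills could be moved out of the cut of H, unless the small group
    generated by A and b had elements cofinal in H and coinitial above H; this
    contradicts saturation.  Similarly, an element of dcl(U c) outside
    ℓV + U + dcl(U b) could be made congruent modulo ℓ to an element of U, so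
    dcl(U c) has no more ℓ-classes over U than dcl(U b).

    Conversely, invariance shows that a multiple of ±t(c) has a cut of the form
    a ± H with small cofinality on one side, so that this cut is also filled by
    an element w(b), and a condition t(y) < w(x) forces it modulo p.  The
    hypothesis on κ gives an embedding of residue classes which forces the
    congruences of t(y) modulo p.  These conditions are consistent because
    finitely many of them can be realized by a small perturbation of c. *)

Set Implicit Arguments.
Unset Strict Implicit.
Unset Printing Implicit Defensive.

Import Order.TTheory GRing.Theory Num.Theory.
Local Open Scope classical_set_scope.
Local Open Scope ring_scope.
Local Open Scope card_scope.

(** * Ordered abelian groups *)

(** Everything rests on one independence principle: in a regular group each residue class modulo N >
    0 meets every interval (0, d) with d beyond the standard integers. Order conditions and
    congruences can hence be arranged separately, the former by staying near a given element, the
    latter by a tiny correction. The obstacle is exact linear relations over U, which no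
    perturbation may break; they are the reason for the coherence conditions on the chosen residues.
    Invariance matters because a small type can decide only one side of a cut of U, the one with
    small cofinality. The other side has to be read off from p, through the inequality with w(b).
    The hypothesis on κ speaks of primes only. Prime powers are reached by torsion-freeness and by
    purity of U in its extensions, all moduli by the Chinese remainder theorem. The partners so
    obtained are not unique and need not be additive in t, so residues are matched by subgroups of
    pairs, and a partner is then chosen for each term and modulus. *)

Inductive zexpr :=
| ZVar of nat | ZZero | ZOpp of zexpr | ZAdd of zexpr & zexpr
| ZMuln of zexpr & nat.

Fixpoint zeval (M : zmodType) (env : seq M) (e : zexpr) : M :=
  match e with
  | ZVar i => nth 0 env i
  | ZZero => 0
  | ZOpp a => - zeval env a
  | ZAdd a b => zeval env a + zeval env b
  | ZMuln a n => zeval env a *+ n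
  end.

Fixpoint zcoef (i : nat) (e : zexpr) : int :=
  match e with
  | ZVar j => (i == j)%:Z
  | ZZero => 0
  | ZOpp a => - zcoef i a
  | ZAdd a b => zcoef i a + zcoef i b
  | ZMuln a n => zcoef i a *+ n
  end.

Lemma zevalE (M : zmodType) (env : seq M) (e : zexpr) :
  zeval env e = \sum_(i < size env) env`_i *~ zcoef i e.
Proof.
elim: e => /= [j||a ->|a -> b ->|a -> n].
- have [lt_j|le_j] := ltnP j (size env); last first.
    rewrite nth_default // big1 // => i _.
    by rewrite (ltn_eqF (leq_trans (ltn_ord i) le_j)) mulr0z.
  rewrite (bigD1 (Ordinal lt_j)) //= eqxx mulr1z big1 ?addr0 // => i ne_ij.
  by rewrite -val_eqE /= in ne_ij; rewrite (negbTE ne_ij) mulr0z.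
- by rewrite big1.
- by rewrite -sumrN; apply: eq_bigr => i _; rewrite mulrNz.
- by rewrite -big_split; apply: eq_bigr => i _; rewrite mulrzDr.
- by rewrite -sumrMnl; apply: eq_bigr => i _; rewrite -mulr_natr natz mulrzA -pmulrn.
Qed.

Lemma zeval_eq (M : zmodType) (env : seq M) (e1 e2 : zexpr) :
  all (fun i => zcoef i e1 == zcoef i e2) (iota 0 (size env)) ->
  zeval env e1 = zeval env e2.
Proof.
move=> /allP h; rewrite !zevalE; apply: eq_bigr => i _.
by have := h i; rewrite mem_iota add0n ltn_ord => /(_ isT)/eqP ->.
Qed.

Ltac zlit n :=
  lazymatch n with O => constr:(true) | S ?m => zlit m | _ => constr:(false) end.
Ltac zsame x y := match goal with _ => unify x y end.
Ltac zfind x env :=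
  lazymatch env with
  | nil => constr:(O)
  | cons ?y ?r =>
      match constr:(O) with
      | _ => let _ := zsame x y in constr:(O)
      | _ => let i := zfind x r in constr:(S i)
      end
  end.
Ltac zadd x env :=
  lazymatch env with
  | nil => constr:(cons x env)
  | cons ?y ?r =>
      match constr:(O) with
      | _ => let _ := zsame x y in constr:(env)
      | _ => let r' := zadd x r in constr:(cons y r')
      end
  end.
Ltac zatoms t env :=
  lazymatch t with
  | GRing.add ?a ?b => let env' := zatoms a env in zatoms b env'
  | GRing.opp ?a => zatoms a env
  | GRing.zero => constr:(env)
  | GRing.natmul ?a ?n =>
      lazymatch zlit n with true => zatoms a env | _ => zadd t env end
  | _ => zadd t env
  end.
Ltac zreify t env :=
  lazymatch t with
  | GRing.add ?a ?b =>
      let a' := zreify a env in let b' := zreify b env in constr:(ZAdd a' b')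
  | GRing.opp ?a => let a' := zreify a env in constr:(ZOpp a')
  | GRing.zero => constr:(ZZero)
  | GRing.natmul ?a ?n =>
      lazymatch zlit n with
      | true => let a' := zreify a env in constr:(ZMuln a' n)
      | _ => let i := zfind t env in constr:(ZVar i)
      end
  | _ => let i := zfind t env in constr:(ZVar i)
  end.
(** Decides identities of abelian groups by reflection: both sides are reified over one list of
    atoms, and [isT] lets the kernel compare integer coefficients. Atoms are compared by
    unification, so convertible spellings are shared. *)
Ltac zmod :=
  lazymatch goal with
  | |- @eq ?T ?a ?b =>
      let env := zatoms a (@nil T) in
      let env := zatoms b env in
      let e1 := zreify a env in
      let e2 := zreify b env in
      exact: (@zeval_eq _ env e1 e2 isT)
  end.

Section OrderedGroups.
Variable M : oagType.
Implicit Types (x y z a b c d : M) (n m k : nat).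

(** This lemma and its variants below stand in for linear arithmetic: [b - a] is displayed as a sum
    of nonnegative differences, and the side equation is left to [zmod]. *)
Lemma ole0 a b c : 0 <= c -> b - a = c -> a <= b.
Proof.
move=> h e; have := oag_lerD2 _ _ a h.
by rewrite add0r (_ : c + a = b) // -e; zmod.
Qed.

Lemma oge0 a b : a <= b -> 0 <= b - a.
Proof. by move=> h; have := oag_lerD2 _ _ (- a) h; rewrite addrN. Qed.

Lemma oadd_ge0 a b : 0 <= a -> 0 <= b -> 0 <= a + b.
Proof. by move=> ha hb; apply: (le_trans hb); apply: (ole0 ha); zmod. Qed.

Lemma ole1 a b c d : c <= d -> b - a = d - c -> a <= b.
Proof. by move=> /oge0; apply: ole0. Qed.

Lemma ole2 a b c d c' d' :
  c <= d -> c' <= d' -> b - a = (d - c) + (d' - c') -> a <= b.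
Proof. by move=> /oge0 h /oge0 h'; apply: ole0; apply: oadd_ge0. Qed.

Lemma ole3 a b c d c' d' e f :
  c <= d -> c' <= d' -> e <= f ->
  b - a = (d - c) + (d' - c') + (f - e) -> a <= b.
Proof.
by move=> /oge0 h /oge0 h' /oge0 h''; apply: ole0 (oadd_ge0 (oadd_ge0 h h') h'').
Qed.

Lemma olt1 a b c d : c < d -> b - a = d - c -> a < b.
Proof.
rewrite !lt_def => /andP[ne le] e; rewrite (ole1 le e) andbT.
by apply: contra ne => /eqP eab; rewrite -subr_eq0 -e eab subrr.
Qed.

Lemma olt2 a b c d c' d' :
  c < d -> c' <= d' -> b - a = (d - c) + (d' - c') -> a < b.
Proof.
move=> h h' e; apply: (@lt_le_trans _ _ (a + (d - c))).
  by apply: (olt1 h); zmod.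
by apply: (ole1 h'); rewrite (_ : b = a + (b - a)); [rewrite e|]; zmod.
Qed.

Lemma olt3 a b c d c' d' e f :
  c < d -> c' <= d' -> e <= f ->
  b - a = (d - c) + (d' - c') + (f - e) -> a < b.
Proof.
move=> h h' h'' eq; apply: (@lt_le_trans _ _ (a + (d - c) + (d' - c'))).
  by apply: (olt2 h h'); zmod.
by apply: (ole1 h''); rewrite (_ : b = a + (b - a)); [rewrite eq|]; zmod.
Qed.

Lemma ole_total x y : (x <= y) || (y <= x).
Proof. exact: oag_le_total. Qed.

Lemma oltNge x y : (x < y) = ~~ (y <= x).
Proof.
apply/idP/idP => [h|h]; first by rewrite (lt_geF h).
have := ole_total x y; rewrite (negbTE h) orbF => le.
rewrite lt_def le andbT; apply: contraNN h => /eqP ->; exact: lexx.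
Qed.

Lemma oleNgt x y : (x <= y) = ~~ (y < x).
Proof. by rewrite oltNge negbK. Qed.

Lemma oltP x y : x < y \/ y <= x.
Proof. by rewrite oltNge; case: (y <= x); [right|left]. Qed.

Lemma otrichotomy x y : [\/ x < y, x = y | y < x].
Proof.
have [|] := oltP x y; first by constructor 1.
by rewrite le_eqVlt => /orP[/eqP ->|]; [constructor 2|constructor 3].
Qed.

Lemma oltF x (P : Prop) : x < x -> P.
Proof. by rewrite ltxx. Qed.

Lemma omuln_ge0 x n : 0 <= x -> 0 <= x *+ n.
Proof.
move=> h; elim: n => [|n ih]; first by rewrite mulr0n.
by rewrite mulrS; apply: oadd_ge0.
Qed.

Lemma omuln_le x y n : x <= y -> x *+ n <= y *+ n.
Proof.
by move=> h; apply: (ole0 (omuln_ge0 n (oge0 h))); rewrite mulrnBl.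
Qed.

Lemma omuln_gt0 x n : 0 < x -> (0 < n)%N -> 0 < x *+ n.
Proof.
case: n => // n h _; rewrite mulrS.
by apply: (olt2 h (omuln_ge0 n (ltW h))); zmod.
Qed.

Lemma omuln_lt x y n : x < y -> (0 < n)%N -> x *+ n < y *+ n.
Proof.
move=> h n0; have hh : 0 < y - x by apply: (olt1 h); zmod.
by apply: (olt1 (omuln_gt0 hh n0)); rewrite mulrnBl; zmod.
Qed.

Lemma oltMn x y n : (0 < n)%N -> (x *+ n < y *+ n) = (x < y).
Proof.
move=> n0; apply/idP/idP => [|/omuln_lt]; last by apply.
by apply: contraTT; rewrite -!oleNgt => /omuln_le.
Qed.

Lemma oleMn x y n : (0 < n)%N -> (x *+ n <= y *+ n) = (x <= y).
Proof. by move=> n0; rewrite !oleNgt oltMn. Qed.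

Lemma omuln_inj n : (0 < n)%N -> injective (fun x : M => x *+ n).
Proof.
by move=> n0 x y e; case: (otrichotomy x y) => // /omuln_lt/(_ n0);
  rewrite e ltxx.
Qed.

Lemma omuln_geS x n m : 0 <= x -> (n <= m)%N -> x *+ n <= x *+ m.
Proof.
move=> h /subnK <-; apply: (ole0 (omuln_ge0 (m - n) h)).
by rewrite mulrnDr; zmod.
Qed.

Lemma ole_mulnr x n : 0 <= x -> (0 < n)%N -> x <= x *+ n.
Proof. by move=> h n0; rewrite -[leLHS]mulr1n; apply: omuln_geS. Qed.

Local Notation one := (pres_one M).

Lemma pres_oneE o : 0 < o -> (forall y, 0 < y -> o <= y) -> one = o.
Proof.
move=> o0 ho; rewrite /pres_one; case: xgetP => [z _ [z0 hz]|/(_ o)[]//].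
by apply/eqP; rewrite eq_le hz // ho.
Qed.

Lemma pres_one0 : (forall x, 0 < x -> exists2 y, 0 < y & y < x) -> one = 0.
Proof.
move=> h; rewrite /pres_one; case: xgetP => [z _ [z0 hz]|//].
by have [y y0] := h z z0; rewrite oltNge hz.
Qed.

Lemma pres_one_ge0 : 0 <= one.
Proof.
rewrite /pres_one; case: xgetP => [x -> [/ltW]|] //.
Qed.

Lemma pres_one_le x : 0 < one -> 0 < x -> one <= x.
Proof.
rewrite /pres_one; case: xgetP => [y -> [_ h] _ /h|_]; last by rewrite ltxx.
by [].
Qed.

Lemma pres_one_le' x : 0 < x -> one <= x.
Proof.
move=> x0; have := pres_one_ge0; rewrite le_eqVlt => /orP[/eqP <-|].
  exact: ltW.
by move/pres_one_le; apply.
Qed.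

(* An archimedean-infinite element: positive and, in the discrete case, larger
   than every standard integer. *)
Definition big x := forall m, one *+ m < x.

Lemma big_gt0 x : big x -> 0 < x.
Proof. by move=> /(_ 0%N); rewrite mulr0n. Qed.

Lemma big_le x y : big x -> x <= y -> big y.
Proof. by move=> h le m; apply: lt_le_trans (h m) le. Qed.

(** A positive element is at least [one], so [one] can be subtracted until 0 is reached. *)
Lemma near_one_ge0 x m : 0 <= x -> x <= one *+ m -> exists n, x = one *+ n.
Proof.
elim: m x => [|m ih] x x0; first by rewrite mulr0n => xle; exists 0%N;
  apply/eqP; rewrite mulr0n eq_le xle.
move=> xm; move: x0; rewrite le_eqVlt => /orP[/eqP <-|x0].
  by exists 0%N.
have [||n e] := ih (x - one).
- by apply: (ole1 (pres_one_le' x0)); zmod.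
- by apply: (ole1 xm); rewrite mulrS; zmod.
by exists n.+1; rewrite mulrS -e; zmod.
Qed.

Lemma not_near_one x : (forall z : int, x <> one *~ z) -> 0 < x -> big x.
Proof.
move=> h x0 m; rewrite oltNge; apply/negP => le.
have [n e] := near_one_ge0 (ltW x0) le; exact: (h n%:Z).
Qed.

End OrderedGroups.

(** * Syntax *)

Lemma teval_rename (M : oagType) V W (s : V -> W) (v : W -> M) (t : term V) :
  teval v (trename s t) = teval (v \o s) t.
Proof. by elim: t => //= [a ->|a -> b ->]. Qed.

Lemma ocons_omap T V W (x : T) (s : V -> W) (v : W -> T) :
  ocons x v \o omap s = ocons x (v \o s).
Proof. by apply: funext; case. Qed.

Lemma holds_rename (M : oagType) V W (s : V -> W) (v : W -> M)
    (phi : formula V) :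
  holds v (frename s phi) <-> holds (v \o s) phi.
Proof.
elim: phi W s v => {V} [V a b|V a b|V n a b|V a iha|V a iha b ihb|V a iha] W s v
  //=; rewrite ?teval_rename //.
- by split=> h; apply/(contra_not _ h); apply iha.
- by rewrite iha ihb.
- by split=> -[x hx]; exists x; move: hx; rewrite iha ocons_omap.
Qed.

Lemma elem_eq_rename (M N : oagType) V W (s : V -> W) (v : W -> M) (w : W -> N) :
  elem_eq v w -> elem_eq (v \o s) (w \o s).
Proof. by move=> h phi; split=> /holds_rename/h/holds_rename. Qed.

Arguments elem_eq_rename {M N V W} s {v w} _ phi.

Lemma elem_eq_sym (M N : oagType) V (v : V -> M) (w : V -> N) :
  elem_eq v w -> elem_eq w v.
Proof. by move=> h phi; rewrite h. Qed.

Lemma elem_eq_trans (M N P : oagType) V (v : V -> M) (w : V -> N) (u : V -> P) :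
  elem_eq v w -> elem_eq w u -> elem_eq v u.
Proof. by move=> h h' phi; rewrite h h'. Qed.

(** Variables range over arbitrary, possibly infinite types; the finitely many that occur are what
    finite satisfiability and unions of chains depend on. *)
Fixpoint tocc V (x : V) (t : term V) : Prop :=
  match t with
  | TVar y => y = x
  | TOpp a => tocc x a
  | TAdd a b => tocc x a \/ tocc x b
  | _ => False
  end.

Fixpoint focc V (x : V) (phi : formula V) {struct phi} : Prop :=
  match phi with
  | FEq a b | FLt a b | FCong _ a b => tocc x a \/ tocc x b
  | FNot a => focc x a
  | FAnd a b => focc x a \/ focc x b
  | FEx a => focc (Some x) a
  end.

Lemma teval_occ (M : oagType) V (v w : V -> M) (t : term V) :
  (forall x, tocc x t -> v x = w x) -> teval v t = teval w t.
Proof.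
elim: t => //= [x h|a ih h|a iha b ihb h]; first exact: h.
  by rewrite ih.
by rewrite iha ?ihb // => x hx; apply: h; [right|left].
Qed.

Lemma holds_occ (M : oagType) V (v w : V -> M) (phi : formula V) :
  (forall x, focc x phi -> v x = w x) -> holds v phi <-> holds w phi.
Proof.
elim: phi v w => {V} [V a b|V a b|V n a b|V a iha|V a iha b ihb|V a iha] v w
  /= h.
1-3: have -> : teval v a = teval w a by apply: teval_occ => x hx; apply: h; left.
1-3: have -> // : teval v b = teval w b
     by apply: teval_occ => x hx; apply: h; right.
- by rewrite (iha _ _ h).
- rewrite (iha v w) ?(ihb v w) // => x hx; apply: h; [right|left] => //.
- by split=> -[x hx]; exists x; move: hx; rewrite (iha _ (ocons x w)) //;
    case=> [y|] //= hy; rewrite h.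
Qed.

Lemma holds_occ1 (M : oagType) V (v w : V -> M) (phi : formula V) :
  holds v phi -> (forall x, focc x phi -> v x = w x) -> holds w phi.
Proof. by move=> h /holds_occ [+ _]; apply. Qed.

Lemma tocc_fin V (t : term V) : exists s, forall x, tocc x t -> List.In x s.
Proof.
elim: t => /= [x||||a [s hs] b [s' hs']].
- by exists [:: x] => y; left.
- by exists [::].
- by exists [::].
- by [].
exists (s ++ s') => x h; apply/List.in_app_iff.
by case: h => h; [left; apply: hs|right; apply: hs'].
Qed.

Lemma focc_fin V (phi : formula V) :
  exists s, forall x, focc x phi -> List.In x s.
Proof.
elim: phi => {V} [V a b|V a b|V n a b|V a iha|V a [s hs] b [s' hs']|V a [s hs]]
  /=.
1-3: have [s hs] := tocc_fin a; have [s' hs'] := tocc_fin b;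
   exists (s ++ s') => x h; apply/List.in_app_iff;
   by case: h => h; [left; apply: hs|right; apply: hs'].
- by [].
- exists (s ++ s') => x h; apply/List.in_app_iff.
  by case: h => h; [left; apply: hs|right; apply: hs'].
exists (pmap id s) => x /hs; elim: s {hs} => //= o s ih [->|/ih h] /=.
  by left.
by case: o => //= y; right.
Qed.

Lemma tocc_rename V W (s : V -> W) (t : term V) y :
  tocc y (trename s t) -> exists2 x, tocc x t & s x = y.
Proof.
elim: t => //= [x <-|a iha b ihb]; first by exists x.
by case=> [/iha|/ihb] [x hx <-]; exists x; auto.
Qed.

Lemma focc_rename V W (s : V -> W) (phi : formula V) y :
  focc y (frename s phi) -> exists2 x, focc x phi & s x = y.
Proof.
move: W s y; elim: V / phi => [V a b|V a b|V n a b|V a iha|V a iha b ihb|V a iha]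
  W s y /=.
1-3: by case=> h; have [x hx <-] := tocc_rename h; exists x; auto.
- exact: iha.
- by case=> h; [have [x hx <-] := iha _ _ _ h|have [x hx <-] := ihb _ _ _ h];
    exists x; auto.
- by move=> h; have [[x|] //= hx [<-]] := iha _ _ _ h; exists x.
Qed.

Lemma term_lift V W (f : V -> W) (t : term W) :
  (forall y, tocc y t -> exists x, f x = y) -> exists t', trename f t' = t.
Proof.
elim: t => /= [y|||a ih|a iha b ihb] h.
- by have [x <-] := h y erefl; exists (TVar x).
- by exists TZero.
- by exists TOne.
- by have [a' <-] := ih h; exists (TOpp a').
- have [|a' <-] := iha; first by move=> y hy; apply: h; left.
  have [|b' <-] := ihb; first by move=> y hy; apply: h; right.
  by exists (TAdd a' b').
Qed.

Lemma formula_lift V W (f : V -> W) (phi : formula W) :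
  (forall y, focc y phi -> exists x, f x = y) ->
  exists phi', frename f phi' = phi.
Proof.
elim: phi V f => {W} [W a b|W a b|W n a b|W a iha|W a iha b ihb|W a iha] V f
  /= h.
1-3: have [|a' <-] := @term_lift _ _ f a; [by move=> y hy; apply: h; left|].
1-3: have [|b' <-] := @term_lift _ _ f b; [by move=> y hy; apply: h; right|].
- by exists (FEq a' b').
- by exists (FLt a' b').
- by exists (FCong n a' b').
- by have [a' <-] := iha _ f h; exists (FNot a').
- have [|a' <-] := iha _ f; first by move=> y hy; apply: h; left.
  have [|b' <-] := ihb _ f; first by move=> y hy; apply: h; right.
  by exists (FAnd a' b').
- have [|a' <-] := iha _ (omap f); last by exists (FEx a').
  by case=> [y /h[x <-]|_]; [exists (Some x)|exists None].
Qed.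

(** The variables of the tuple that occur are quantified away along a finite list. One formula
    serves all models, so satisfiability by a tuple can be moved along elementary maps. *)
Lemma exists_closure V W (phi : formula (V + W)) :
  exists psi : formula W, forall (M : oagType) (e : W -> M),
    holds e psi <-> exists c : V -> M, holds (sjoin c e) phi.
Proof.
have [s hs] : exists s, forall x, focc (inl x) phi -> List.In x s.
  have [s hs] := focc_fin phi.
  exists (pmap (fun k => if k is inl x then Some x else None) s) => x /hs.
  elim: s {hs} => //= o s ih [->|/ih h] /=; first by left.
  by case: o => //= y; right.
elim: s W phi hs => /= [|x s ih] W phi hs.
  (* A dummy quantifier: the renaming needs a target for [inl], and [W] may be empty. *)
  exists (FEx (frename (fun k => if k is inr w then Some w else None) phi)).
  move=> M e /=; split=> -[x hx].
    exists (fun=> x); move: hx; rewrite holds_rename => /holds_occ1; apply.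
    by case=> [v /hs|].
  exists 0; rewrite holds_rename; apply: (holds_occ1 hx).
  by case=> [v /hs|].
pose r (k : V + W) : V + option W :=
  match k with
  | inl y => if pselect (y = x) then inr None else inl y
  | inr w => inr (Some w)
  end.
have [y|psi hpsi] := ih _ (frename r phi).
  move=> h; have [[z|w] //=] := focc_rename h; case: pselect => // ne hz [<-].
  by case: (hs _ hz) => // e; case: ne.
exists (FEx psi) => M e /=; split.
  move=> [z /hpsi[c]]; rewrite holds_rename => h.
  exists (fun y => if pselect (y = x) then z else c y).
  by apply: (holds_occ1 h) => -[y|w] _ //=; case: pselect.
move=> [c h]; exists (c x); apply/hpsi; exists c; rewrite holds_rename.
apply: (holds_occ1 h) => -[y|w] _ //=.
by case: pselect => [yx|//] /=; rewrite yx.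
Qed.

Definition FImp V (a b : formula V) := FNot (FAnd a (FNot b)).

Lemma holds_imp (M : oagType) V (v : V -> M) a b :
  holds v (FImp a b) <-> (holds v a -> holds v b).
Proof.
split=> /= [h ha|h [ha]]; last by apply; apply: h.
by apply: contrapT => hb; apply: h.
Qed.

Definition FConj V (s : seq (formula V)) : formula V :=
  foldr (@FAnd V) (FEq TZero TZero) s.

Lemma holds_conj (M : oagType) V (v : V -> M) s :
  holds v (FConj s) <-> forall a, List.In a s -> holds v a.
Proof.
elim: s => /= [|a s ih]; first by split.
rewrite ih; split=> [[ha h] b [<-|/h]|h] //.
by split=> [|b hb]; apply: h; [left|right].
Qed.

Fixpoint tcoef W (t : term (option W)) : int :=
  match t with
  | TVar None => 1
  | TOpp a => - tcoef a
  | TAdd a b => tcoef a + tcoef b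
  | _ => 0
  end.

Fixpoint trest W (t : term (option W)) : term W :=
  match t with
  | TVar None => TZero
  | TVar (Some w) => TVar w
  | TZero => TZero
  | TOne => TOne
  | TOpp a => TOpp (trest a)
  | TAdd a b => TAdd (trest a) (trest b)
  end.

Lemma teval_coef (M : oagType) W (z : M) (v : W -> M) (t : term (option W)) :
  teval (ocons z v) t = z *~ tcoef t + teval v (trest t).
Proof.
elim: t => /= [[w|]|||a ->|a -> b ->] /=; rewrite ?mulr0z ?mulr1z ?add0r ?addr0 //.
  by rewrite mulrNz opprD.
by rewrite mulrzDr; zmod.
Qed.

Fixpoint tsubst V W (s : V -> term W) (t : term V) : term W :=
  match t with
  | TVar x => s x
  | TZero => TZero
  | TOne => TOne
  | TOpp a => TOpp (tsubst s a)
  | TAdd a b => TAdd (tsubst s a) (tsubst s b)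
  end.

Lemma teval_subst (M : oagType) V W (s : V -> term W) (v : W -> M) (t : term V) :
  teval v (tsubst s t) = teval (fun x => teval v (s x)) t.
Proof. by elim: t => //= [a ->|a -> b ->]. Qed.

Definition TMuln V (t : term V) n := iter n (TAdd t) TZero.

Lemma teval_muln (M : oagType) V (v : V -> M) (t : term V) n :
  teval v (TMuln t n) = teval v t *+ n.
Proof. by elim: n => //= n ->; rewrite mulrS. Qed.

Definition TMulz V (t : term V) (z : int) :=
  match z with Posz n => TMuln t n | Negz n => TOpp (TMuln t n.+1) end.

Lemma teval_mulz (M : oagType) V (v : V -> M) (t : term V) z :
  teval v (TMulz t z) = teval v t *~ z.
Proof.
case: z => n /=; first by rewrite teval_muln pmulrn.
by rewrite teval_muln NegzE mulrNz -pmulrn mulrS.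
Qed.

(** * Small cardinals *)

Lemma card_le_injE T W (A : set T) (B : set W) :
  (A #<= B) <-> exists f : A -> B, injective f.
Proof.
split=> [/card_leP/injfunPex[f _ injf]|[f injf]].
  by exists f => x y; apply: injf; rewrite inE.
by apply/card_leP/injfunPex; exists f => // x y _ _; apply: injf.
Qed.

Lemma card_leT_inj T W : ([set: T] #<= [set: W]) <-> exists f : T -> W, injective f.
Proof.
rewrite card_le_injE; split=> [[f injf]|[f injf]].
  pose g x : [set: T] := exist _ x (mem_set I).
  by exists (fun x => val (f (g x))) => x y /val_inj/injf[].
exists (fun x => exist _ (f (val x)) (mem_set I)) => x y [] /injf.
exact: val_inj.
Qed.

(** The graph of a maximal partial injection covers one of the two sides, as otherwise one more pair
    could be added. *)
Lemma inj_comparable (T W : Type) :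
  (exists f : T -> W, injective f) \/ (exists f : W -> T, injective f).
Proof.
pose P (g : set (T * W)) :=
  forall a b, g a -> g b -> a.1 = b.1 <-> a.2 = b.2.
have [|g [Pg maxg]] := @Zorn_bigcup _ P.
  move=> F FP totF a b [X FX Xa] [Y FY Yb].
  by have [/(_ _ Xa) Ya|/(_ _ Yb) Xb] := totF _ _ FX FY;
    [apply: (FP _ FY)|apply: (FP _ FX)].
have [domg|/existsNP[x nx]] := pselect (forall x, exists y, g (x, y)).
  left; have /choice[f fg] := domg.
  by exists f => x x' e; apply/(Pg _ _ (fg x) (fg x')).
have [rang|/existsNP[y ny]] := pselect (forall y, exists x, g (x, y)).
  right; have /choice[f fg] := rang.
  by exists f => y y' e; apply/(Pg _ _ (fg y) (fg y')).
case: (maxg (g `|` [set (x, y)])).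
  rewrite properEneq; split; last exact: subsetUl.
  by apply/eqP => e; apply: nx; exists y; rewrite e; right.
move=> [a a'] [b b'] [ga|[-> ->]] [gb|[-> ->]] //=; first exact: (Pg _ _ ga gb).
  by split=> e; [case: nx; exists a'|case: ny; exists a]; rewrite -e.
by split=> e; [case: nx; exists b'|case: ny; exists b]; rewrite e.
Qed.

Section Small.
Variable K : Type.
Local Notation smallT X := (small K [set: X]).

Lemma small_cardle T W (A : set T) (B : set W) :
  A #<= B -> small K B -> small K A.
Proof.
move=> AB [BK KB]; split; first exact: card_le_trans AB BK.
by move=> KA; apply: KB; apply: card_le_trans KA AB.
Qed.

Lemma small_sub T (A B : set T) : A `<=` B -> small K B -> small K A.
Proof. by move=> /subset_card_le; apply: small_cardle. Qed.

Lemma small_inj T W (f : T -> W) : injective f -> smallT W -> smallT T.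
Proof. by move=> h; apply: small_cardle; apply/card_leT_inj; exists f. Qed.

Lemma small_range T W (f : T -> W) : smallT T -> small K (range f).
Proof. by apply: small_cardle; exact: card_image_le. Qed.

Lemma small_type T (A : set T) : small K A -> smallT A.
Proof.
apply: small_cardle; apply/card_le_injE.
by exists val => x y /val_inj.
Qed.

Hypothesis slK : strong_limit K.

Lemma small_nat : smallT nat. Proof. by case: slK. Qed.

(** [strong_limit] speaks of subsets of [K] only; an injection into [K] transports the power
    type. *)
Lemma small_set T : smallT T -> smallT (set T).
Proof.
move=> sT; have [/card_leT_inj[f injf] _] := sT.
have := slK.2 _ (small_range f sT); apply: small_inj.
instantiate (1 := fun S => [set k | exists2 t, S t & f t = val k]).
move=> S S' e; apply/seteqP.
have key t : S t <-> S' t.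
  have := congr1 (fun X => X (exist _ (f t) (mem_set (imageP f I)))) e.
  rewrite /= => {}e; split=> ht.
    have [t' St' /injf <- //] : exists2 t', S' t' & f t' = f t.
      by rewrite -e; exists t.
  have [t' St' /injf <- //] : exists2 t', S t' & f t' = f t.
    by rewrite e; exists t.
by split=> t /key.
Qed.

(** Cardinal arithmetic is replaced by codes in power sets, which stay small: two copies of [X] are
    told apart by {{x}} and {{x}, ∅}, and comparability reduces a general sum to this case. *)
Lemma small_sum T W : smallT T -> smallT W -> smallT (T + W).
Proof.
have key X : smallT X -> smallT (X + X).
  move=> sX; have := small_set (small_set sX); apply: small_inj.
  instantiate (1 := fun k => match k with
    inl x => [set [set x]] | inr x => [set [set x]; set0] end).
  have h1 (x : X) : [set x] <> set0.
    by move=> e; have : [set x] x by []; rewrite e.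
  have h (x y : X) : [set [set x]] <> [set [set y]; set0].
    move=> e; have : [set [set x]] set0 by rewrite e; right.
    by rewrite /= => /esym; apply: h1.
  case=> x [] y // e.
  - have : [set [set y]] [set x] by rewrite -e.
    rewrite /= => e'; have : [set y] x by rewrite -e'.
    by move=> ->.
  - by case: (h _ _ e).
  - by case: (h y x).
  - have : [set [set y]; set0] [set x] by rewrite -e; left.
    case=> [/= e'|/h1 //].
    have : [set y] x by rewrite -e'.
    by move=> ->.
move=> sT sW; have [[f injf]|[f injf]] := inj_comparable T W.
  apply: small_inj (key _ sW).
  instantiate (1 := fun k => match k with inl x => inl (f x) | inr y => inr y end).
  by case=> x [] y // []; [move=> /injf ->|move=> ->].
apply: small_inj (key _ sT).
instantiate (1 := fun k => match k with inl x => inl x | inr y => inr (f y) end).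
by case=> x [] y // []; [move=> ->|move=> /injf ->].
Qed.

Lemma small_prod T W : smallT T -> smallT W -> smallT (T * W).
Proof.
move=> sT sW; apply: small_inj (small_set (small_sum sT sW)).
instantiate (1 := fun a => [set inl a.1; inr a.2]).
move=> [x y] [x' y'] /= e; congr (_, _).
  have : [set inl x'; inr y'] (@inl T W x) by rewrite -e; left.
  by case=> [[]|].
have : [set inl x'; inr y'] (@inr T W y) by rewrite -e; right.
by case=> [|[]].
Qed.

Lemma small_unit : smallT unit.
Proof. by apply: small_inj small_nat; instantiate (1 := fun=> 0%N); case=> -[]. Qed.

Lemma small_option T : smallT T -> smallT (option T).
Proof.
move=> sT; apply: small_inj (small_sum small_unit sT).
instantiate (1 := fun o => if o is Some x then inr x else inl tt).
by case=> [x|] [y|] // [->].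
Qed.

Lemma small_seq T : smallT T -> smallT (seq T).
Proof.
move=> sT; apply: small_inj (small_set (small_prod small_nat sT)).
instantiate (1 := fun s => [set a | onth s a.1 = Some a.2]).
move=> s s' e; have {}e i : onth s i = onth s' i.
  have h x : onth s i = Some x <-> onth s' i = Some x.
    by have := congr1 (fun S => S (i, x)) e; rewrite /= => ->.
  case E: (onth s i) => [x|]; first by apply/esym/h.
  by case E': (onth s' i) => [x|//]; move/h: E'; rewrite E.
elim: s s' e => [|x s ih] [|x' s'] e //; first by have := e 0%N.
  by have := e 0%N.
by have [->] := e 0%N; rewrite (ih s') // => i; have := e i.+1.
Qed.

Lemma small_setU T (A B : set T) : small K A -> small K B -> small K (A `|` B).
Proof.
move=> /small_type sA /small_type sB.
apply: small_sub (small_range (sjoin (fun a : A => val a) (fun b : B => val b))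
  (small_sum sA sB)) => x [Ax|Bx].
  by exists (inl (exist _ x (mem_set Ax))).
by exists (inr (exist _ x (mem_set Bx))).
Qed.

(** A prefix code: no code is a proper prefix of another, which is why injectivity is proved with
    arbitrary continuations. *)
Fixpoint tcode V (t : term V) : seq (V + nat) :=
  match t with
  | TVar x => [:: inl x]
  | TZero => [:: inr 0%N]
  | TOne => [:: inr 1%N]
  | TOpp a => inr 2%N :: tcode a
  | TAdd a b => inr 3%N :: tcode a ++ tcode b
  end.

Lemma tcode_inj V (t t' : term V) r r' :
  tcode t ++ r = tcode t' ++ r' -> t = t' /\ r = r'.
Proof.
elim: t t' r r' => [x|||a iha|a iha b ihb] [y|||a'|a' b'] r r' //=.
- by case=> -> ->.
- by case=> ->.
- by case=> ->.
- by case=> /iha[-> ->].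
- by case; rewrite -!catA => /iha[-> /ihb[-> ->]].
Qed.

Lemma small_term V : smallT V -> smallT (term V).
Proof.
move=> sV; apply: small_inj (small_seq (small_sum sV small_nat)).
instantiate (1 := @tcode V) => t t' e.
by have := @tcode_inj _ t t' [::] [::]; rewrite e => /(_ erefl)[].
Qed.

End Small.

Lemma fip_ultra T (C : set (set T)) :
  (forall n (S : 'I_n -> set T), (forall k, C (S k)) ->
     exists x, forall k, S k x) ->
  exists2 F : set_system T, UltraFilter F & C `<=` F.
Proof.
move=> fip.
pose F0 : set_system T := [set A | exists n (S : 'I_n -> set T),
  (forall k, C (S k)) /\ forall x, (forall k, S k x) -> A x].
have F0P : ProperFilter F0.
  apply: Build_ProperFilter_ex.
    by move=> A [n [S [/fip[x xS] h]]]; exists x; apply: h.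
  split.
  - by exists 0%N, (fun=> setT); split=> // -[].
  - move=> A B [n [S [CS hS]]] [m [S' [CS' hS']]].
    exists (n + m)%N,
      (fun k => match fintype.split k with inl i => S i | inr i => S' i end).
    split=> [k|x h]; first by case: (fintype.split k).
    split; [apply: hS => k; have := h (unsplit (inl k))
           |apply: hS' => k; have := h (unsplit (inr k))];
    by rewrite fintype.unsplitK.
  - move=> A B AB [n [S [CS hS]]]; exists n, S; split=> // x /hS; exact: AB.
have [F [uF sF]] := ultraFilterLemma F0P.
exists F => // A CA; apply: sF; exists 1%N, (fun=> A); split=> [//|x h]; exact: (h ord0).
Qed.

(** * Ultrapowers and compactness *)

Section Ultrapower.
Variables (M : oagType) (T : Type) (F : set_system T) (uF : UltraFilter F).

(** The ultrapower is the quotient of the group of functions by those vanishing almost everywhere,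
    so its group structure comes from the quotient construction. *)
Definition ultra_null : {pred T -> M} := fun f => `[< F [set i | f i = 0] >].

Lemma ultra_nullP f : reflect (F [set i | f i = 0]) (f \in ultra_null).
Proof. exact: asboolP. Qed.

Lemma ultra_null_zmod : zmod_closed ultra_null.
Proof.
split=> [|f g /ultra_nullP hf /ultra_nullP hg]; apply/ultra_nullP.
  by apply: filterS filterT => i _.
apply: filterS (filterI hf hg) => i [/= fi gi].
by rewrite /GRing.add /= /GRing.opp /= fi gi; zmod.
Qed.

HB.instance Definition _ :=
  GRing.isZmodClosed.Build (T -> M) ultra_null ultra_null_zmod.

Definition upower := Quotient.quot ultra_null.
HB.instance Definition _ := GRing.Zmodule.on upower.

Definition upi (f : T -> M) : upower := (\pi_(Quotient.quot ultra_null) f)%qT.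

Lemma ultra_notP A : ~ F A <-> F (~` A).
Proof.
split=> [h|h h']; first by case: (in_ultra_setVsetC A uF).
by have [x []] := filter_ex (filterI h h').
Qed.

Lemma upi_eq f g : upi f = upi g <-> F [set i | f i = g i].
Proof.
have e : (upi f == upi g) = (f - g \in ultra_null).
  by rewrite Quotient.idealrBE.
split=> [/eqP|h].
  rewrite e => /ultra_nullP; apply: filterS => i /= h.
  by apply/eqP; rewrite -subr_eq0 -h.
apply/eqP; rewrite e; apply/ultra_nullP; apply: filterS h => i /= h.
by rewrite /GRing.add /= /GRing.opp /= h subrr.
Qed.

Lemma upi_repr (a : upower) : upi (generic_quotient.repr a) = a.
Proof. exact: generic_quotient.reprK. Qed.

Lemma upi_surj (a : upower) : exists f, a = upi f.
Proof. by exists (generic_quotient.repr a); rewrite upi_repr. Qed.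

Lemma upiD f g : upi f + upi g = upi (fun i => f i + g i).
Proof. exact: (esym (@Quotient.pi_add _ ultra_null f g)). Qed.

Lemma upiN f : - upi f = upi (fun i => - f i).
Proof. exact: (esym (@Quotient.pi_opp _ ultra_null f)). Qed.

Lemma upi0 : 0 = upi (fun=> 0).
Proof. by rewrite /upi /GRing.zero /= /Quotient.zero; unlock. Qed.

Lemma upiMn f n : upi f *+ n = upi (fun i => f i *+ n).
Proof.
elim: n => [|n ih]; first by rewrite mulr0n upi0; congr upi; apply: funext.
by rewrite mulrS ih upiD; congr upi; apply: funext => i; rewrite mulrS.
Qed.

Definition ule (a b : upower) :=
  `[< F [set i | generic_quotient.repr a i <= generic_quotient.repr b i] >].

Lemma uleP f g : ule (upi f) (upi g) <-> F [set i | f i <= g i].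
Proof.
have hf : F [set i | generic_quotient.repr (upi f) i = f i].
  by apply/upi_eq; rewrite upi_repr.
have hg : F [set i | generic_quotient.repr (upi g) i = g i].
  by apply/upi_eq; rewrite upi_repr.
split=> [/asboolP h|h]; [|apply/asboolP];
  by apply: filterS (filterI hf (filterI hg h)) => i /= [-> [->]].
Qed.

Lemma ule_refl : reflexive ule.
Proof.
move=> a; have [f ->] := upi_surj a; apply/uleP.
by apply: filterS filterT => i _ /=.
Qed.

Lemma ule_anti : antisymmetric ule.
Proof.
move=> a b; have [f ->] := upi_surj a; have [g ->] := upi_surj b.
case/andP => /uleP h /uleP h'; apply/upi_eq.
by apply: filterS (filterI h h') => i /= [fg gf]; apply/eqP; rewrite eq_le fg.
Qed.

Lemma ule_trans : transitive ule.
Proof.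
move=> b a c; have [f ->] := upi_surj a; have [g ->] := upi_surj b.
have [k ->] := upi_surj c => /uleP h /uleP h'; apply/uleP.
by apply: filterS (filterI h h') => i /= [fg]; apply: le_trans.
Qed.

HB.instance Definition _ :=
  Order.Le_isPOrder.Build ring_display upower ule_refl ule_anti ule_trans.

Lemma upi_le f g : upi f <= upi g <-> F [set i | f i <= g i].
Proof. exact: uleP. Qed.

Lemma ule_total (a b : upower) : (a <= b) || (b <= a).
Proof.
have [f ->] := upi_surj a; have [g ->] := upi_surj b.
case: (in_ultra_setVsetC [set i | f i <= g i] uF) => h.
  by apply/orP; left; apply/upi_le.
apply/orP; right; apply/upi_le; apply: filterS h => i /= /negP.
by rewrite -oltNge => /ltW.
Qed.

Lemma ule_add (a b c : upower) : a <= b -> a + c <= b + c.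
Proof.
have [f ->] := upi_surj a; have [g ->] := upi_surj b.
have [k ->] := upi_surj c => /upi_le h; rewrite !upiD; apply/upi_le.
by apply: filterS h => i /= h; apply: oag_lerD2.
Qed.

HB.instance Definition _ := POrderedZmodule_isOAG.Build upower ule_total ule_add.

Lemma upi_lt f g : upi f < upi g <-> F [set i | f i < g i].
Proof.
rewrite oltNge; split=> [/negP h|h].
  have /ultra_notP : ~ F [set i | g i <= f i] by move=> /upi_le.
  by apply: filterS => i /= /negP; rewrite -oltNge.
apply/negP => /upi_le h'; have [i [/= hi]] := filter_ex (filterI h h').
by rewrite oleNgt hi.
Qed.

(** The constant is given by a choice operator, so it has to be compared with its copy directly: a
    least positive element persists, and density passes on through coordinatewise witnesses. *)
Lemma upi_one : pres_one upower = upi (fun=> pres_one M).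
Proof.
have [[o [o0 ho]]|no] :=
  pselect (exists x : M, 0 < x /\ forall y : M, 0 < y -> x <= y).
  rewrite (pres_oneE o0 ho); apply: pres_oneE => [|y].
    by rewrite upi0; apply/upi_lt; apply: filterS filterT.
  have [f ->] := upi_surj y; rewrite upi0 => /upi_lt h; apply/upi_le.
  by apply: filterS h => i /=; apply: ho.
have dense (x : M) : 0 < x -> exists2 y, 0 < y & y < x.
  move=> x0; apply: contrapT => h; apply: no; exists x; split=> // y y0.
  by rewrite oleNgt; apply/negP => yx; apply: h; exists y.
rewrite (pres_one0 dense) -upi0; apply: pres_one0 => y.
have [f ->] := upi_surj y; rewrite upi0 => /upi_lt hf.
have /choice[g hg] : forall i, exists z : M, 0 < f i -> 0 < z /\ z < f i.
  move=> i; have [/dense[z z0 zf]|n0] := pselect (0 < f i); first by exists z.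
  by exists 0.
by exists (upi g); apply/upi_lt; apply: filterS hf => i /= /hg[].
Qed.

Lemma upi_teval V (v : V -> T -> M) (t : term V) :
  teval (fun x => upi (v x)) t = upi (fun i => teval (v^~ i) t).
Proof.
elim: t => //= [||a ->|a -> b ->].
- exact: upi0.
- exact: upi_one.
- exact: upiN.
- exact: upiD.
Qed.

(** Łoś's theorem. Witnesses for congruences and quantifiers are chosen in each coordinate, with a
    default where there is none. *)
Lemma upi_holds V (v : V -> T -> M) (phi : formula V) :
  holds (fun x => upi (v x)) phi <-> F [set i | holds (v^~ i) phi].
Proof.
elim: phi v => {V} [V a b|V a b|V n a b|V a iha|V a iha b ihb|V a iha] v /=.
- by rewrite !upi_teval upi_eq.
- by rewrite !upi_teval upi_lt.
- rewrite !upi_teval upiN upiD; split=> [[z]|h].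
    have [f ->] := upi_surj z; rewrite upiMn => /upi_eq.
    by apply: filterS => i /= e; exists (f i).
  have /choice[f hf] : forall i, exists z : M,
      (exists z, teval (v^~ i) a - teval (v^~ i) b = z *+ n) ->
      teval (v^~ i) a - teval (v^~ i) b = z *+ n.
    move=> i; have [[z hz]|no] :=
      pselect (exists z, teval (v^~ i) a - teval (v^~ i) b = z *+ n).
      by exists z.
    by exists 0 => /no.
  by exists (upi f); rewrite upiMn; apply/upi_eq; apply: filterS h => i /= /hf.
- by rewrite iha ultra_notP.
- rewrite iha ihb; split=> [[h h']|h]; first exact: filterI.
  by split; apply: filterS h => i [].
have key f : (ocons (upi f) (fun x => upi (v x))) =
    (fun x => upi (ocons f v x)) by apply: funext; case.
have key' f i : (ocons f v)^~ i = ocons (f i) (v^~ i)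
  by apply: funext; case.
split=> [[z]|h].
  have [f ->] := upi_surj z; rewrite key iha; apply: filterS => i /= h.
  by exists (f i); rewrite -key'.
have /choice[f hf] : forall i, exists z : M,
    (exists z, holds (ocons z (v^~ i)) a) -> holds (ocons z (v^~ i)) a.
  move=> i; have [[z hz]|no] := pselect (exists z, holds (ocons z (v^~ i)) a).
    by exists z.
  by exists 0 => /no.
exists (upi f); rewrite key iha; apply: filterS h => i /= /hf.
by rewrite key'.
Qed.

End Ultrapower.

Definition finsat (M : oagType) V W (e : W -> M) (S : set (formula (V + W))) :=
  forall (n : nat) (phi : 'I_n -> formula (V + W)), (forall k, S (phi k)) ->
  exists c : V -> M, forall k, holds (sjoin c e) (phi k).

Lemma finsat_ultra (M : oagType) V W (e : W -> M) (S : set (formula (V + W))) :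
  finsat e S ->
  exists2 F : set_system (V -> M), UltraFilter F &
    forall phi, S phi -> F [set c | holds (sjoin c e) phi].
Proof.
move=> fS.
have [n A CA|F uF sF] := @fip_ultra (V -> M)
  [set A | exists2 phi, S phi & A = [set c | holds (sjoin c e) phi]].
  have /choice[phi hphi] : forall k, exists phi, S phi /\
      A k = [set c | holds (sjoin c e) phi].
    by move=> k; have [phi] := CA k; exists phi.
  have [k|c hc] := fS n phi; first by case: (hphi k).
  by exists c => k; rewrite (hphi k).2; exact: hc.
by exists F => // phi Sphi; apply: sF; exists phi.
Qed.

(** The ultrapower is indexed by the tuples of [U] themselves, so the coordinate functions form the
    realization. *)
Lemma compactness (U : oagType) V (S : set (formula (V + U))) :
  finsat id S ->
  exists (X : elemext U) (c : V -> X), realizes (@emb U X) c S.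
Proof.
move=> /finsat_ultra[F uF sF].
have h : elem_eq id (fun u : U => upi uF (fun=> u)).
  move=> phi; rewrite (upi_holds uF (fun u _ => u)); split=> [h|].
    by apply: filterS filterT => i _.
  by move=> /filter_ex[].
exists (ElemExt h), (fun x => upi uF (fun c => c x)) => phi /sF Fphi /=.
have -> : sjoin (fun x => upi uF (fun c => c x)) (fun u => upi uF (fun=> u)) =
  fun k => upi uF (fun c => sjoin c id k) by apply: funext; case.
by rewrite upi_holds; apply: filterS Fphi.
Qed.

(** * Saturation *)

Lemma In_mem (T : eqType) (x : T) s : x \in s -> List.In x s.
Proof.
elim: s => //= y s ih; rewrite inE => /orP[/eqP ->|/ih]; first by left.
by right.
Qed.

Lemma all_conj V n (phi : 'I_n -> formula V) :
  exists s, forall a, List.In a s <-> exists k, a = phi k.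
Proof.
exists (map phi (enum 'I_n)) => a; rewrite List.in_map_iff.
split=> [[k [<- _]]|[k ->]]; first by exists k.
by exists k; split=> //; apply: In_mem; rewrite mem_enum.
Qed.

Lemma finsat_conj (M : oagType) V W (e : W -> M) (S : set (formula (V + W))) :
  (forall phi, S phi -> exists c, holds (sjoin c e) phi) ->
  S (FEq TZero TZero) -> (forall a b, S a -> S b -> S (FAnd a b)) -> finsat e S.
Proof.
move=> hS S0 SA n phi hphi; have [s hs] := all_conj phi.
have [|c /holds_conj hc] := hS (FConj s).
  elim: s {hs} (fun a => proj1 (hs a)) => //= a s ih h; apply: SA.
    by have [|k ->] := h a; [left|].
  by apply: ih => b hb; apply: h; right.
by exists c => k; apply: hc; apply/hs; exists k.
Qed.

(** The completion consists of the formulas true at almost all tuples for an ultrafilter, hence is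
    finitely satisfiable in the same model. *)
Lemma finsat_complete (M : oagType) V W (e : W -> M) (S : set (formula (V + W))) :
  finsat e S -> exists2 p, complete_type e p & S `<=` p.
Proof.
move=> /finsat_ultra[F uF sF].
exists [set phi | F [set c | holds (sjoin c e) phi]] => //.
split=> [n phi hphi|phi].
  have : F [set c | forall k, holds (sjoin c e) (phi k)].
    elim: n phi hphi => [|n ih] phi hphi.
      by apply: filterS filterT => c _ [].
    have h := ih (fun k => phi (lift ord0 k)) (fun k => hphi _).
    apply: filterS (filterI (hphi ord0) h) => c [/= h0 h1] k.
    by case: (unliftP ord0 k) => [j ->|->].
  by move=> /filter_ex[c hc]; exists c.
by case: (in_ultra_setVsetC [set c | holds (sjoin c e) phi] uF); [left|right].
Qed.

Section Saturation.
Variables (K : Type) (slK : strong_limit K) (U : oagType).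
Hypothesis satU : saturated K U.
Local Notation smallT X := (small K [set: X]).

(** Parameters are named by an arbitrary small type, possibly with repetitions, and [S] may be
    incomplete; saturation is applied below in this form. *)
Lemma saturation W (e : W -> U) (S : set (formula (unit + W))) :
  smallT W -> finsat e S ->
  exists x, forall phi, S phi -> holds (sjoin (fun=> x) e) phi.
Proof.
move=> sW fS; pose A := range e.
have sA : small K A by apply: small_range.
pose s (k : unit + W) : unit + A :=
  sjoin inl (fun w => inr (exist _ (e w) (mem_set (imageP e I)))) k.
have key d : sjoin d (fun a : A => val a) \o s = sjoin d e.
  by apply: funext => -[|].
have [|p cp sp] :=
  @finsat_complete U unit A (fun a => val a) [set frename s phi | phi in S].
  move=> n phi hphi.
  have /choice[psi hpsi] k : exists psi, S psi /\ frename s psi = phi k.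
    by have [psi] := hphi k; exists psi.
  have [c hc] := fS n psi (fun k => (hpsi k).1).
  by exists c => k; rewrite -(hpsi k).2 holds_rename key.
have [c rc] := satU sA cp; exists (c tt) => phi Sphi.
have := rc (frename s phi); rewrite holds_rename key.
have <- : c = (fun=> c tt) by apply: funext; case.
by apply; apply: sp; exists phi.
Qed.

Lemma extend1 (M : oagType) W (v : W -> M) (w : W -> U) (x : M) :
  smallT W -> elem_eq v w -> exists y, elem_eq (ocons x v) (ocons y w).
Proof.
move=> sW vw.
pose s (k : unit + W) := if k is inr w then Some w else None.
have key (N : oagType) (c : unit -> N) (e : W -> N) :
    sjoin c e = ocons (c tt) e \o s by apply: funext => -[[]|].
pose r (o : option W) : unit + W := if o is Some w then inr w else inl tt.
have key' (N : oagType) (c : unit -> N) (e : W -> N) :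
    sjoin c e \o r = ocons (c tt) e by apply: funext => -[].
have [|y hy] := @saturation W w
  [set phi | holds (sjoin (fun=> x) v) phi] sW.
  apply: finsat_conj => //= phi; rewrite key -holds_rename => hx.
  have /vw[y hy] : holds v (FEx (frename s phi)) by exists x.
  by exists (fun=> y); rewrite key -holds_rename.
exists y => phi.
have h a : holds (ocons x v) a -> holds (ocons y w) a.
  move=> ha; have := hy (frename r a); rewrite (holds_rename r _ a) key'.
  by apply; rewrite /= holds_rename key'.
split; first exact: h.
by apply: contraPP => nx; apply: (h (FNot phi)).
Qed.

(** [saturated] treats one variable. Small tuples are reached by a maximal elementary graph between
    the indices of [b] and [U], which [extend1] shows to be total. *)
Lemma realize_tuple (M : oagType) I W (b : I -> M) (v : W -> M) (w : W -> U) :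
  smallT I -> smallT W -> elem_eq v w ->
  exists c, elem_eq (sjoin b v) (sjoin c w).
Proof.
move=> sI sW vw.
pose P (g : set (I * U)) := elem_eq
  (sjoin (fun z : g => b (val z).1) v) (sjoin (fun z : g => (val z).2) w).
have P0 : P set0.
  pose s (k : (@set0 (I * U)) + W) : W :=
    match k with
    | inl z => False_rect W (set_mem (valP z))
    | inr w => w
    end.
  have key (N : oagType) c (e : W -> N) : sjoin c e = e \o s.
    by apply: funext => -[[z hz]|//]; case: (set_mem hz).
  by rewrite /P !key; apply: elem_eq_rename.
have [|g [Pg maxg]] := @Zorn_bigcup _ P.
  move=> F FP totF; set G := \bigcup_(X in F) X.
  (* A formula involves finitely many pairs, which lie in one member of the chain, or in the empty
     graph if there are none. *)
  have fin (l : seq (G + W)) : exists g : set (I * U), [/\ P g, F g \/ g = set0 &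
      forall z : G, List.In (inl z) l -> g (val z)].
    elim: l => [|[z|z] l [g [Pg Fg hg]]].
    - by exists set0; split=> //; right.
    - have [X FX Xz] := set_mem (valP z).
      case: Fg => [Fg|g0]; last first.
        exists X; split; [exact: FP|by left|].
        by move=> y [[<-]|/hg] //; rewrite g0.
      have [gX|Xg] := totF _ _ Fg FX.
        exists X; split; [exact: FP|by left|].
        by move=> y [[<-]|/hg/gX].
      exists g; split => //; first by left.
      by move=> y [[<-]|/hg] //; apply: Xg.
    - by exists g; split=> // y [//|/hg].
  move=> phi; have [l hl] := focc_fin phi; have [g [Pg Fg hg]] := fin l.
  have gG z : g z -> G z by case: Fg => [Fg gz|-> //]; exists g.
  pose f (k : g + W) : G + W := match k with
    | inl z => inl (exist _ (val z) (mem_set (gG _ (set_mem (valP z)))))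
    | inr w => inr w end.
  have [|phi' <-] := @formula_lift _ _ f phi.
    move=> [z|z] hz; last by exists (inr z).
    exists (inl (exist _ (val z) (mem_set (hg _ (hl _ hz))))).
    by congr inl; apply: val_inj.
  rewrite !holds_rename.
  have key (N : oagType) (h : I * U -> N) (e : W -> N) :
    sjoin (fun z : G => h (val z)) e \o f = sjoin (fun z : g => h (val z)) e.
    by apply: funext => -[].
  by rewrite (key _ (fun z => b z.1)) (key _ snd).
(* Equal indices have equal entries, and elementarity carries the equality to the second components.
   So the graph is functional, injects into [I], and is small. *)
have fung (z z' : g) : (val z).1 = (val z').1 -> z = z'.
  move=> e; apply: val_inj; apply: injective_projections => //=.
  by apply (Pg (FEq (TVar (inl z)) (TVar (inl z')))); rewrite /= e.
have sg : smallT g by apply: small_inj sI; exact: fung.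
have [dom|/existsNP[i ni]] := pselect (forall i, exists u, g (i, u)).
  have /choice[c hc] := dom; exists c.
  pose s (k : I + W) : g + W := match k with
    | inl i => inl (exist _ (i, c i) (mem_set (hc i))) | inr w => inr w end.
  have := elem_eq_rename s Pg.
  suff [-> ->] : sjoin (fun z : g => b (val z).1) v \o s = sjoin b v /\
    sjoin (fun z : g => (val z).2) w \o s = sjoin c w by [].
  by split; apply: funext => -[].
have [u hu] := extend1 (b i) (small_sum slK sg sW) Pg.
case: (maxg (g `|` [set (i, u)])).
  rewrite properEneq; split; last exact: subsetUl.
  by apply/eqP => e; apply: ni; exists u; rewrite e; right.
set g' := g `|` _.
pose s (k : g' + W) : option (g + W) := match k with
  | inl z => if pselect (g (val z)) is left gz
             then Some (inl (exist _ (val z) (mem_set gz))) else None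
  | inr w => Some (inr w) end.
have := elem_eq_rename s hu.
set v1 := _ \o s; set w1 := _ \o s.
suff [-> ->] : v1 = sjoin (fun z : g' => b (val z).1) v /\
               w1 = sjoin (fun z : g' => (val z).2) w by [].
by split; apply: funext => -[z|//] /=; rewrite /v1 /w1 /=;
  case: pselect => //= nz; case: (set_mem (valP z)) => // ->.
Qed.

End Saturation.

(** * Regular groups *)

Definition dvdby (M : zmodType) (N : nat) (x : M) := exists z, x = z *+ N.

Section Divisibility.
Variable M : zmodType.
Implicit Types (x y : M) (N : nat).

Lemma dvdby0 N : dvdby N (0 : M).
Proof. by exists 0; rewrite mul0rn. Qed.

Lemma dvdbyB N x y : dvdby N x -> dvdby N y -> dvdby N (x - y).
Proof. by move=> [a ->] [b ->]; exists (a - b); rewrite mulrnBl. Qed.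

Lemma dvdbyN N x : dvdby N x -> dvdby N (- x).
Proof. by move=> h; rewrite -sub0r; apply: dvdbyB (dvdby0 N) h. Qed.

Lemma dvdbyD N x y : dvdby N x -> dvdby N y -> dvdby N (x + y).
Proof. by move=> h /dvdbyN h'; rewrite -(opprK y); apply: dvdbyB. Qed.

Lemma dvdbyMz N x z : dvdby N x -> dvdby N (x *~ z).
Proof. by move=> [a ->]; exists (a *~ z); rewrite !pmulrn -!mulrzA mulrC. Qed.

Lemma dvdby_mul N x : dvdby N (x *+ N). Proof. by exists x. Qed.

Lemma dvdby1 x : dvdby 1 x. Proof. by exists x. Qed.

Lemma dvdbyW N N' x : (N %| N')%N -> dvdby N' x -> dvdby N x.
Proof. by move=> /dvdnP[k ->] [a ->]; exists (a *+ k); rewrite mulrnA. Qed.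

Lemma dvdby_congr N x y : dvdby N (x - y) -> dvdby N x <-> dvdby N y.
Proof.
move=> h; split=> h'.
  by rewrite (_ : y = x - (x - y)); [apply: dvdbyB|zmod].
by rewrite (_ : x = (x - y) + y); [apply: dvdbyD|zmod].
Qed.

End Divisibility.

Lemma dvdbyM (M : oagType) N k (x : M) :
  (0 < k)%N -> dvdby (N * k) (x *+ k) <-> dvdby N x.
Proof.
move=> k0; split=> [[z]|[z ->]]; last by exists z; rewrite mulrnA.
by rewrite mulrnA => /(omuln_inj k0) ->; exists z.
Qed.

Definition agree (M M' : oagType) (N : nat) (x : M) (y : M') :=
  [/\ 0 < x <-> 0 < y, x < 0 <-> y < 0 & dvdby N x <-> dvdby N y].

Lemma agree_eq0 (M M' : oagType) N (x : M) (y : M') :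
  agree N x y -> x = 0 <-> y = 0.
Proof.
case=> h1 h2 _; split=> e.
  case: (otrichotomy y 0) => // /[dup] h; first by move/h2; rewrite e ltxx.
  by move/h1; rewrite e ltxx.
case: (otrichotomy x 0) => // /[dup] h; first by move/h2; rewrite e ltxx.
by move/h1; rewrite e ltxx.
Qed.

(** For a conjunction the moduli are multiplied. Divisibility of t by N1 is recovered as
    divisibility of N2 t by N1 N2, whence the multiplied terms in the list. *)
Lemma qf_agree V (psi : formula V) : qfree psi ->
  exists (T : seq (term V)) N, (0 < N)%N /\
    forall (M M' : oagType) (v : V -> M) (w : V -> M'),
      (forall t, List.In t T -> agree N (teval v t) (teval w t)) ->
      holds v psi <-> holds w psi.
Proof.
elim: psi => {V} [V a b|V a b|V n a b|V a iha|V a iha b ihb|V a iha] //=.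
- move=> _; exists [:: TAdd a (TOpp b)], 1%N; split=> // M M' v w h.
  have /agree_eq0 := h _ (or_introl erefl) => /= h'.
  split=> e; apply/eqP; rewrite -subr_eq0; apply/eqP; apply h';
    by rewrite e subrr.
- move=> _; exists [:: TAdd b (TOpp a)], 1%N; split=> // M M' v w h.
  have [h' _ _] := h _ (or_introl erefl).
  split=> e.
    have /h' /= : 0 < teval v (TAdd b (TOpp a)) by apply: (olt1 e) => /=; zmod.
    by move=> h''; apply: (olt1 h''); zmod.
  have /h' /= : 0 < teval w (TAdd b (TOpp a)) by apply: (olt1 e) => /=; zmod.
  by move=> h''; apply: (olt1 h''); zmod.
(* Congruence modulo 0 is equality. *)
- move=> _; case: n => [|n].
    exists [:: TAdd a (TOpp b)], 1%N; split=> // M M' v w h.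
    have /agree_eq0 := h _ (or_introl erefl) => /= h'.
    by split=> -[z e]; exists 0; rewrite mulr0n; apply h'; rewrite e mulr0n.
  exists [:: TAdd a (TOpp b)], n.+1; split=> // M M' v w h.
  by have [_ _] := h _ (or_introl erefl).
- by move=> /iha[T [N [N0 h]]]; exists T, N; split=> // M M' v w /h ->.
case/andP => /iha[T1 [N1 [N10 h1]]] /ihb[T2 [N2 [N20 h2]]].
exists (T1 ++ map (fun t => TMuln t N2) T1 ++ T2 ++
        map (fun t => TMuln t N1) T2), (N1 * N2)%N.
rewrite muln_gt0 N10 N20; split=> // M M' v w h.
have {}h t :
    List.In t T1 \/ List.In t [seq TMuln t N2 | t <- T1] \/
    List.In t T2 \/ List.In t [seq TMuln t N1 | t <- T2] ->
    agree (N1 * N2) (teval v t) (teval w t).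
  by move=> ht; apply: h; rewrite !List.in_app_iff.
have e1 : holds v a <-> holds w a.
  apply: h1 => t ht; have [e1 e2 _] := h t (or_introl ht); split=> //.
  have [|_ _] := h (TMuln t N2); last by rewrite !teval_muln !dvdbyM.
  by right; left; apply: List.in_map ht.
have e2 : holds v b <-> holds w b.
  apply: h2 => t ht; have [|e2 e3 _] := h t; first by tauto.
  split=> //; have [|_ _] := h (TMuln t N1).
    by right; right; right; apply: List.in_map ht.
  by rewrite !teval_muln mulnC !dvdbyM.
by rewrite e1 e2.
Qed.

Lemma holds_niff (M : oagType) V (v : V -> M) a b :
  holds v (FNot (FAnd (FImp a b) (FImp b a))) <-> ~ (holds v a <-> holds v b).
Proof.
split=> h1 h2; apply: h1; first by split; apply/holds_imp; case: h2.
by case: h2 => h h'; split; apply/holds_imp.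
Qed.

Section Regular.
Variables (G : oagType) (regG : regular G).

(** [regular] concerns [G] and finitely many indexed variables. Equivalence with a quantifier-free
    formula is expressed by a sentence, so it passes to all models of the theory, and the variables
    that occur can be indexed. *)
Lemma qe_agree V (phi : formula V) :
  exists (T : seq (term V)) N, (0 < N)%N /\
    forall (M M' : oagType), elem_equiv G M -> elem_equiv G M' ->
    forall (v : V -> M) (w : V -> M'),
      (forall t, List.In t T -> agree N (teval v t) (teval w t)) ->
      holds v phi <-> holds w phi.
Proof.
have [s hs] := focc_fin phi; pose n := size s.
(* The successor provides a default index for the variables that do not occur. *)
have /choice[idx hidx] : forall x, exists k : 'I_n.+1,
    List.In x s -> onth s k = Some x.
  move=> x; have [hx|nx] := pselect (List.In x s); last by exists ord0.
  have [k kn hk] : exists2 k, (k < n)%N & onth s k = Some x.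
    rewrite /n; elim: (s) hx => //= y s' ih [->|/ih[k kn hk]]; first by exists 0%N.
    by exists k.+1.
  by exists (inord k); rewrite inordK ?(leq_trans kn).
have [psi qfpsi hpsi] := regG (frename idx phi).
have [T [N [N0 hT]]] := qf_agree qfpsi.
pose sg (k : 'I_n.+1) : term V := if onth s k is Some x then TVar x else TZero.
have valid M (GM : elem_equiv G M) (v : 'I_n.+1 -> M) :
    holds v (frename idx phi) <-> holds v psi.
  have [chi hchi] := exists_closure (frename (@inl _ void) (FNot (FAnd
    (FImp (frename idx phi) psi) (FImp psi (frename idx phi))))).
  have key (X : oagType) : ~ holds (@of_void X) chi <->
      forall c : 'I_n.+1 -> X, holds c (frename idx phi) <-> holds c psi.
    rewrite hchi; split=> [/forallNP h c|h [c]].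
      have := h c; rewrite holds_rename holds_niff; exact: contrapT.
    by rewrite holds_rename holds_niff; apply; apply: h.
  by move: v; apply/key; rewrite -(GM chi); apply/key.
exists (map (tsubst sg) T), N; split=> // M M' GM GM' v w h.
have key X (GX : elem_equiv G X) (u : V -> X) :
    holds u phi <-> holds (fun k => teval u (sg k)) psi.
  rewrite -valid // holds_rename; apply: holds_occ => x /hs hx /=.
  by rewrite /sg hidx.
rewrite !key //; apply: hT => t ht; rewrite -!teval_subst.
by apply: h; apply: List.in_map ht.
Qed.

Lemma lin_bool (T : seq (term bool)) : exists C, forall t, List.In t T ->
  exists i j k : int, [/\ (`|i| <= C)%N, (`|j| <= C)%N, (`|k| <= C)%N &
    forall (M : oagType) (v : bool -> M),
      teval v t = v true *~ i + v false *~ j + pres_one M *~ k].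
Proof.
have lin (t : term bool) : exists i j k : int, forall (M : oagType) (v : bool -> M),
      teval v t = v true *~ i + v false *~ j + pres_one M *~ k.
  elim: t => [[]|||a [i [j [k h]]]|a [i [j [k h]]] b [i' [j' [k' h']]]].
  - by exists 1, 0, 0 => M v /=; rewrite !mulr0z !addr0.
  - by exists 0, 1, 0 => M v /=; rewrite !mulr0z add0r addr0.
  - by exists 0, 0, 0 => M v /=; rewrite !mulr0z !addr0.
  - by exists 0, 0, 1 => M v /=; rewrite !mulr0z !add0r.
  - exists (- i), (- j), (- k) => M v /=; rewrite h !mulrNz; zmod.
  - exists (i + i'), (j + j'), (k + k') => M v /=; rewrite h h' !mulrzDr; zmod.
elim: T => [|t T [C hC]]; first by exists 0%N.
have [i [j [k h]]] := lin t.
exists (C + `|i| + `|j| + `|k|)%N => t' [<-|/hC].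
  exists i, j, k; split=> //; lia.
move=> [i' [j' [k' [h1 h2 h3 h4]]]]; exists i', j', k'; split=> //; lia.
Qed.

Lemma omulz_le (M : oagType) (x : M) (i : int) C : 0 <= x -> (`|i| <= C)%N ->
  - (x *+ C) <= x *~ i /\ x *~ i <= x *+ C.
Proof.
move=> x0; case: i => n hn; split.
- by apply: (ole2 (omuln_ge0 C x0) (omuln_ge0 n x0)); rewrite -pmulrn; zmod.
- by rewrite -pmulrn; apply: omuln_geS.
- have := omuln_geS x0 (hn : (n.+1 <= C)%N) => h.
  by apply: (ole1 h); rewrite NegzE mulrNz -pmulrn; zmod.
- apply: (ole2 (omuln_ge0 C x0) (omuln_ge0 n.+1 x0)).
  by rewrite NegzE mulrNz -pmulrn; zmod.
Qed.

Lemma lex_pos (M : oagType) (e a : M) (i j k : int) C :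
  (`|i| <= C)%N -> (`|k| <= C)%N ->
  pres_one M *+ C < e -> e *+ C.+1 <= a -> 0 < j ->
  0 < e *~ i + a *~ j + pres_one M *~ k.
Proof.
move=> hi hk he ha; case: j => // -[//|j] _.
have o0 := pres_one_ge0 M.
have e0 : 0 < e by apply: le_lt_trans (omuln_ge0 C o0) he.
have a0 : 0 < a by apply: lt_le_trans ha; apply: omuln_gt0.
have [h1 _] := omulz_le (ltW e0) hi; have [h2 _] := omulz_le o0 hk.
apply: (@lt_le_trans _ _ (a - e *+ C - pres_one M *+ C)).
  by apply: (olt2 he ha); rewrite mulrS; zmod.
apply: (ole3 h1 h2 (omuln_ge0 j (ltW a0))); rewrite -pmulrn mulrS; zmod.
Qed.

(** The gaps between 1, [e] and [a] exceed the bound [C] on the coefficients, so the sign is decided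
    lexicographically by j, then i, then the multiple of 1, which is the same for both pairs. *)
Lemma lex_sign (M : oagType) (e a e' a' : M) (i j k : int) C :
  (`|i| <= C)%N -> (`|k| <= C)%N ->
  pres_one M *+ C < e -> e *+ C.+1 <= a ->
  pres_one M *+ C < e' -> e' *+ C.+1 <= a' ->
  let x := e *~ i + a *~ j + pres_one M *~ k in
  let x' := e' *~ i + a' *~ j + pres_one M *~ k in
  (0 < x <-> 0 < x') /\ (x < 0 <-> x' < 0).
Proof.
move=> hi hk he ha he' ha' x x'.
pose D (z z' : M) := (0 < z <-> 0 < z') /\ (z < 0 <-> z' < 0).
have Dpos (z z' : M) : 0 < z -> 0 < z' -> D z z'.
  by move=> h h'; split; rewrite ?h ?h' ?(lt_gtF h) ?(lt_gtF h').
have Dneg (z z' : M) : 0 < - z -> 0 < - z' -> D z z'.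
  move=> h h'; have hz : z < 0 by apply: (olt1 h); zmod.
  have hz' : z' < 0 by apply: (olt1 h'); zmod.
  by split; rewrite ?hz ?hz' ?(lt_gtF hz) ?(lt_gtF hz').
have [j0|j0|j0] := ltrgtP 0 j.
- by apply: Dpos; apply: (@lex_pos _ _ _ _ _ _ C).
- have nx (y b : M) : - (y *~ i + b *~ j + pres_one M *~ k) =
     y *~ (- i) + b *~ (- j) + pres_one M *~ (- k) by rewrite !mulrNz; zmod.
  by apply: Dneg; rewrite nx; apply: (@lex_pos _ _ _ _ _ _ C);
    rewrite ?abszN ?oppr_gt0.
rewrite /x /x' -j0 !mulr0z !addr0.
have pos (y : M) (i' k' : int) : (`|k'| <= C)%N -> pres_one M *+ C < y ->
    0 < i' -> 0 < y *~ i' + pres_one M *~ k'.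
  move=> hk' hy; case: i' => // -[//|i'] _.
  have o0 := pres_one_ge0 M; have [h1 _] := omulz_le o0 hk'.
  have y0 : 0 <= y by apply: le_trans (omuln_ge0 C o0) (ltW hy).
  by apply: (olt3 hy h1 (omuln_ge0 i' y0)); rewrite -pmulrn mulrS; zmod.
have [i0|i0|i0] := ltrgtP 0 i.
- by apply: Dpos; apply: pos.
- have nx (y : M) : - (y *~ i + pres_one M *~ k) =
     y *~ (- i) + pres_one M *~ (- k) by rewrite !mulrNz; zmod.
  by apply: Dneg; rewrite nx; apply: pos; rewrite ?abszN ?oppr_gt0.
by rewrite -i0 !mulr0z.
Qed.

(** Without a least positive element, every positive element has another one below its half;
    repeated halving makes room for any multiple. *)
Lemma dense_div (M : oagType) (d : M) n :
  pres_one M = 0 -> 0 < d -> exists2 y, 0 < y & y *+ n <= d.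
Proof.
move=> one0 d0; elim: n => [|[|n] [y y0 yd]].
- by exists d; rewrite ?mulr0n // ltW.
- by exists d.
have [z /andP[z0 zy]] : exists z, 0 < z < y.
  apply: contrapT => no; move: (y0).
  have e : pres_one M = y.
    apply: pres_oneE => // z z0; rewrite oleNgt; apply/negP => zy.
    by apply: no; exists z; rewrite z0.
  by rewrite -e one0 ltxx.
have [w /andP[w0 w2]] : exists w, 0 < w <= y - w.
  have [h|h] := oltP z (y - z); first by exists z; rewrite z0 ltW.
  exists (y - z); apply/andP; split; first by apply: (olt1 zy); zmod.
  by apply: (ole1 h); zmod.
exists w => //; apply: le_trans yd.
have h : w *+ 2 <= y by apply: (ole1 w2); rewrite mulr2n; zmod.
apply: le_trans (omuln_le n.+1 h); rewrite -mulrnA; apply: omuln_geS.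
  exact: ltW.
lia.
Qed.

(* The set of pairs (ε, a) for which (0, ε) meets the class of a modulo N is
   quantifier-free definable; on pairs with a ≫ ε ≫ 1 and ε divisible enough,
   membership depends on the residue of a only, and (P a, a + P b) is such a
   pair, with witness a, for b large. *)
Lemma tiny_unif N : (0 < N)%N -> exists D,
  forall (M : oagType) (GM : elem_equiv G M) (d t : M),
  0 < d -> pres_one M *+ D <= d -> exists e, [/\ 0 < e, e < d & dvdby N (e - t)].
Proof.
move=> N0.
pose phi : formula bool := FEx (FAnd (FAnd (FLt TZero (TVar None))
  (FLt (TVar None) (TVar (Some true)))) (FCong N (TVar None) (TVar (Some false)))).
have [T [N1 [N10 hT]]] := qe_agree phi.
have [C hC] := lin_bool T.
(* A multiple of [N], so that adding multiples of [P] keeps the class modulo [N]; of [N1], so that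
   it keeps the divisibilities deciding [phi]; and at least 2, so that a < P a for a > 0. *)
pose P := (2 * (N * N1))%N.
have P2 : (1 < P)%N by rewrite /P; nia.
have P0 : (0 < P)%N by apply: ltnW.
have NP : (N %| P)%N by rewrite /P dvdn_mull // dvdn_mulr.
have N1P : (N1 %| P)%N by rewrite /P dvdn_mull // dvdn_mull.
exists (C.+1 * P)%N => M GM d t d0 bd.
have o0 := pres_one_ge0 M.
(* A multiple of [P] below [d] but beyond C · 1. In the discrete case d2 is (C + 1) · 1, the origin
   of the bound in the statement; in the dense case it is found by division. *)
have [d2 hd2 d2C] : exists2 d2, d2 *+ P <= d & pres_one M *+ C < d2 *+ P.
  have [o1|o1] := oltP 0 (pres_one M).
    exists (pres_one M *+ C.+1); first by rewrite -mulrnA.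
    have lt1 : pres_one M *+ C < pres_one M *+ C.+1.
      by apply: (olt1 o1); rewrite mulrS; zmod.
    rewrite -mulrnA; apply: lt_le_trans lt1 (omuln_geS o0 _).
    by rewrite leq_pmulr.
  have one0 : pres_one M = 0 by apply/eqP; rewrite eq_le o1.
  have [y y0 yd] := dense_div P one0 d0.
  by exists y => //; rewrite one0 mul0rn; apply: omuln_gt0.
pose d1 := d2 *+ P.
have d10 : 0 < d1 by apply: le_lt_trans (omuln_ge0 C o0) d2C.
have [b0 b00 hb0] : exists2 b, 0 <= b & d1 *+ C.+1 <= t + b.
  have [t0|t0] := oltP t 0.
    exists (d1 *+ C.+1 - t); last by rewrite (_ : t + _ = d1 *+ C.+1) ?lexx //; zmod.
    by apply: (ole2 (omuln_ge0 C.+1 (ltW d10)) (ltW t0)); zmod.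
  exists (d1 *+ C.+1); first exact: omuln_ge0 (ltW d10).
  by apply: (ole1 t0); zmod.
(* In the class of [t] modulo [P], and large enough for the lexicographic comparison with [d1]. *)
pose t1 := t + b0 *+ P.
have t1d : d1 *+ C.+1 <= t1.
  by apply: (ole2 hb0 (ole_mulnr b00 P0)); rewrite /t1; zmod.
have d1t : d1 <= t1 by apply: le_trans t1d; apply: ole_mulnr => //; exact: ltW.
have t10 : 0 < t1 by apply: lt_le_trans d1t.
pose b := t1 *+ (P * C.+1); pose t2 := t1 + b *+ P.
have b0' : 0 <= b by apply: omuln_ge0 (ltW t10).
have vw : forall t', List.In t' T -> agree N1
    (teval (fun k : bool => if k then d1 else t1) t')
    (teval (fun k : bool => if k then t1 *+ P else t2) t').
  move=> t' /hC[i [j [k [hi hj hk lin]]]]; rewrite !lin.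
  have [||||s1 s2] := @lex_sign M d1 t1 (t1 *+ P) t2 i j k C hi hk.
  - exact: d2C.
  - exact: t1d.
  - apply: lt_le_trans (ole_mulnr (ltW t10) P0).
    exact: lt_le_trans d2C d1t.
  - rewrite -mulrnA; apply: (ole2 (ltW t10) (ole_mulnr b0' P0)).
    by rewrite /t2 /b; zmod.
  split=> //; apply: dvdby_congr.
  rewrite (_ : _ - _ = (d1 - t1 *+ P) *~ i + (t1 - t2) *~ j); last first.
    by rewrite !mulrzBl; zmod.
  apply: dvdbyW N1P _; apply: dvdbyD; apply: dvdbyMz.
    by rewrite /d1 -mulrnBl; apply: dvdby_mul.
  by exists (- b); rewrite /t2 mulNrn; zmod.
have [_] := hT _ _ GM GM _ _ vw.
case=> [|x /= [[x0 xd] [z hz]]].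
  exists t1 => /=; split.
    split=> //; apply: lt_le_trans (omuln_geS (ltW t10) P2).
    by apply: (olt1 t10); rewrite mulr2n; zmod.
  suff [z hz] : dvdby N (t1 - t2) by exists z.
  by apply: dvdbyW NP _; exists (- b); rewrite /t2 mulNrn; zmod.
exists x; split=> //; first exact: lt_le_trans xd hd2.
rewrite (_ : x - t = (x - t1) + b0 *+ P); last by rewrite /t1; zmod.
by apply: dvdbyD; [exists z|apply: dvdbyW NP _; apply: dvdby_mul].
Qed.

Lemma tiny (M : oagType) (GM : elem_equiv G M) N (d t : M) :
  (0 < N)%N -> big d -> exists e, [/\ 0 < e, e < d & dvdby N (e - t)].
Proof.
move=> /tiny_unif[D h] bd; apply: h GM d t (big_gt0 bd) (ltW (bd D)).
Qed.

(** An element congruent to kt modulo Nk is k times an element congruent to t modulo N; [tiny] is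
    applied to the former. *)
Lemma tiny_mul (M : oagType) (GM : elem_equiv G M) N k (d t : M) :
  (0 < N)%N -> (0 < k)%N -> big d ->
  exists e, [/\ 0 < e, e *+ k < d & dvdby N (e - t)].
Proof.
move=> N0 k0 bd.
have [||e [e0 ed [z hz]]] := @tiny M GM (N * k) d (t *+ k); rewrite ?muln_gt0 ?N0 //.
have ee : e = (t + z *+ N) *+ k by rewrite mulrnDl -mulrnA -hz; zmod.
exists (t + z *+ N); split.
- by rewrite -(oltMn _ _ k0) mul0rn -ee.
- by rewrite -ee.
- by exists z; zmod.
Qed.

End Regular.

(** * Elementary extensions and pure hulls *)

Section Embedding.
Variables (U : oagType) (X : elemext U).
Local Notation emb := (@emb U X).

Lemma emb_elem : elem_eq (fun u : U => u) emb. Proof. by case: X. Qed.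

Lemma emb_elem' W (v : W -> U) : elem_eq v (emb \o v).
Proof. by move=> phi; have := elem_eq_rename v emb_elem phi. Qed.

Lemma emb_equiv G : elem_equiv G U -> elem_equiv G X.
Proof.
move=> h; apply: elem_eq_trans h _.
have := elem_eq_rename (@of_void U) emb_elem.
by have -> : emb \o @of_void U = @of_void X by apply: funext; case.
Qed.

Lemma emb_lt x y : (emb x < emb y) = (x < y).
Proof.
have /= h := emb_elem' (fun b : bool => if b then x else y)
  (FLt (TVar true) (TVar false)).
by apply/idP/idP; apply h.
Qed.

Lemma emb_le x y : (emb x <= emb y) = (x <= y).
Proof. by rewrite !oleNgt emb_lt. Qed.

Lemma embD x y : emb (x + y) = emb x + emb y.
Proof.
have /= h := emb_elem' (fun b => if b is Some b then if b then x else y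
  else x + y) (FEq (TVar None) (TAdd (TVar (Some true)) (TVar (Some false)))).
by apply h.
Qed.

Lemma emb0 : emb 0 = 0.
Proof. by apply: (addrI (emb 0)); rewrite -embD !addr0. Qed.

Lemma embN x : emb (- x) = - emb x.
Proof. by apply: (addrI (emb x)); rewrite -embD !subrr emb0. Qed.

Lemma emb1 : emb (pres_one U) = pres_one X.
Proof.
have /= h := emb_elem (FEq (TVar (pres_one U)) TOne).
by apply h.
Qed.

Lemma emb_teval W (v : W -> U) (t : term W) :
  teval (fun w => emb (v w)) t = emb (teval v t).
Proof.
by elim: t => //= [||a ->|a -> b ->]; rewrite ?emb0 ?emb1 ?embN ?embD.
Qed.

Lemma embMn x n : emb (x *+ n) = emb x *+ n.
Proof. by elim: n => [|n ih]; rewrite ?mulr0n ?emb0 // !mulrS embD ih. Qed.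

Lemma embMz x z : emb (x *~ z) = emb x *~ z.
Proof. by case: z => n; rewrite ?NegzE ?mulrNz -!pmulrn ?embN embMn. Qed.

Lemma emb_dvdby N u : dvdby N (emb u) <-> dvdby N u.
Proof.
have := emb_elem (FCong N (TVar u) TZero); rewrite /= !subr0 => h.
by split; apply h.
Qed.

Lemma emb_pure n x u : (0 < n)%N -> x *+ n = emb u -> exists u', x = emb u'.
Proof.
move=> n0 e; have [|z hz] := (emb_dvdby n u).1; first by exists x.
by exists z; apply: (omuln_inj n0); rewrite /= -embMn -hz.
Qed.

End Embedding.

(** The pure hull of the subgroup generated by the tuple and 1; it is the definable closure, by
    [dcl_phull]. *)
Definition phull (M : oagType) W (v : W -> M) : set M :=
  [set x | exists n a, (0 < n)%N /\ x *+ n = teval v a].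

Section Frac.
Variables (M : oagType) (W : Type) (v : W -> M).

Lemma phull_teval a : phull v (teval v a).
Proof. by exists 1%N, a. Qed.

Lemma phullB x y : phull v x -> phull v y -> phull v (x - y).
Proof.
move=> [n [a [n0 ha]]] [m [b [m0 hb]]].
exists (n * m)%N, (TAdd (TMuln a m) (TOpp (TMuln b n))).
rewrite muln_gt0 n0 m0; split=> //=.
by rewrite !teval_muln -ha -hb -!mulrnA mulrnBl [(m * n)%N]mulnC.
Qed.

Lemma phull0 : phull v 0. Proof. exact: (phull_teval TZero). Qed.

Lemma phullN x : phull v x -> phull v (- x).
Proof. by rewrite -sub0r; apply: phullB; apply: phull0. Qed.

Lemma phullD x y : phull v x -> phull v y -> phull v (x + y).
Proof. by move=> h /phullN h'; rewrite -[y]opprK; apply: phullB. Qed.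

Lemma phullMn x n : phull v x -> phull v (x *+ n).
Proof.
by move=> h; elim: n => [|n ih]; rewrite ?mulr0n ?mulrS; [apply: phull0|apply: phullD].
Qed.

Lemma phullMz x z : phull v x -> phull v (x *~ z).
Proof.
by case: z => n h; rewrite ?NegzE ?mulrNz -pmulrn; [|apply: phullN]; apply: phullMn.
Qed.

Lemma phull_pure x n : (0 < n)%N -> phull v (x *+ n) -> phull v x.
Proof.
move=> n0 [m [a [m0 ha]]]; exists (n * m)%N, a.
by rewrite muln_gt0 n0 m0 mulrnA.
Qed.

End Frac.

(** * Moving an element within its cut over a tuple *)

Section Perturbation.
Variables (G : oagType) (regG : regular G).
Variables (M : oagType) (GM : elem_equiv G M) (W : Type) (v : W -> M).
Local Notation ev t z := (teval (ocons z v) t).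

(** Besides having equal signs, all nonconstant terms are infinite in absolute value at both points;
    this is the room needed to move within the cut. *)
Definition same_cut (x y : M) := forall t : term (option W), tcoef t != 0 ->
  (big (ev t x) /\ big (ev t y)) \/ (big (- ev t x) /\ big (- ev t y)).

(** The points have separate roles: [x] supplies the truth of [phi], [y] the place and [g] the
    residue. By quantifier elimination only finitely many signs and divisibilities by [N] matter. If
    k bounds the slopes of the terms and [eta] their absolute values at [y] from below, a move by e
    with ke < [eta] keeps the signs, and [tiny_mul] finds such a move into the class of [g]. *)
Lemma perturb (phi : formula (option W)) x y :
  holds (ocons x v) phi -> same_cut x y ->
  exists N, (0 < N)%N /\ forall P g, (0 < P)%N -> (N %| P)%N ->
    (forall t, dvdby N (ev t x) <-> dvdby N (ev t g)) ->
    (exists e, [/\ 0 < e, dvdby P (y + e - g) & holds (ocons (y + e) v) phi]) /\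
    (exists e, [/\ 0 < e, dvdby P (y - e - g) & holds (ocons (y - e) v) phi]).
Proof.
move=> phix cut.
have [T [N [N0 hT]]] := qe_agree regG phi.
exists N; split=> // P g P0 NP hg.
have [eta [k [beta k0 hk]]] : exists eta k, [/\ big eta, (0 < k)%N &
    forall t, List.In t T -> tcoef t != 0 -> (`|tcoef t| <= k)%N /\
      (eta <= ev t y \/ eta <= - ev t y)].
  elim: T {hT} => [|t T [eta [k [beta k0 hk]]]].
    have [[_ b]|[_ b]] := cut (TVar None) isT.
      by exists y, 1%N; split=> // t [].
    by exists (- y), 1%N; split=> // t [].
  have [t0|t0] := eqVneq (tcoef t) 0.
    exists eta, k; split=> // t' [<-|/hk //]; by rewrite t0.
  have [b [bb hb]] : exists b, big b /\ (b <= ev t y \/ b <= - ev t y).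
    by have [[_ b]|[_ b]] := cut t t0; [exists (ev t y)|exists (- ev t y)];
       split=> //; [left|right].
  have [c [bc c1 c2]] : exists c, [/\ big c, c <= b & c <= eta].
    by have /orP[h|h] := ole_total b eta; [exists b|exists eta].
  exists c, (k + `|tcoef t|)%N; split=> //; first by rewrite addn_gt0 k0.
  move=> t' [<-|ht'] nt'.
    split; first by rewrite leq_addl.
    by case: hb => hb'; [left|right]; apply: le_trans hb'.
  have [h1 h2] := hk t' ht' nt'; split; first by apply: leq_trans h1 (leq_addr _ _).
  by case: h2 => h2; [left|right]; apply: le_trans h2.
have key z e : dvdby P (z - g) -> 0 < e -> e *+ k < eta ->
    z = y + e \/ z = y - e -> holds (ocons z v) phi.
  move=> zg e0 ek hz.
  suff hh t : List.In t T -> agree N (ev t x) (ev t z).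
    by case: (hT _ _ GM GM _ _ hh) => + _; apply.
  move=> ht.
  have hd : dvdby N (ev t x) <-> dvdby N (ev t z).
    rewrite hg; apply: dvdby_congr; rewrite !teval_coef.
    rewrite (_ : _ - _ = - ((z - g) *~ tcoef t)); last by rewrite mulrzBl; zmod.
    by apply: dvdbyN; apply: dvdbyMz; apply: dvdbyW NP _.
  have [t0|t0] := eqVneq (tcoef t) 0.
    by rewrite !teval_coef t0 !mulr0z.
  have [hk1 hk2] := hk t ht t0.
  have [d [ez d1 d2]] : exists d, [/\ ev t z = ev t y + d, - (e *+ k) <= d &
      d <= e *+ k].
    have [h1 h2] := omulz_le (ltW e0) hk1.
    case: hz => ->; rewrite !teval_coef.
      by exists (e *~ tcoef t); split=> //; rewrite mulrzDl; zmod.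
    exists (- (e *~ tcoef t)); split.
    - by rewrite mulrzBl; zmod.
    - by apply: (ole1 h2); zmod.
    - by apply: (ole1 h1); zmod.
  have [[/big_gt0 bx /big_gt0 by_]|[/big_gt0 bx /big_gt0 by_]] := cut t t0.
    have hy : eta <= ev t y.
      case: hk2 => // h; have : 0 < - ev t y by apply: lt_le_trans (big_gt0 beta) h.
      by move=> h'; apply: (@oltF M 0); apply: (olt2 by_ (ltW h')); zmod.
    have hz0 : 0 < ev t z by rewrite ez; apply: (olt3 ek hy d1); zmod.
    by split; rewrite // ?hz0 ?bx ?(lt_gtF hz0) ?(lt_gtF bx).
  have hy : eta <= - ev t y.
    case: hk2 => // h; have : 0 < ev t y by apply: lt_le_trans (big_gt0 beta) h.
    by move=> h'; apply: (@oltF M 0); apply: (olt2 by_ (ltW h')); zmod.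
  have hz0 : ev t z < 0 by rewrite ez; apply: (olt3 ek hy d2); zmod.
  have hx0 : ev t x < 0 by apply: (olt1 bx); zmod.
  by split; rewrite // ?hz0 ?hx0 ?(lt_gtF hz0) ?(lt_gtF hx0).
split.
  have [e [e0 ek he]] := tiny_mul regG GM (g - y) P0 k0 beta.
  have he' : dvdby P (y + e - g) by rewrite (_ : _ - _ = e - (g - y)); [|zmod].
  by exists e; split=> //; apply: key ek _ => //; left.
have [e [e0 ek he]] := tiny_mul regG GM (y - g) P0 k0 beta.
have he' : dvdby P (y - e - g).
  by rewrite (_ : _ - _ = - (e - (y - g))); [apply: dvdbyN|zmod].
by exists e; split=> //; apply: key ek _ => //; right.
Qed.

Lemma same_cutC x y : same_cut x y -> same_cut y x.
Proof.
by move=> h t /h[[h1 h2]|[h1 h2]]; [left|right].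
Qed.

(** A term of slope n that changes sign from [x] to [y], or takes a multiple of 1 as value at one of
    them, puts a fraction a/n into the interval. *)
Lemma gap_same_cut x y : x <= y ->
  (forall n a, (0 < n)%N -> x *+ n <= teval v a -> teval v a <= y *+ n -> False) ->
  same_cut x y.
Proof.
move=> xy no.
have pos t n : (0 < n)%N -> tcoef t = n%:Z ->
  (big (ev t x) /\ big (ev t y)) \/ (big (- ev t x) /\ big (- ev t y)).
  move=> n0 tn; have evE z : ev t z = z *+ n + teval v (trest t).
    by rewrite teval_coef tn -pmulrn.
  have nz z : ev t x <= pres_one M *~ z -> pres_one M *~ z <= ev t y -> False.
    rewrite !evE => h1 h2.
    apply: (no n (TAdd (TMulz TOne z) (TOpp (trest t))) n0) => /=;
      rewrite teval_mulz /=.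
      by apply: (ole1 h1); zmod.
    by apply: (ole1 h2); zmod.
  have le : ev t x <= ev t y.
    by rewrite !evE; apply: (ole1 (omuln_le n xy)); zmod.
  have [x0|x0] := oltP 0 (ev t x).
    have bx : big (ev t x).
      by apply: not_near_one => // z e; apply: (nz z); rewrite -e.
    by left; split=> //; apply: big_le bx le.
  have y0 : ev t y < 0.
    by rewrite oltNge; apply/negP => y0; apply: (nz 0); rewrite mulr0z.
  have b : big (- ev t y).
    apply: not_near_one => [z e|]; last by apply: (olt1 y0); zmod.
    by apply: (nz (- z)); rewrite mulrNz -e opprK.
  by right; split=> //; apply: big_le b _; apply: (ole1 le); zmod.
move=> t; case E : (tcoef t) => [[|n]|n] // _; first exact: pos E.
have E' : tcoef (TOpp t) = n.+1%:Z by rewrite /= E NegzE opprK.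
case: (pos (TOpp t) n.+1 isT E') => /= -[h1 h2]; first by right.
by left; move: h1 h2; rewrite !opprK.
Qed.

Lemma not_phull_same_cut x : ~ phull v x -> same_cut x x.
Proof.
move=> nx; apply: gap_same_cut => // n a n0 h1 h2; apply: nx.
by exists n, a; split=> //; apply/eqP; rewrite eq_le h1.
Qed.

End Perturbation.

(** An element outside the pure hull can be perturbed within any formula it satisfies, so none
    defines it. Conversely, division by n is unique. *)
Lemma dcl_phull G (regG : regular G) (M : oagType) (GM : elem_equiv G M)
    (S : set M) (x : M) :
  dcl S x <-> phull (fun s : S => val s) x.
Proof.
split=> [[phi hphi]|[n [a [n0 ha]]]].
  apply: contrapT => nx; have phix : holds (ocons x (fun s : S => val s)) phi.
    by apply/hphi.
  have [N [N0 h]] := perturb regG GM phix (not_phull_same_cut nx).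
  have [|[e [e0 _ /hphi he]] _] := h N x N0 (dvdnn N); first by [].
  by move: e0; rewrite -(addrK x e) (addrC e) he subrr ltxx.
exists (FEq (TMuln (TVar None) n) (trename Some a)) => y /=.
rewrite teval_muln teval_rename /=.
have -> : ocons y (fun s : S => val s) \o Some = (fun s : S => val s) by [].
by split=> [|->//]; rewrite -ha => /(omuln_inj n0).
Qed.

(** * Computing the invariants in an arbitrary realization *)

Section Realizations.
Variables (U : oagType) (I : Type) (q : ftype I U).

Lemma dcl_base G (regG : regular G) (GU : elem_equiv G U) (c : realization q) x :
  dcl (base c) x <-> phull (sjoin (rtup c) (@emb U c)) x.
Proof.
rewrite (dcl_phull regG (emb_equiv c GU)); split=> -[n [a [n0 ha]]].
  have /choice[f hf] : forall s : base c, exists k : I + U,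
      val s = sjoin (rtup c) (@emb U c) k.
    move=> [s hs] /=; case: (set_mem hs) => -[z _ <-]; first by exists (inr z).
    by exists (inl z).
  exists n, (trename f a); split=> //; rewrite ha teval_rename.
  by apply: teval_occ => s _; apply: hf.
have hb k : base c (sjoin (rtup c) (@emb U c) k).
  by case: k => k; [right|left]; exists k.
exists n, (trename (fun k => @exist _ (fun z => z \in base c) _ (mem_set (hb k))) a).
by rewrite teval_rename; split.
Qed.

Lemma realizes_iff (X : elemext U) (c : I -> X) : global_type q ->
  realizes (@emb U X) c q ->
  forall phi, holds (sjoin c (@emb U X)) phi <-> q phi.
Proof.
move=> [_ cq] rc phi; split=> [h|]; last exact: rc.
by case: (cq phi) => // /rc.
Qed.

Lemma subgroup_span (X : oagType) (W : Type) (v : W -> X) :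
  subgroup (range (teval v)).
Proof.
split; first by exists TZero.
by move=> _ _ [a _ <-] [b _ <-]; exists (TAdd a (TOpp b)).
Qed.

Lemma span_base (c : realization q) :
  smallest (@subgroup c) (base c) =
  range (teval (sjoin (rtup c) (@emb U c))).
Proof.
apply/seteqP; split.
  apply: smallest_sub; first exact: subgroup_span.
  by move=> x [[u _ <-]|[i _ <-]]; [exists (TVar (inr u))|exists (TVar (inl i))].
move=> _ [a _ <-] S [[S0 SB] baseS].
have SN x : S x -> S (- x) by move=> h; rewrite -sub0r; apply: SB.
elim: a => /= [[i|u]|||a ha|a ha b hb].
- by apply: baseS; right; exists i.
- by apply: baseS; left; exists u.
- exact: S0.
- by apply: baseS; left; exists (pres_one U) => //; apply: emb1.
- exact: SN.
- by rewrite -[teval _ b]opprK; apply: SB => //; apply: SN.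
Qed.

Lemma fills_transfer (X Y : elemext U) (c : I -> X) (d : I -> Y) H (a : term (I + U)) :
  global_type q ->
  realizes (@emb U X) c q -> realizes (@emb U Y) d q ->
  fills H (teval (sjoin c (@emb U X)) a) -> fills H (teval (sjoin d (@emb U Y)) a).
Proof.
move=> gq rc rd.
have h phi : holds (sjoin c (@emb U X)) phi -> holds (sjoin d (@emb U Y)) phi.
  by move=> /(realizes_iff gq rc) /rd.
move=> [f1 f2]; split=> [u /f1|u /f2] hu.
  exact: (h (FLt (TVar (inr u)) a)).
exact: (h (FLt a (TVar (inr u)))).
Qed.

(** Filling a cut by a given term is expressed by formulas of the type, so any single realization
    decides membership. *)
Lemma HsetP (X : elemext U) (c : I -> X) H : global_type q ->
  realizes (@emb U X) c q ->
  Hset q H <-> convex_subgroup H /\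
    exists a, fills H (teval (sjoin c (@emb U X)) a).
Proof.
move=> gq rc; split=> -[cH].
  move=> [d [x [+ fx]]]; rewrite span_base => -[a _ ax]; split=> //.
  by exists a; apply: (@fills_transfer d X (rtup d) c H a gq _ rc); [case: (d)|rewrite ax].
move=> [a fa]; split=> //; exists (Realization rc), (teval (sjoin c (@emb U X)) a).
by rewrite span_base; split=> //; exists a.
Qed.

End Realizations.

(** * Cuts of convex subgroups *)

Section Fills.
Variables (G : oagType) (regG : regular G) (U : oagType) (GU : elem_equiv G U).
Variables (X : elemext U) (H : set U) (cH : convex_subgroup H).

Lemma subgroupN h : H h -> H (- h).
Proof. by case: cH => -[H0 HB] _ Hh; rewrite -sub0r; apply: HB. Qed.

Lemma subgroupD h k : H h -> H k -> H (h + k).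
Proof.
by case: (cH) => -[H0 HB] _ Hh /subgroupN; rewrite -[in H (h + k)](opprK k); apply: HB.
Qed.

Lemma subgroupMn h n : H h -> H (h *+ n).
Proof.
move=> Hh; elim: n => [|n ih]; first by rewrite mulr0n; case: cH => -[].
by rewrite mulrS; apply: subgroupD.
Qed.

Definition above (u : U) := forall h, H h -> h < u.

Lemma not_above u : 0 <= u -> ~ H u -> above u.
Proof.
move=> u0 nu h Hh; rewrite oltNge; apply/negP => uh; apply: nu.
by case: cH => -[H0 _]; apply; [exact: H0|exact: Hh|exact: u0|exact: uh].
Qed.

Lemma above_notin u : above u -> ~ H u.
Proof. by move=> au /au; rewrite ltxx. Qed.

Lemma above_gt0 u : above u -> 0 < u.
Proof. by apply; case: cH => -[]. Qed.

Lemma fills_gt0 (x : X) : fills H x -> 0 < x.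
Proof. by move=> [h _]; rewrite -(emb0 X); apply: h; case: cH => -[]. Qed.

(** The filling element is positive, hence at least 1, so 1 is not above [H]; therefore [H] contains
    1 and its multiples. *)
Lemma above_big (x : X) u : fills H x -> above u -> big u.
Proof.
move=> fx au m; apply: au; apply: subgroupMn.
have := pres_one_ge0 U; rewrite le_eqVlt => /orP[/eqP <-|o0].
  by case: cH => -[].
apply: contrapT => /(not_above (ltW o0))/fx.2.
by rewrite emb1 oltNge pres_one_le' //; apply: fills_gt0.
Qed.

(** Take e congruent to u modulo k with 2e < u. Then u' = (u - e)/k satisfies 2k u' > u, so u'
    cannot lie in [H]. *)
Lemma above_div (x : X) u k : fills H x -> above u -> (0 < k)%N ->
  exists2 u', above u' & u' *+ k <= u.
Proof.
move=> fx au k0.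
have [e [e0 e2 [z hz]]] := tiny_mul regG GU u k0 (isT : 0 < 2)%N (above_big fx au).
exists (- z); last first.
  rewrite mulNrn -hz; apply: (ole1 (ltW e0)); zmod.
have hz2 : u < (- z) *+ k *+ 2.
  by rewrite mulNrn -hz; apply: (olt1 e2); rewrite mulr2n; zmod.
apply: not_above.
  rewrite oleNgt; apply/negP => z0; have := lt_trans (above_gt0 au) hz2.
  by rewrite oltNge -mulrnA -(mul0rn U (k * 2)) omuln_le // ltW.
move=> Hz; have := au _ (subgroupMn 2 (subgroupMn k Hz)).
by rewrite oltNge ltW.
Qed.

Lemma fills_mul (x : X) n : (0 < n)%N -> fills H x -> fills H (x *+ n).
Proof.
move=> n0 fx; split=> [h /fx.1 hx|u au].
  by apply: lt_le_trans hx _; apply: ole_mulnr => //; apply: ltW; apply: fills_gt0.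
have [u' au' le] := above_div fx au n0.
apply: (@lt_le_trans _ _ (@emb U X u' *+ n)); last by rewrite -embMn emb_le.
by apply: omuln_lt => //; apply: fx.2.
Qed.

End Fills.

(** * Residue classes *)

Lemma bezout_coprime a b : coprime a b ->
  exists u v : int, u * a%:Z + v * b%:Z = 1.
Proof.
move=> ab; have [u [v h]] := Bezoutz a%:Z b%:Z; exists u, v.
by rewrite h /gcdz; congr Posz; apply/eqP.
Qed.

Lemma bezout_prime l (k : int) : prime l -> ~~ (l %| k)%Z ->
  exists u v : int, u * k + v * l%:Z = 1.
Proof.
move=> pl lk; have [u [v h]] := Bezoutz k l%:Z; exists u, v; rewrite h /gcdz /=.
have : coprime l `|k| by rewrite prime_coprime // -dvdzE.
by rewrite coprime_sym /coprime => /eqP ->.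
Qed.

Lemma dvdby_coprime (M : zmodType) a b (x : M) : coprime a b ->
  dvdby a x -> dvdby b x -> dvdby (a * b) x.
Proof.
move=> ab [y hy] [z hz].
have [u [v huv]] := bezout_coprime ab; exists (z *~ u + y *~ v).
have e1 : x *~ (u * a%:Z) = z *~ u *+ (a * b).
  by rewrite {1}hz !pmulrn -!mulrzA; congr (_ *~ _); lia.
have e2 : x *~ (v * b%:Z) = y *~ v *+ (a * b).
  by rewrite {1}hy !pmulrn -!mulrzA; congr (_ *~ _); lia.
by rewrite -[LHS]mulr1z -huv mulrzDr mulrnDl e1 e2.
Qed.

(** * Bases of D modulo ℓD + U *)

Section Bases.
Variables (G : oagType) (regG : regular G) (U : oagType) (GU : elem_equiv G U).
Variables (I : Type) (q : ftype I U) (c : realization q).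
Variables (l : nat) (pl : prime l).
Local Notation D := (dcl (base c)).
Local Notation emb := (@emb U c).
Local Notation sub := (kappa_sub l c).

Lemma D_phull x : D x <-> phull (sjoin (rtup c) emb) x.
Proof. exact: dcl_base regG GU c x. Qed.

Lemma DB x y : D x -> D y -> D (x - y).
Proof. by rewrite !D_phull; apply: phullB. Qed.

Lemma D_D x y : D x -> D y -> D (x + y).
Proof. by rewrite !D_phull; apply: phullD. Qed.

Lemma DMz x z : D x -> D (x *~ z).
Proof. by rewrite !D_phull; apply: phullMz. Qed.

Lemma D_emb u : D (emb u).
Proof. by apply/D_phull; apply: (phull_teval _ (TVar (inr u))). Qed.

Lemma D0 : D 0. Proof. by rewrite -(emb0 c); apply: D_emb. Qed.

Lemma D_pure x n : (0 < n)%N -> D (x *+ n) -> D x.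
Proof. by move=> n0; rewrite !D_phull; apply: phull_pure. Qed.

Lemma D_sum (s : seq c) (z : c -> int) : (forall e, e \in s -> D e) ->
  D (\sum_(e <- s) e *~ z e).
Proof.
elim: s => [|e s ih] h; first by rewrite big_nil; apply: D0.
rewrite big_cons; apply: D_D; first by apply: DMz; apply: h; rewrite inE eqxx.
by apply: ih => x xs; apply: h; rewrite inE xs orbT.
Qed.

Lemma subP x : D x -> sub x <-> exists u, dvdby l (x - emb u).
Proof.
move=> Dx; split=> [[d [Dd [u ->]]]|[u [z hz]]].
  by exists u; exists d; zmod.
exists z; split; last by exists u; rewrite -hz; zmod.
by apply: D_pure (prime_gt0 pl) _; rewrite -hz; apply: DB => //; apply: D_emb.
Qed.

Lemma sub_emb u : sub (emb u).
Proof. by exists 0; split; [apply: D0|exists u; rewrite mul0rn add0r]. Qed.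

Lemma sub_mul d : D d -> sub (d *+ l).
Proof. by move=> h; exists d; split=> //; exists 0; rewrite emb0 addr0. Qed.

Lemma subB x y : sub x -> sub y -> sub (x - y).
Proof.
move=> [d [Dd [u ->]]] [d' [Dd' [u' ->]]].
exists (d - d'); split; first exact: DB.
by exists (u - u'); rewrite embD embN mulrnBl; zmod.
Qed.

Lemma sub0 : sub 0. Proof. by rewrite -(emb0 c); apply: sub_emb. Qed.

Lemma subN x : sub x -> sub (- x).
Proof. by move=> h; rewrite -sub0r; apply: subB h; apply: sub0. Qed.

Lemma sub_add x y : sub x -> sub y -> sub (x + y).
Proof. by move=> h /subN h'; rewrite -[y]opprK; apply: subB. Qed.

Lemma subMz x z : sub x -> sub (x *~ z).
Proof.
move=> [d [Dd [u ->]]]; exists (d *~ z); split; first exact: DMz.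
by exists (u *~ z); rewrite embMz mulrzDl !pmulrn -!mulrzA [_ * z]mulrC.
Qed.

(** Independence and span with integer coefficients on duplicate-free sequences are easier to
    manipulate than tuples over 'F_l; [kbasisP] relates the two forms. *)
Definition kindep (B : set c) := forall (s : seq c) (z : c -> int), uniq s ->
  (forall e, e \in s -> B e) -> sub (\sum_(e <- s) e *~ z e) ->
  forall e, e \in s -> (l %| z e)%Z.

Definition kspan (B : set c) (x : c) := exists (s : seq c) (z : c -> int),
  [/\ uniq s, forall e, e \in s -> B e & sub (x - \sum_(e <- s) e *~ z e)].

Lemma card_Fl (k : 'F_l) : (k < l)%N.
Proof. by rewrite -[X in (_ < X)%N](Fp_cast pl); apply: ltn_ord. Qed.

Lemma sum_tuple (s : seq c) (z : c -> int) :
  let b (i : 'I_(size s)) := s`_i in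
  let k (i : 'I_(size s)) : 'F_l := (`|(z (b i) %% l)%Z|)%:R in
  (forall e, e \in s -> D e) ->
  sub (\sum_(e <- s) e *~ z e - \sum_i b i *+ k i).
Proof.
move=> b k hs; rewrite (big_nth 0) big_mkord -sumrB.
elim/big_ind: _ => [||i _]; [exact: sub0|exact: sub_add|].
have -> : (k i : nat) = `|(z (b i) %% l)%Z|%N.
  rewrite /k val_Fp_nat // modn_small //.
  have l0 : 0 < l%:Z by rewrite ltz_nat prime_gt0.
  by rewrite -ltz_nat gez0_abs ?modz_ge0 ?gt_eqF // ltz_pmod.
have l0 : l%:Z != 0 by rewrite eqz_nat -lt0n prime_gt0.
rewrite -/(b i) [in X in _ *~ X](divz_eq (z (b i)) l) mulrzDr pmulrn.
rewrite gez0_abs ?modz_ge0 // addrK mulrzA -pmulrn.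
by apply: sub_mul; apply: DMz; apply: hs; rewrite mem_nth.
Qed.

Lemma kindepP (B : set c) : B `<=` D ->
  (forall (n : nat) (b : 'I_n -> c) (k : 'I_n -> 'F_l),
        injective b -> (forall i, B (b i)) ->
        sub (\sum_(i < n) b i *+ k i) -> forall i, k i = 0) -> kindep B.
Proof.
move=> BD h s z us sB hsum e es.
pose b (i : 'I_(size s)) := s`_i.
pose k (i : 'I_(size s)) : 'F_l := (`|(z (b i) %% l)%Z|)%:R.
have injb : injective b.
  by move=> i j /eqP; rewrite /b nth_uniq // => /eqP/val_inj.
have Bb i : B (b i) by apply: sB; rewrite mem_nth.
have := h _ b k injb Bb.
have hd : forall e, e \in s -> D e by move=> x /sB/BD.
have -> : \sum_i b i *+ k i = (\sum_(e <- s) e *~ z e) -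
   (\sum_(e <- s) e *~ z e - \sum_i b i *+ k i) by zmod.
move=> /(_ (subB hsum (sum_tuple z hd))) hk.
have hi : (index e s < size s)%N by rewrite index_mem.
have := congr1 (@nat_of_ord _) (hk (Ordinal hi)).
rewrite /k /b /= nth_index // val_Fp_nat // modn_small => [|]; last first.
  have l0 : 0 < l%:Z by rewrite ltz_nat prime_gt0.
  by rewrite -ltz_nat gez0_abs ?modz_ge0 ?gt_eqF // ltz_pmod.
by move=> /eqP; rewrite absz_eq0 => /eqP h0; apply/dvdz_mod0P.
Qed.

Lemma kbasisP (B : set c) : B `<=` D ->
  kappa_basis l B <-> kindep B /\ forall x, D x -> kspan B x.
Proof.
move=> BD; split=> [[_ ind sp]|[ind sp]].
  split=> [|x Dx]; first exact: kindepP.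
  have [n [b [k [Bb hx]]]] := sp x Dx.
  pose s := undup (map b (enum 'I_n)).
  (* The spanning tuple may repeat entries, so their coefficients are collected. *)
  exists s, (fun e => \sum_(i < n | b i == e) (k i)%:Z); split.
  - exact: undup_uniq.
  - by move=> e; rewrite mem_undup => /mapP[i _ ->].
  have -> // : \sum_(e <- s) e *~ (\sum_(i < n | b i == e) (k i)%:Z) =
            \sum_(i < n) b i *+ k i.
  under eq_bigr => e _ do rewrite (big_morph _ (mulrzDr e) (mulr0z e)).
  rewrite (exchange_big_dep xpredT) //=; apply: eq_bigr => i _.
  rewrite -big_filter (_ : [seq e <- s | b i == e] = [:: b i]).
    by rewrite big_seq1 -pmulrn.
  have : b i \in s by rewrite mem_undup map_f ?mem_enum.
  have : uniq s by apply: undup_uniq.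
  elim: (s) => //= e s' ih /andP[es us]; rewrite inE eq_sym.
  case: eqP => [ebi|_] /= => [_|/(ih us) //].
  rewrite -ebi; congr (_ :: _); apply/eqP; rewrite -[_ == _]negbK -has_filter.
  by apply/hasPn => y ys; apply: contraNneq es => ->.
split=> //; last first.
  move=> x /sp[s [z [us sB hx]]].
  exists (size s), (fun i => s`_i), (fun i => (`|(z s`_i %% l)%Z|)%:R).
  split=> [i|]; first by apply: sB; rewrite mem_nth.
  have := sum_tuple (s := s) z (fun e es => BD _ (sB e es)).
  move=> /(sub_add hx); set S := \sum_(e <- s) _; set S' := \sum_(i < _) _.
  by rewrite (_ : _ + _ = x - S'); [|zmod].
move=> n b k injb Bb hsum i.
pose z e : int := \sum_(i < n | b i == e) (k i)%:Z.
have zb j : z (b j) = k j.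
  rewrite /z (eq_bigl (pred1 j)) ?big_pred1_eq // => j' /=.
  by apply/eqP/eqP => [/injb|->].
have := ind (map b (enum 'I_n)) z.
rewrite map_inj_uniq ?enum_uniq // => /(_ isT).
rewrite big_map big_enum /=; under eq_bigr => j _ do rewrite zb -pmulrn.
have hB e : e \in [seq b i | i <- enum 'I_n] -> B e by move=> /mapP[j _ ->].
move=> /(_ hB hsum (b i)); rewrite map_f ?mem_enum // zb => /(_ isT).
rewrite dvdzE /= => lk; apply: val_inj; apply/eqP => /=.
have := card_Fl (k i); case: (posnP (k i)) => [->//|k0].
by move=> kl; have := dvdn_leq k0 lk; rewrite leqNgt kl.
Qed.

(** Zorn's lemma is applied to the sets added to [B], so that the empty chain is no exception. If x
    is not spanned, its coefficient in any relation is divisible by ℓ, as otherwise Bézout would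
    solve the relation for x. *)
Lemma basis_ext (B : set c) : B `<=` D -> kindep B ->
  exists C : set c, B `<=` C /\ kappa_basis l C.
Proof.
move=> BD indB; pose P (C : set c) := C `<=` D /\ kindep (C `|` B).
have [|C [[CD indC] maxC]] := @Zorn_bigcup _ P.
  move=> F FP totF; split=> [x [X /FP[XD _]]|]; first exact: XD.
  move=> s z us sF hsum e es.
  have [X [indX hX]] : exists X : set c, kindep (X `|` B) /\
      forall e, e \in s -> (X `|` B) e.
    suff [X [hX1 hX2]] : exists X : set c, (F X \/ X = set0) /\
        forall e, e \in s -> (X `|` B) e.
      exists X; split=> //; case: hX1 => [/FP[]//|->]; by rewrite set0U.
    elim: s sF {us hsum e es} => [|e s ih] sF; first by exists set0; split; [right|].
    have [x xs|X [FX hX]] := ih; first by apply: sF; rewrite inE xs orbT.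
    have : (\bigcup_(X in F) X `|` B) e by apply: sF; rewrite inE eqxx.
    case=> [[Y FY Ye]|Be]; last first.
      exists X; split=> // x; rewrite inE => /orP[/eqP ->|/hX //]; by right.
    have [YX|XY] : Y `<=` X \/ X `<=` Y.
    - case: FX => [FX|->]; last by right.
      exact: totF.
    - exists X; split=> // x; rewrite inE => /orP[/eqP ->|/hX //]; left; exact: YX.
    exists Y; split; first by left.
    move=> x; rewrite inE => /orP[/eqP ->|/hX[/XY|]]; by [left|left|right].
  exact: (indX s z).
have CBD : C `|` B `<=` D by move=> x [/CD|/BD].
exists (C `|` B); split; first exact: subsetUr.
apply/kbasisP => //; split=> // x Dx; apply: contrapT => nsp.
apply: (maxC (C `|` [set x])).
  rewrite properEneq; split; last exact: subsetUl.
  apply/eqP => e; apply: nsp; exists [:: x], (fun=> 1); split=> //.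
    by move=> y; rewrite inE => /eqP ->; left; rewrite e; right.
  by rewrite big_seq1 mulr1z subrr; apply: sub0.
split; first by move=> y [/CD|->].
move=> s z us sC.
have sC' e : e \in s -> e != x -> (C `|` B) e.
  by move=> /sC[[Ce|->]|Be]; rewrite ?eqxx // => _; [left|right].
have [xs|xs] := boolP (x \in s); last first.
  move=> hs; apply: indC => // e es; apply: sC' => //.
  by apply: contraNneq xs => <-.
rewrite (perm_big _ (perm_to_rem xs)) big_cons.
set s' := rem x s; have us' : uniq s' by rewrite rem_uniq.
have s'C e : e \in s' -> (C `|` B) e.
  by rewrite /s' mem_rem_uniq // inE => /andP[ex es]; apply: sC'.
set S := \sum_(_ <- _) _.
have [lz|lz] := boolP (l %| z x)%Z.
  move=> h e es; have [->//|ex] := eqVneq e x.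
  apply: (indC s' z us' s'C); last by rewrite /s' mem_rem_uniq // inE ex.
  rewrite (_ : \sum_(_ <- _) _ = x *~ z x + S - x *~ z x); last by rewrite -/S; zmod.
  apply: subB => //; have /dvdzP[m ->] := lz.
  by rewrite mulrzA -pmulrn; apply: sub_mul; apply: DMz.
have [m [m' hm]] := bezout_prime pl lz.
move=> h; case: nsp; exists s', (fun e => - (m * z e)); split=> //.
have -> : x - \sum_(e <- s') e *~ - (m * z e) =
  (x *~ z x + S) *~ m + (x *~ m') *+ l.
  rewrite mulrzDl -!mulrzA pmulrn -mulrzA addrAC -mulrzDr.
  rewrite [z x * m]mulrC hm mulr1z; congr (_ + _).
  rewrite -sumrN /S (big_morph ( *~%R^~ m) (mulrzDl m) (mul0rz _ m)).
  apply: eq_bigr => e _.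
  by rewrite mulrNz opprK -mulrzA mulrC.
by apply: sub_add; [apply: subMz|apply: sub_mul; apply: DMz].
Qed.

End Bases.

(** * Domination implies the inequalities *)

Local Notation vals A := (fun a : A => val a).
Local Notation over f A := (fun a : A => f (val a)).

Section CompleteTypes.
Variables (M : oagType) (I W : Type) (e : W -> M) (p : ftype I W).
Hypothesis cp : complete_type e p.

Lemma ctype_closed n (phi : 'I_n -> formula (I + W)) theta :
  (forall k, p (phi k)) ->
  (forall c, (forall k, holds (sjoin c e) (phi k)) -> holds (sjoin c e) theta) ->
  p theta.
Proof.
move=> hphi h; case: (cp.2 theta) => // nt; exfalso.
have [|c hc] := cp.1 n.+1
  (fun k => if unlift ord0 k is Some j then phi j else FNot theta).
  by move=> k; case: unliftP => [j _|_].
have := hc ord0; rewrite unlift_none /=; apply; apply: h => k.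
by have := hc (lift ord0 k); rewrite liftK.
Qed.

Lemma ctype_conj n (phi : 'I_n -> formula (I + W)) : (forall k, p (phi k)) ->
  exists2 psi, p psi & forall (X : oagType) (v : I + W -> X),
    holds v psi <-> forall k, holds v (phi k).
Proof.
move=> hphi; have [s hs] := all_conj phi.
have hc (X : oagType) (v : I + W -> X) :
    holds v (FConj s) <-> forall k, holds v (phi k).
  rewrite holds_conj; split=> [h k|h a /hs[k ->] //].
  by apply: h; apply/hs; exists k.
exists (FConj s) => //; apply: ctype_closed hphi _ => c h; exact/hc.
Qed.

End CompleteTypes.

(** * Compactness for the entailment of q by p and r *)

Section Extension.
Variables (U : oagType) (I J : Type) (p : ftype I U) (q : ftype J U).
Variables (A : set U) (r : ftype (I + J) A).
Hypotheses (gp : global_type p) (gq : global_type q).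
Hypothesis cr : complete_type (vals A) r.
Hypothesis pr : forall phi, restr A p phi ->
  r (frename (sjoin (fun i => inl (inl i)) inr) phi).

Let lp (psi : formula (I + U)) : formula ((I + J) + U) :=
  frename (sjoin (fun i => inl (inl i)) inr) psi.
Let lq (theta : formula (J + U)) : formula ((I + J) + U) :=
  frename (sjoin (fun j => inl (inr j)) inr) theta.
Let lr (phi : formula ((I + J) + A)) : formula ((I + J) + U) :=
  frename (sjoin inl (fun a => inr (val a))) phi.

Let hlp (X : oagType) (c : I + J -> X) (e : U -> X) psi :
  holds (sjoin c e) (lp psi) <-> holds (sjoin (c \o inl) e) psi.
Proof.
rewrite holds_rename.
by have -> : sjoin c e \o sjoin (fun i => inl (inl i)) inr = sjoin (c \o inl) e
  by apply: funext; case.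
Qed.

Let hlq (X : oagType) (c : I + J -> X) (e : U -> X) psi :
  holds (sjoin c e) (lq psi) <-> holds (sjoin (c \o inr) e) psi.
Proof.
rewrite holds_rename.
by have -> : sjoin c e \o sjoin (fun i => inl (inr i)) inr = sjoin (c \o inr) e
  by apply: funext; case.
Qed.

Let hlr (X : oagType) (c : I + J -> X) (e : U -> X) psi :
  holds (sjoin c e) (lr psi) <-> holds (sjoin c (fun a : A => e (val a))) psi.
Proof.
rewrite holds_rename.
by have -> : sjoin c e \o sjoin inl (fun a : A => inr (val a)) =
  sjoin c (fun a : A => e (val a)) by apply: funext; case.
Qed.

Let sj (T : Type) (c : I + J -> T) : c = sjoin (c \o inl) (c \o inr).
Proof. by apply: funext; case. Qed.

Lemma joint_realization (eta : formula ((I + J) + U)) :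
  (forall psi phi, p psi -> r phi -> exists c : I + J -> U,
     [/\ holds (sjoin c id) (lp psi), holds (sjoin c id) (lr phi) &
         holds (sjoin c id) eta]) ->
  exists (X : elemext U) (b : I -> X) (c : J -> X),
  [/\ realizes (@emb U X) b p,
     realizes (over (@emb U X) A) (sjoin b c) r &
     holds (sjoin (sjoin b c) (@emb U X)) eta].
Proof.
move=> hsat.
pose S : set (formula ((I + J) + U)) := [set phi | exists psi chi,
  [/\ p psi, r chi & phi = FAnd (lp psi) (FAnd (lr chi) eta)]].
have p1 : p (FEq TZero TZero).
  by apply: (ctype_closed gp (n := 0) (phi := fun=> FEq TZero TZero)) => // -[].
have r1 : r (FEq TZero TZero).
  by apply: (ctype_closed cr (n := 0) (phi := fun=> FEq TZero TZero)) => // -[].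
have [n phi hphi|X [bc rbc]] := @compactness U _ S; last first.
  exists X, (bc \o inl), (bc \o inr); rewrite -sj; split=> [psi hpsi|psi hpsi|].
  - have [|+ _] := rbc (FAnd (lp psi) (FAnd (lr (FEq TZero TZero)) eta)).
      by exists psi, (FEq TZero TZero).
    by rewrite -[X in X -> _]/(holds _ (lp psi)) hlp.
  - have [|_ [+ _]] := rbc (FAnd (lp (FEq TZero TZero)) (FAnd (lr psi) eta)).
      by exists (FEq TZero TZero), psi.
    by rewrite -[X in X -> _]/(holds _ (lr psi)) hlr.
  have [|_ [_ //]] := rbc (FAnd (lp (FEq TZero TZero)) (FAnd (lr (FEq TZero TZero)) eta)).
  by exists (FEq TZero TZero), (FEq TZero TZero).
have /choice[f hf] k : exists a : formula (I + U) * formula ((I + J) + A),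
    [/\ p a.1, r a.2 & phi k = FAnd (lp a.1) (FAnd (lr a.2) eta)].
  by have [psi [chi]] := hphi k; exists (psi, chi).
have [Psi pPsi hPsi] := ctype_conj gp (phi := fun k => (f k).1)
  (fun k => let: And3 h _ _ := hf k in h).
have [Phi rPhi hPhi] := ctype_conj cr (phi := fun k => (f k).2)
  (fun k => let: And3 _ h _ := hf k in h).
have [c [/hlp/hPsi h1 /hlr/hPhi h2 h3]] := hsat _ _ pPsi rPhi.
exists c => k; have [_ _ ->] := hf k; split; first by rewrite hlp; apply: h1.
by split=> //; rewrite hlr; apply: h2.
Qed.

(** The projection of [phi] to the variables of [p] is a formula over [A]. It lies in [p], since
    otherwise its negation would lie in [r] beside [phi]. *)
Lemma joint_sat psi phi : p psi -> r phi -> exists c : I + J -> U,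
  holds (sjoin c id) (lp psi) /\ holds (sjoin c id) (lr phi).
Proof.
move=> ppsi rphi.
pose s (k : (I + J) + A) : J + (I + A) := match k with
  | inl (inl i) => inr (inl i) | inl (inr j) => inl j | inr a => inr (inr a) end.
have [chi hchi] := exists_closure (frename s phi).
have hs (X : oagType) (b : I -> X) (d : J -> X) (e : A -> X) :
   sjoin d (sjoin b e) \o s = sjoin (sjoin b d) e by apply: funext => -[[]|].
have pchi : p (inst (vals A) chi).
  case: (gp.2 (inst (vals A) chi)) => // nchi; exfalso.
  have /pr r2 : restr A p (FNot chi) by [].
  have [c hc] := cr.1 2 (fun k => if k == ord0 then phi else
    frename (sjoin (fun i => inl (inl i)) inr) (FNot chi))
    (fun k => if k == ord0 as b return r (if b then _ else _) then rphi else r2).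
  have h0 := hc ord0; have := hc ord_max; rewrite /= holds_rename; apply.
  have -> : sjoin c (vals A) \o sjoin (fun i => inl (inl i)) inr =
     sjoin (c \o inl) (vals A) by apply: funext; case.
  by apply/hchi; exists (c \o inr); rewrite holds_rename hs -sj.
have [a ha] := gp.1 2 (fun k => if k == ord0 then psi else
    inst (vals A) chi)
    (fun k => if k == ord0 as b return p (if b then _ else _) then ppsi else pchi).
have /= h0 := ha ord0; have := ha ord_max; rewrite /= /inst holds_rename.
have -> : sjoin a id \o sjoin inl (fun w : A => inr (val w)) =
  sjoin a (fun w : A => val w) by apply: funext; case.
move=> /hchi[b]; rewrite holds_rename hs => hb.
exists (sjoin a b); rewrite hlp hlr; split=> //.
Qed.

Hypothesis ent : entails p r q.

(** If every formula of [r] had a counterexample over [b], their existential closures would descend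
    from [X] to [U], and compactness would refute [entails]. *)
Lemma entails_syntactic (X : elemext U) (b : I -> X) theta :
  realizes (@emb U X) b p -> q theta -> exists2 phi, r phi &
  forall c : J -> X,
    holds (sjoin (sjoin b c) (over (@emb U X) A)) phi ->
    holds (sjoin c (@emb U X)) theta.
Proof.
move=> rb qt; apply: contrapT => no.
have [|Y [b' [c' [rb' rbc']]]] := joint_realization (eta := FNot (lq theta)).
  move=> psi phi ppsi rphi; apply: contrapT => no'; apply: no; exists phi => // c hc.
  apply: contrapT => nt; apply: no'.
  have [chi hchi] := exists_closure (FAnd (lp psi) (FAnd (lr phi) (FNot (lq theta)))).
  have : holds (@emb U X) chi.
    apply/hchi; exists (sjoin b c); split; first by rewrite hlp; apply: rb.
    by split; [rewrite hlr|rewrite /= hlq].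
  by rewrite -(emb_elem X chi) => /hchi[d [h1 [h2 h3]]]; exists d.
by rewrite /= hlq; apply; apply: ent rb' rbc' _ qt.
Qed.

End Extension.

Lemma params_list V W (t : term (V + W)) (d : W) : exists (l : seq W) (t' : term (V + nat)),
  t = trename (sjoin inl (fun n => inr (nth d l n))) t'.
Proof.
have [s hs] := tocc_fin t.
pose l := pmap (fun k => if k is inr w then Some w else None) s.
have hl w : tocc (inr w) t -> exists n, nth d l n = w.
  move=> /hs; rewrite /l; elim: s {hs l} => //= k s ih [->|/ih[n <-]] /=.
    by exists 0%N.
  by case: k => [v|w'] /=; [exists n|exists n.+1].
have [|t' ht'] := @term_lift _ _ (sjoin inl (fun n => inr (nth d l n))) t.
  by move=> [v|w] h; [exists (inl v)|have [n <-] := hl w h; exists (inr n)].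
by exists l, t'.
Qed.

Section Forward.
Variables (G : oagType) (regG : regular G) (K : Type) (slK : strong_limit K).
Variables (U : oagType) (GU : elem_equiv G U) (satU : saturated K U).
Variables (I J : Type) (p : ftype I U) (q : ftype J U).
Hypotheses (sI : small K [set: I]).
Hypotheses (gp : global_type p) (gq : global_type q).
Variables (A : set U) (sA : small K A) (r : ftype (I + J) A).
Hypothesis cr : complete_type (vals A) r.
Hypothesis pr : forall phi, restr A p phi ->
  r (frename (sjoin (fun i => inl (inl i)) inr) phi).
Hypothesis ent : entails p r q.
Variables (X : elemext U) (b : I -> X) (c : J -> X).
Hypotheses (rb : realizes (@emb U X) b p)
  (rbc : realizes (over (@emb U X) A) (sjoin b c) r).
Local Notation emb := (@emb U X).
Let GX := emb_equiv X GU.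

Lemma forward_realizes : realizes emb c q. Proof. exact: ent rb rbc. Qed.
Let rc := forward_realizes.

(** [chi] defines a set that contains t(c)/n and consists of values t(y)/n at tuples satisfying
    [theta]. The tuple [v] collects b, [A] and the finitely many parameters of t; it is small and
    independent of [theta], as the saturation arguments below require. *)
Lemma type_projection (t : term (J + U)) n :
  exists v : (I + A) + nat -> X, [/\
    forall a, exists a', teval v a = teval (sjoin b emb) a' &
    forall theta, q theta -> exists chi : formula (option ((I + A) + nat)),
      forall z : X,
      (z *+ n = teval (sjoin c emb) t -> holds (ocons z v) chi) /\
      (holds (ocons z v) chi -> exists y : J -> X,
         z *+ n = teval (sjoin y emb) t /\ holds (sjoin y emb) theta)].
Proof.
have [l [t' et]] := params_list t 0.
pose v (k : (I + A) + nat) : X := sjoin (sjoin b (over emb A))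
   (fun n => emb (nth 0 l n)) k.
exists v; split=> [a|theta qt].
  exists (trename (fun k => match k with inl (inl i) => inl i
    | inl (inr a) => inr (val a) | inr n => inr (nth 0 l n) end) a).
  by rewrite teval_rename; congr teval; apply: funext => -[[]|].
have [phi rphi hphi] := entails_syntactic gp cr ent rb qt.
pose s1 (k : (I + J) + A) : J + option ((I + A) + nat) := match k with
  | inl (inl i) => inr (Some (inl (inl i))) | inl (inr j) => inl j
  | inr a => inr (Some (inl (inr a))) end.
pose s2 (k : J + nat) : J + option ((I + A) + nat) :=
  sjoin inl (fun n => inr (Some (inr n))) k.
have [chi hchi] := exists_closure (FAnd (frename s1 phi)
   (FEq (TMuln (TVar (inr None)) n) (trename s2 t'))).
have h1 z y : holds (sjoin y (ocons z v)) (frename s1 phi) <->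
    holds (sjoin (sjoin b y) (over emb A)) phi.
  rewrite holds_rename.
  by have -> : sjoin y (ocons z v) \o s1 =
    sjoin (sjoin b y) (over emb A) by apply: funext => -[[]|].
have h2 z y : teval (sjoin y (ocons z v)) (trename s2 t') =
    teval (sjoin y emb) t.
  rewrite et !teval_rename.
  by congr teval; apply: funext => -[].
exists chi => z; split=> [hz|/hchi[y [/h1/hphi hy]]].
  apply/hchi; exists c; split; first by apply/h1; apply: rbc.
  by rewrite /= h2 teval_muln.
by rewrite /= h2 teval_muln => e; exists y.
Qed.

Lemma forward_H : Hset q `<=` Hset p.
Proof.
move=> H /(HsetP _ gq rc)[cH [t ft]]; apply/(HsetP _ gp rb); split=> //.
apply: contrapT => /forallNP no.
set x := teval _ t in ft.
have [v [hv hchi]] := type_projection t 1.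
have nov n a : (0 < n)%N -> ~ fills H (teval v a *+ n).
  by move=> n0; have [a' ->] := hv a; rewrite -teval_muln; apply: no.
have nx : ~ phull v x.
  move=> [n [a [n0 ha]]]; apply: (nov 1%N a) => //; rewrite mulr1n -ha.
  exact: (fills_mul regG GU cH n0 ft).
have xchi theta : q theta -> exists2 chi, holds (ocons x v) chi &
    forall z, holds (ocons z v) chi -> exists2 y : J -> X,
      z = teval (sjoin y emb) t & holds (sjoin y emb) theta.
  move=> /hchi[chi h]; exists chi; first by apply: (h x).1.
  by move=> z /(h z).2[y [e hy]]; exists y.
(* Otherwise [h] and x have the same cut over [v], and perturbing at [h] gives a value of t below
   [h], against h < t in [q]. *)
have low h : H h -> exists n a, [/\ (0 < n)%N, emb h *+ n <= teval v a &
    teval v a < x *+ n].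
  move=> Hh; apply: contrapT => nf.
  have hx : emb h < x by apply: ft.1.
  have cut : same_cut v (emb h) x.
    apply: gap_same_cut; first exact: ltW.
    move=> n a n0 h1; rewrite le_eqVlt => /orP[/eqP e|h2].
      by apply: nx; exists n, a.
    by apply: nf; exists n, a.
  have qt : q (FLt (TVar (inr h)) t) by apply/(realizes_iff gq rc).
  have [chi chix hchi'] := xchi _ qt.
  have [N [N0 hN]] := perturb regG GX chix (same_cutC cut).
  have [|_ [e [e0 _ /hchi'[y ey]]]] := hN N x N0 (dvdnn N); first by [].
  move=> /= h1; have {}h1 : emb h < emb h - e by rewrite ey; exact: h1.
  by apply: (@oltF _ (0 : X)); apply: (olt2 h1 (ltW e0)); zmod.
have high u : above H u -> exists n a, [/\ (0 < n)%N, x *+ n < teval v a &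
    teval v a <= emb u *+ n].
  move=> au; apply: contrapT => nf.
  have hx : x < emb u by apply: ft.2.
  have cut : same_cut v x (emb u).
    apply: gap_same_cut; first exact: ltW.
    move=> n a n0; rewrite le_eqVlt => /orP[/eqP e|h1] h2.
      by apply: nx; exists n, a.
    by apply: nf; exists n, a.
  have qt : q (FLt t (TVar (inr u))) by apply/(realizes_iff gq rc).
  have [chi chix hchi'] := xchi _ qt.
  have [N [N0 hN]] := perturb regG GX chix cut.
  have [|[e [e0 _ /hchi'[y ey /= h1]]] _] := hN N x N0 (dvdnn N); first by [].
  have {}h1 : emb u + e < emb u by rewrite ey; exact: h1.
  by apply: (@oltF _ (0 : X)); apply: (olt2 h1 (ltW e0)); zmod.
(* Numerators of fractions below x are rounded up into [H], and below those of fractions above x are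
   rounded down to elements above [H]. This is possible since no element generated by b fills
   [H]. *)
have /choice[lo hlo] (k : nat * term ((I + A) + nat)) : exists h,
    H h /\ ((0 < k.1)%N -> teval v k.2 < x *+ k.1 -> teval v k.2 <= emb h).
  have [[k0 hk]|nk] := pselect ((0 < k.1)%N /\ teval v k.2 < x *+ k.1); last first.
    by exists 0; split=> [|h1 h2]; [case: (cH) => -[]|case: nk].
  apply: contrapT => nh; apply: (nov 1%N k.2) => //; rewrite mulr1n; split.
    move=> h Hh; rewrite oltNge; apply/negP => h'; apply: nh.
    by exists h; split.
  move=> u au; apply: lt_trans hk _.
  exact: (fills_mul regG GU cH k0 ft).2 _ au.
have /choice[hi hhi] (k : nat * term ((I + A) + nat)) : exists u,
    (0 < k.1)%N -> x *+ k.1 < teval v k.2 ->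
    above H u /\ emb u *+ k.1 <= teval v k.2.
  have [[k0 hk]|nk] := pselect ((0 < k.1)%N /\ x *+ k.1 < teval v k.2); last first.
    by exists 0 => h1 h2; case: nk.
  suff [u au hu] : exists2 u, above H u & emb u <= teval v k.2.
    have [u' au' hu'] := above_div regG GU cH ft au k0.
    exists u' => _ _; split=> //; apply: le_trans hu.
    by rewrite -embMn emb_le.
  apply: contrapT => nu; apply: (nov 1%N k.2) => //; rewrite mulr1n; split.
    move=> h Hh; apply: lt_trans hk.
    exact: (fills_mul regG GU cH k0 ft).1 _ Hh.
  move=> u au; rewrite oltNge; apply/negP => h'; apply: nu.
  by exists u.
pose e' k := sjoin lo hi k.
have sW : small K [set: (nat * term ((I + A) + nat)) + (nat * term ((I + A) + nat))].
  have sv : small K [set: nat * term ((I + A) + nat)].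
    apply: (small_prod slK (small_nat slK)); apply: (small_term slK).
    apply: (small_sum slK) (small_nat slK).
    exact: (small_sum slK sI (small_type sA)).
  exact: (small_sum slK).
have ee : elem_eq (fun k => emb (e' k)) e' by apply: elem_eq_sym; apply: emb_elem'.
(* Over the rounded bounds, [y] in U looks like x. By [low] it is above [H], and by [high] some
   upper bound is then at most [y], a contradiction. *)
have [y hy] := extend1 satU x sW ee.
have loy k : lo k < y.
  have /= h := hy (FLt (TVar (Some (inl k))) (TVar None)).
  by apply h; apply: ft.1; case: (hlo k).
have hiy k : x < emb (hi k) -> y < hi k.
  have /= h := hy (FLt (TVar None) (TVar (Some (inr k)))).
  by apply h.
have ay : above H y.
  move=> h Hh; have [h0 [hh0 h00 Hh0]] : exists h0, [/\ h <= h0, 0 <= h0 & H h0].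
    have [hp|hn] := oltP 0 h; first by exists h; rewrite (ltW hp).
    by exists 0; split=> //; case: (cH) => -[].
  have [n [a [n0 h1 h2]]] := low h0 Hh0.
  have [_ /(_ n0 h2) h3] := hlo (n, a).
  apply: le_lt_trans hh0 (le_lt_trans _ (loy (n, a))).
  rewrite -(emb_le X); apply: le_trans (le_trans h1 h3).
  by apply: ole_mulnr => //; rewrite -(emb0 X) emb_le.
have [n [a [n0 h1 h2]]] := high y ay.
have [ahi h3] := hhi (n, a) n0 h1.
have : y < hi (n, a) by apply: hiy; apply: ft.2.
rewrite oltNge => /negP; apply; rewrite -(emb_le X) -(oleMn _ _ n0).
exact: le_trans h3 h2.
Qed.

(** Modulo powers of ℓ, an element x outside D + ℓX is independent of the pure subgroup D: if ℓ does
    not divide k, Bézout puts x into the class of an element of D; otherwise z is divisible by ℓ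
    too, and one divides. The right-hand side does not mention x, so any two such elements behave
    alike. *)
Lemma coset_pow (D : set X) l x z s :
  prime l -> (forall y y', D y -> D y' -> D (y - y')) ->
  (forall y n, (0 < n)%N -> D (y *+ n) -> D y) ->
  (forall y, D y -> ~ dvdby l (x - y)) -> D z ->
  forall k : int, dvdby (l ^ s) (x *~ k + z) <->
    ((l ^ s)%N %| k)%Z /\ dvdby (l ^ s) z.
Proof.
move=> pl DB Dp nx Dz k; split; last first.
  move=> [/dvdzP[m ->] hz]; apply: dvdbyD => //.
  by rewrite mulrzA -pmulrn; apply: dvdby_mul.
have l0 := prime_gt0 pl.
have D0 : D 0 by rewrite -(subrr z); apply: DB.
have DN y : D y -> D (- y) by move=> h; rewrite -sub0r; apply: DB.
have DD y y' : D y -> D y' -> D (y + y').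
  by move=> h /DN h'; rewrite -[y']opprK; apply: DB.
have DMn y n : D y -> D (y *+ n).
  by move=> h; elim: n => [|n ih]; rewrite ?mulr0n ?mulrS //; apply: DD.
have DMz y m : D y -> D (y *~ m).
  by case: m => n h; rewrite ?NegzE ?mulrNz -pmulrn; [|apply: DN]; apply: DMn.
elim: s z Dz k => [|s ih] z Dz k h.
  by rewrite expn0 dvd1z; split=> //; apply: dvdby1.
have [lk|lk] := boolP (l %| k)%Z; last first.
  have [m [m' hm]] := bezout_prime pl lk.
  case: (nx (- (z *~ m))); first by apply: DN; apply: DMz.
  have -> : x - - (z *~ m) = (x *~ k + z) *~ m + x *~ m' *+ l.
    rewrite opprK mulrzDl -mulrzA pmulrn -mulrzA [k * m]mulrC addrAC -mulrzDr hm.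
    by rewrite mulr1z.
  apply: dvdbyD; last exact: dvdby_mul.
  by apply: dvdbyMz; apply: dvdbyW h; rewrite expnS dvdn_mulr.
have /dvdzP[k' ek] := lk.
have [w hw] : dvdby l z.
  have [w hw] := h; exists (w *+ (l ^ s) - x *~ k').
  rewrite mulrnBl -mulrnA -expnSr -hw ek mulrzA -pmulrn; zmod.
have Dw : D w by apply: (Dp _ _ l0); rewrite -hw.
have {}h : dvdby (l ^ s) (x *~ k' + w).
  apply/(dvdbyM _ _ l0); rewrite -expnSr mulrnDl -hw.
  by rewrite pmulrn -mulrzA -ek.
have [/dvdzP[m em] [w' hw']] := ih _ Dw _ h.
split; last by exists w'; rewrite hw hw' -mulrnA expnSr.
by rewrite ek em; apply/dvdzP; exists m; rewrite expnSr PoszM mulrA.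
Qed.

Lemma forward_coset l (pl : prime l) e : phull (sjoin c emb) e ->
  exists f u, phull (sjoin b emb) f /\ dvdby l (e - f - emb u).
Proof.
move=> [n [t [n0 et]]]; apply: contrapT => no.
have l0 := prime_gt0 pl.
have {}no f u : phull (sjoin b emb) f -> ~ dvdby l (e - f - emb u).
  by move=> hf hd; apply: no; exists f, u.
have [v [hv hchi]] := type_projection t n.
have hvb y : phull v y -> phull (sjoin b emb) y.
  by move=> [m [a [m0 ha]]]; have [a' ea] := hv a; exists m, a'; rewrite ha ea.
have noe u : ~ dvdby l (e - emb u).
  by have := no 0 u (phull0 _); rewrite subr0.
have nev y : phull v y -> ~ dvdby l (e - y).
  by move=> /hvb hy; have := no y 0 hy; rewrite emb0 subr0.
(* For each fraction congruent modulo ℓ to some element of U, one such element is fixed. An element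
   of U that looks like e over these is then congruent to no fraction modulo ℓ. *)
have /choice[w hw] (k : nat * term ((I + A) + nat)) : exists u, forall y,
    (0 < k.1)%N -> y *+ k.1 = teval v k.2 -> forall u', dvdby l (y - emb u') ->
    dvdby l (y - emb u).
  have [[y [u [k0 hy hu]]]|nk] := pselect (exists y u, [/\ (0 < k.1)%N,
      y *+ k.1 = teval v k.2 & dvdby l (y - emb u)]).
    exists u => y' _; rewrite -hy => /(omuln_inj k0) -> u' _; exact: hu.
  by exists 0 => y k0 hy u' hu'; case: nk; exists y, u'.
have sW : small K [set: nat * term ((I + A) + nat)].
  apply: (small_prod slK (small_nat slK)); apply: (small_term slK).
  apply: (small_sum slK) (small_nat slK).
  exact: (small_sum slK sI (small_type sA)).
have ee : elem_eq (fun k => emb (w k)) w by apply: elem_eq_sym; apply: emb_elem'.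
have [u hu] := extend1 satU e sW ee.
have nu y : phull v y -> ~ dvdby l (emb u - y).
  move=> [m [a [m0 ha]]] hd; apply: (noe (w (m, a))).
  have h := hu (FCong l (TVar None) (TVar (Some (m, a)))).
  suff : dvdby l (u - w (m, a)) by case: h => /= _; apply.
  apply/(emb_dvdby X); rewrite embD embN.
  rewrite (_ : _ - _ = (emb u - y) + (y - emb (w (m, a)))); last by zmod.
  apply: dvdbyD => //; apply: (hw (m, a) y m0 ha u).
  by rewrite -opprB; apply: dvdbyN.
(* With the denominator of e = t(c)/n cleared, this says that e and u are not congruent modulo ℓ. *)
have qt : q (FNot (FCong (n * l) t (TMuln (TVar (inr u)) n))).
  apply/(realizes_iff gq rc) => /= -[z].
  rewrite teval_muln /= -et -mulrnBl mulnC mulrnA => /(omuln_inj n0) hz.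
  by apply: (noe u); exists z.
have [chi hchi'] := hchi _ qt.
have chie : holds (ocons e v) chi by apply: (hchi' e).1.
have ne : ~ phull v e by move=> /nev; rewrite subrr; apply; apply: dvdby0.
have [N [N0 hN]] := perturb regG GX chie (not_phull_same_cut ne).
have [n' cn' eN] := pfactor_coprime pl N0.
(* The extra factor makes a congruence modulo [P] one modulo ℓ, even if ℓ does not divide N. *)
set s0 := logn l N in eN; pose P := (l * N)%N.
have P0 : (0 < P)%N by rewrite muln_gt0 l0.
have cop : coprime n' (l ^ s0.+1) by rewrite coprime_sym coprimeXl.
have [al [al1 al2]] : exists al : int, (n'%:Z %| al)%Z /\ ((l ^ s0.+1)%:Z %| 1 - al)%Z.
  have [x [y h]] := bezout_coprime cop; exists (x * n'%:Z).
  by rewrite -[in 1 - _]h addrC addKr !dvdz_mull.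
(* By the Chinese remainder theorem, [g] has the residue of u modulo ℓ^(s0 + 1) and that of e modulo
   the part of N prime to ℓ. *)
pose g := e + (emb u - e) *~ al.
have gu : dvdby (l ^ s0.+1) (g - emb u).
  rewrite (_ : _ - _ = - ((emb u - e) *~ (1 - al))); last first.
    by rewrite mulrzBr mulr1z /g; zmod.
  apply: dvdbyN; have /dvdzP[m ->] := al2.
  by rewrite mulrzA -pmulrn; apply: dvdby_mul.
have ge : dvdby n' (g - e).
  rewrite (_ : _ - _ = (emb u - e) *~ al); last by rewrite /g; zmod.
  have /dvdzP[m ->] := al1.
  by rewrite mulrzA -pmulrn; apply: dvdby_mul.
have tdiff d x y (tt : term (option ((I + A) + nat))) : dvdby d (x - y) ->
    dvdby d (teval (ocons x v) tt) <-> dvdby d (teval (ocons y v) tt).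
  move=> h; apply: dvdby_congr; rewrite !teval_coef.
  rewrite (_ : _ - _ = (x - y) *~ tcoef tt); last by rewrite mulrzBl; zmod.
  exact: dvdbyMz.
have hcong tt : dvdby N (teval (ocons e v) tt) <-> dvdby N (teval (ocons g v) tt).
  have split_ x : dvdby N x <-> dvdby n' x /\ dvdby (l ^ s0) x.
    rewrite eN; split=> [h|[h h']].
      by split; apply: dvdbyW h; [rewrite dvdn_mulr|rewrite dvdn_mull].
    apply: dvdby_coprime => //.
    by apply: coprime_dvdr cop; rewrite expnS dvdn_mull.
  have gu' : dvdby (l ^ s0) (g - emb u).
    by apply: dvdbyW gu; rewrite expnS dvdn_mull.
  rewrite !split_ (tdiff _ _ _ tt ge) (tdiff _ _ _ tt gu') !teval_coef.
  have ht : phull v (teval v (trest tt)) by apply: phull_teval.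
  have hp y k : (0 < k)%N -> phull v (y *+ k) -> phull v y by apply: phull_pure.
  have hB y y' : phull v y -> phull v y' -> phull v (y - y') by apply: phullB.
  rewrite (coset_pow s0 pl hB (fun y k k0 => @hp y k k0) nev ht).
  by rewrite (coset_pow s0 pl hB (fun y k k0 => @hp y k k0) nu ht).
have [[e' [_ he' /(hchi' _).2[y [ey /= hy]]]] _] := hN P g P0 (dvdn_mull _ (dvdnn N)) hcong.
apply: hy; rewrite teval_muln /=.
rewrite (_ : teval _ _ = (e + e') *+ n) // -mulrnBl.
suff : dvdby (n * l) ((e + e' - emb u) *+ n) by [].
rewrite mulnC; apply/(dvdbyM _ _ n0).
rewrite (_ : _ - _ = (e + e' - g) + (g - emb u)); last by zmod.
apply: dvdbyD; first by apply: dvdbyW he'; rewrite dvdn_mulr.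
by apply: dvdbyW gu; rewrite expnS dvdn_mulr.
Qed.

(** [forward_coset] replaces each basis element for q by one of dcl(U b) in the same class modulo ℓ
    and U. Independence survives, so the images are distinct and extend to a basis for p. *)
Lemma forward_kappa l : prime l -> kappa_le l q p.
Proof.
move=> pl; pose rq := Realization rc; pose rp := Realization rb.
have ind0 : kindep l (set0 : set rq) by move=> s z _ h _ e /h.
have [B [_ bB]] := basis_ext regG GU pl (sub0set _) ind0.
have BD : B `<=` dcl (base rq) by case: bB.
have [indB _] := (kbasisP regG GU pl BD).1 bB.
have /choice[f hf] (e : X) : exists f, B e ->
    dcl (base rp) f /\ exists u, dvdby l (e - f - emb u).
  have [Be|nBe] := pselect (B e); last by exists 0.
  have /(dcl_base regG GU) := BD _ Be; move=> /(forward_coset pl)[f [u [hf hu]]].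
  exists f => _; split; last by exists u.
  by apply/(dcl_base regG GU).
have sumf (s : seq X) (z : X -> int) : (forall e, e \in s -> B e) ->
    exists u, dvdby l (\sum_(e <- s) e *~ z e - \sum_(e <- s) f e *~ z e - emb u).
  elim: s => [|e s ih] sB.
    by exists 0; rewrite !big_nil emb0 !subr0; apply: dvdby0.
  have [u hu] := ih (fun x xs => sB x (mem_behead (s := e :: s) xs)).
  have [_ [u' hu']] := hf e (sB e (mem_head _ _)).
  exists (u + u' *~ z e); rewrite !big_cons embD embMz.
  set S := \sum_(_ <- _) _ in hu *; set S' := \sum_(_ <- _) _ in hu *.
  rewrite (_ : _ - _ = (S - S' - emb u) + (e - f e - emb u') *~ z e); last first.
    by rewrite !mulrzBl; zmod.
  by apply: dvdbyD => //; apply: dvdbyMz.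
have injf : {in B &, injective f}.
  move=> e e'; rewrite !inE => Be Be' ee; apply: contrapT => /eqP ne.
  pose s := [:: e; e'].
  have us : uniq s by rewrite /= inE ne.
  have sB x : x \in s -> B x by rewrite !inE => /orP[/eqP ->|/eqP ->].
  pose z x : int := if x == e then 1 else -1.
  have [De [u hu]] := hf e Be; have [De' [u' hu']] := hf e' Be'.
  have hs : kappa_sub l rq (\sum_(x <- s) x *~ z x).
    rewrite big_cons big_seq1 /z eqxx eq_sym (negbTE ne) mulr1z mulrNz mulr1z.
    apply/(subP regG GU pl); first by apply: (DB regG GU); apply: BD.
    exists (u - u'); rewrite embD embN /=.
    rewrite (_ : _ - _ = (e - f e - emb u) - (e' - f e' - emb u')).
      exact: dvdbyB.
    by rewrite ee; zmod.
  have := indB s z us sB hs e (mem_head _ _).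
  rewrite /z eqxx dvdzE /= dvdn1 => /eqP l1; by rewrite l1 in pl.
have C0D : f @` B `<=` dcl (base rp) by move=> _ [e Be <-]; case: (hf e Be).
have indC0 : kindep l (f @` B : set rp).
  move=> s z us sC hs x xs.
  have /choice[g hg] (y : X) : exists e, (f @` B) y -> B e /\ f e = y.
    by have [[e Be <-]|ny] := pselect ((f @` B) y); [exists e|exists 0].
  have fg y : y \in s -> f (g y) = y by move=> /sC/hg[].
  have us' : uniq (map g s).
    by rewrite map_inj_in_uniq // => y y' ys ys' e; rewrite -(fg y) // e fg.
  have sB e : e \in map g s -> B e by move=> /mapP[y /sC/hg[? _] ->].
  have [u hu] := sumf (map g s) (fun e => z (f e)) sB.
  have e1 : \sum_(e <- map g s) f e *~ z (f e) = \sum_(y <- s) y *~ z y.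
    by rewrite big_map; apply: eq_big_seq => y ys; rewrite fg.
  have Ds : dcl (base rp) (\sum_(y <- s) y *~ z y).
    by apply: (D_sum regG GU) => y /sC/C0D.
  have [u2 hu2] := (subP regG GU pl Ds).1 hs.
  rewrite -(fg x xs).
  apply: (indB (map g s) (fun e => z (f e)) us' sB _ (g x) (map_f g xs)).
  apply/(subP regG GU pl); first by apply: (D_sum regG GU) => e /sB/BD.
  exists (u + u2); rewrite embD; rewrite e1 in hu.
  set S := \sum_(_ <- _) _ in hu *; set S' := \sum_(_ <- _) _ in hu hu2.
  rewrite (_ : _ - _ = (S - S' - emb u) + (S' - emb u2)); last by zmod.
  exact: dvdbyD.
have [C [CC bC]] := basis_ext regG GU pl C0D indC0.
exists rq, B, rp, C; split=> //; apply/card_le_injE.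
exists (fun e => exist (fun x => x \in C) (f (val e)) (mem_set (CC _ (imageP f (set_mem (valP e)))))).
by move=> e e' [] /injf h; apply: val_inj; apply: h; apply: valP.
Qed.

End Forward.

(** * Cuts of invariant types *)

Section Shape.
Variables (K : Type) (slK : strong_limit K) (U : oagType) (satU : saturated K U).
Variables (X : elemext U) (x : X) (nx : forall u, x <> @emb U X u).
Variables (L0 : set U) (sL0 : small K L0).
Local Notation emb := (@emb U X).
Hypothesis cof : forall u, emb u < x -> exists z, [/\ L0 z, u <= z & emb z < x].

Let ltxN u : ~ emb u < x -> x < emb u.
Proof. by case: (otrichotomy x (emb u)) => // /nx. Qed.

(* H is the stabilizer of the cut of x.  If the lower part has a largest coset
   modulo H then x lies just above it; otherwise the positive elements above H
   have the coinitial small set of differences of L0, and saturation provides a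
   limit a of L0 lying just above x. *)
Lemma cut_shape : exists a H, convex_subgroup H /\
  (fills H (x - emb a) \/ fills H (emb a - x)).
Proof.
pose H : set U := [set h | forall l, emb l < x ->
  emb (l + h) < x /\ emb (l - h) < x].
have Hneg h : H h -> H (- h).
  by move=> Hh l /Hh[h1 h2]; rewrite opprK.
have cH : convex_subgroup H.
  split; first split.
  - by move=> l hl; rewrite subr0 addr0.
  - move=> h k Hh Hk l hl; split.
      have [h1 _] := Hh l hl; have [_ h2] := Hk _ h1.
      by rewrite (_ : l + (h - k) = l + h - k); [|zmod].
    have [_ h1] := Hh l hl; have [h2 _] := Hk _ h1.
    by rewrite (_ : l - (h - k) = l - h + k); [|zmod].
  - move=> h y k Hh Hk hy yk l hl; split.
      apply: le_lt_trans (Hk l hl).1; rewrite emb_le.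
      by apply: (ole1 yk); zmod.
    apply: le_lt_trans (Hh l hl).2; rewrite emb_le.
    by apply: (ole1 hy); zmod.
have [[a ax ha]|nmax] := pselect (exists2 a, emb a < x &
    forall u, emb u < x -> exists2 h, H h & u <= a + h).
  exists a, H; split=> //; left; split=> [h Hh|u au].
    by apply: (olt1 (Hh a ax).1); rewrite embD; zmod.
  suff : x < emb (a + u) by move=> h; apply: (olt1 h); rewrite embD; zmod.
  apply: ltxN => /ha[h Hh hu]; have := au h Hh.
  by move=> h1; apply: (@oltF _ (0 : U)); apply: (olt2 h1 hu); zmod.
have {}nmax a : emb a < x -> exists2 u, emb u < x & forall h, H h -> a + h < u.
  move=> ax; apply: contrapT => nu; apply: nmax; exists a => // u ux.
  apply: contrapT => nh; apply: nu; exists u => // h Hh.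
  by rewrite oltNge; apply/negP => uh; apply: nh; exists h.
have down l l' : l <= l' -> emb l' < x -> emb l < x.
  by move=> ll; apply: le_lt_trans; rewrite emb_le.
(* An element above [H] does not stabilize the cut, and cofinality puts a witness of this into
   [L0]. *)
have crit v : above H v -> exists l, [/\ L0 l, emb l < x & x < emb (l + v)].
  move=> av; apply: contrapT => nl; apply: (above_notin av) => l hl.
  have v0 := above_gt0 cH av.
  split; last by apply: down hl; apply: (ole1 (ltW v0)); zmod.
  apply: contrapT => /ltxN hx; apply: nl; have [z [Lz lz zx]] := cof hl.
  exists z; split=> //; apply: lt_le_trans hx _; rewrite emb_le.
  by apply: (ole1 lz); zmod.
(* The sums l2 + (l' - l) are the bounds needed for the limit [a]; on the diagonal they give [L0]
   itself. *)
pose W := ((L0 * L0) * L0)%type.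
pose e' (k : W) : U := val k.1.1 + (val k.1.2 - val k.2).
have sW : small K [set: W] by do 2?apply: (small_prod slK); apply: small_type.
have ee : elem_eq (fun k => emb (e' k)) e' by apply: elem_eq_sym; apply: emb_elem'.
have [a ha] := extend1 satU x sW ee.
have lo k : emb (e' k) < x -> e' k < a.
  by have /= h := ha (FLt (TVar (Some k)) (TVar None)); apply h.
have hi k : x < emb (e' k) -> a < e' k.
  by have /= h := ha (FLt (TVar None) (TVar (Some k))); apply h.
have xa : x < emb a.
  apply: ltxN => /cof[z [Lz az zx]].
  pose z' : L0 := exist _ z (mem_set Lz).
  have := @lo (z', z', z'); rewrite /e' /= subrr addr0 => /(_ zx).
  by rewrite oltNge az.
exists a, H; split=> //; right; split=> [h Hh|v av].
  have : x < emb (a - h).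
    apply: ltxN => h1; have [h2 _] := Hh _ h1; move: h2.
    by rewrite addrNK => h2; have := lt_trans h2 xa; rewrite ltxx.
  by move=> h1; apply: (olt1 h1); rewrite embD embN; zmod.
suff : emb (a - v) < x.
  by move=> h1; apply: (olt1 h1); rewrite embD embN; zmod.
have [l [Ll lx lv]] := crit v av.
have [u ux hu] := nmax l lx; have [l' [Ll' ul' l'x]] := cof ux.
have ad : above H (l' - l).
  by move=> h /hu h1; apply: (olt2 h1 ul'); zmod.
have dv : l' - l <= v.
  rewrite oleNgt; apply/negP => h1.
  have h2 : emb (l + v) < x.
    by apply: down l'x; apply: (ole1 (ltW h1)); zmod.
  by have := lt_trans h2 lv; rewrite ltxx.
have [l2 [Ll2 l2x l2d]] := crit _ ad.
have := @hi (exist _ l2 (mem_set Ll2), exist _ l' (mem_set Ll'), exist _ l (mem_set Ll)).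
rewrite /e' /= => /(_ l2d) h1; apply: down l2x.
by apply: (ole2 (ltW h1) dv); zmod.
Qed.

End Shape.

Section InvariantCut.
Variables (G : oagType) (regG : regular G) (K : Type) (slK : strong_limit K).
Variables (U : oagType) (GU : elem_equiv G U) (satU : saturated K U).
Variables (J : Type) (q : ftype J U) (gq : global_type q).
Variables (A : set U) (sA : small K A).
Hypothesis inv : forall (n : nat) (d d' : 'I_n -> U), equiv_over A d d' ->
      forall phi : formula (J + 'I_n), q (inst d phi) <-> q (inst d' phi).
Variables (X : elemext U) (c : J -> X) (rc : realizes (@emb U X) c q).
Local Notation emb := (@emb U X).
Local Notation v := (fun a : A => val a).
Let GX := emb_equiv X GU.

Lemma invariant_lt (t : term J) (u u' : U) :
  elem_eq (ocons u v) (ocons u' v) -> emb u < teval c t -> emb u' < teval c t.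
Proof.
move=> uu.
pose phi : formula (J + 'I_1) := FLt (TVar (inr ord0)) (trename inl t).
have key w : q (inst (fun=> w) phi) <-> emb w < teval c t.
  by rewrite -(realizes_iff gq rc) /inst holds_rename /= teval_rename.
rewrite -!key; have [|+ _] := @inv 1%N (fun=> u) (fun=> u') _ phi; last exact.
pose s (k : 'I_1 + A) : option A := if k is inr a then Some a else None.
have h w : sjoin (fun _ : 'I_1 => w) v = ocons w v \o s by apply: funext => -[].
by rewrite /equiv_over !h; apply: elem_eq_rename.
Qed.

(** If both sides failed, some u < x < u' would have no fraction over [A] between them, hence the
    same cut over [A]. Perturbation and saturation would give u'' at least u' with the type of u
    over [A], although invariance forces u'' < x. *)
Lemma rational_cut (t : term J) : (forall u, teval c t <> emb u) ->
  let x := teval c t in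
  (forall u, emb u < x -> exists n a, [/\ (0 < n)%N, u *+ n <= teval v a &
     emb (teval v a) < x *+ n]) \/
  (forall u, x < emb u -> exists n a, [/\ (0 < n)%N, teval v a <= u *+ n &
     x *+ n < emb (teval v a)]).
Proof.
move=> nx x; apply: contrapT => /not_orP[/existsNP[u /not_implyP[ux nu]]
  /existsNP[u' /not_implyP[xu' nu']]].
have uu' : u < u' by rewrite -(emb_lt X); apply: lt_trans ux xu'.
have cut : same_cut v u u'.
  apply: gap_same_cut; first exact: ltW.
  move=> n a n0 h1 h2; case: (otrichotomy (x *+ n) (emb (teval v a))) => h3.
  - by apply: nu'; exists n, a.
  - by have [w] := emb_pure n0 h3; apply: nx.
  - by apply: nu; exists n, a.
pose s (o : option A) : unit + option A :=
  if o is Some a then inr (Some a) else inl tt.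
pose S : set (formula (unit + option A)) := [set psi |
  (exists2 phi, holds (ocons u v) phi & psi = frename s phi) \/
  psi = FNot (FLt (TVar (inl tt)) (TVar (inr None)))].
have hs (y : unit -> U) : sjoin y (ocons u' v) \o s = ocons (y tt) v.
  by apply: funext => -[].
have [|u'' hu''] := @saturation K U satU (option A) (ocons u' v) S
    (small_option slK (small_type sA)).
  move=> n phi hphi.
  have /choice[f hf] k : exists psi, holds (ocons u v) psi /\
      forall y, holds (ocons (y tt) v) psi -> u' <= y tt ->
      holds (sjoin y (ocons u' v)) (phi k).
    have [[psi h e]|e] := hphi k.
      by exists psi; split=> // y hy _; rewrite e holds_rename hs.
    exists (FEq TZero TZero); split=> // y _ h; rewrite e /=.
    by rewrite oltNge h.
  have [l hl] := all_conj f.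
  have hu : holds (ocons u v) (FConj l).
    by apply/holds_conj => a /hl[k ->]; case: (hf k).
  have [N [N0 hN]] := perturb regG GU hu cut.
  have [|[e [e0 _ he]] _] := hN N u N0 (dvdnn N); first by [].
  exists (fun=> u' + e) => k; apply: (hf k).2.
    by move/holds_conj: he; apply; apply/hl; exists k.
  by apply: (ole1 (ltW e0)); zmod.
have le : u' <= u''.
  by rewrite oleNgt; apply/negP => h; apply: (hu'' _ (or_intror erefl)).
have eq : elem_eq (ocons u v) (ocons u'' v).
  have key phi : holds (ocons u v) phi -> holds (ocons u'' v) phi.
    move=> h; have := hu'' (frename s phi).
    by rewrite (holds_rename s _ phi) hs; apply; left; exists phi.
  move=> phi; split; first exact: key.
  by apply: contraPP => h; apply: (key (FNot phi)).
have := invariant_lt eq ux; move=> h; have := lt_trans h xu'.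
by rewrite emb_lt oltNge le.
Qed.

(** [Z] contains the values of terms over [A] and, for each pair of fractions, an element of U
    between them if there is one. If the latter are cofinal below x, [cut_shape] applies with k = 1.
    Otherwise no element of U lies between some fraction a/n and x; then nx - a fills the cut of the
    zero subgroup, and k = n. *)
Lemma cut_set : exists Z : set U, small K Z /\
  forall t : term J, (forall u, teval c t <> emb u) ->
  exists (t' : term J) k a H, [/\ t' = t \/ t' = TOpp t, (0 < k)%N,
    convex_subgroup H,
    forall u, emb u < teval c t' *+ k ->
      exists z, [/\ Z z, u <= z & emb z < teval c t' *+ k] &
    fills H (teval c t' *+ k - emb a) \/ fills H (emb a - teval c t' *+ k)].
Proof.
pose Fr := (nat * term A)%type.
pose between (f : Fr * Fr) u := teval v f.1.2 <= u *+ f.1.1 /\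
  u *+ f.2.1 <= teval v f.2.2.
have /choice[ch hch] f : exists u, forall u', between f u' -> between f u.
  have [[u hu]|nu] := pselect (exists u, between f u); first by exists u.
  by exists 0 => u' hu'; case: nu; exists u'.
have sF : small K [set: Fr].
  apply: (small_prod slK (small_nat slK)).
  exact: (small_term slK (small_type sA)).
exists (range (fun a : term A => teval v a) `|` range ch).
split.
  apply: (small_setU slK); apply: small_range.
    exact: (small_term slK (small_type sA)).
  exact: (small_prod slK).
set Z := _ `|` _.
have sZ : small K (range ch) by apply: small_range; apply: (small_prod slK).
have left (t : term J) : (forall u, teval c t <> emb u) ->
   (forall u, emb u < teval c t -> exists n a, [/\ (0 < n)%N,
      u *+ n <= teval v a & emb (teval v a) < teval c t *+ n]) ->
   exists k a H, [/\ (0 < k)%N, convex_subgroup H,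
    forall u, emb u < teval c t *+ k ->
      exists z, [/\ Z z, u <= z & emb z < teval c t *+ k] &
    fills H (teval c t *+ k - emb a) \/ fills H (emb a - teval c t *+ k)].
  move=> nx rat; set x := teval c t in nx rat *.
  have [cof|/existsNP[u0 /not_implyP[u0x nz]]] := pselect (forall u, emb u < x ->
    exists z, [/\ range ch z, u <= z & emb z < x]).
    have [a [H [cH hH]]] := cut_shape slK satU nx sZ cof.
    exists 1%N, a, H; rewrite mulr1n; split=> // u /cof[z [rz uz zx]].
    by exists z; split=> //; right.
  have [n [a [n0 u0a ax]]] := rat u0 u0x.
  have nou u : teval v a <= u *+ n -> emb u < x -> False.
    move=> au ux; have [n' [a' [n0' ua' ax']]] := rat u ux.
    have [h1 h2] := hch ((n, a), (n', a')) u (conj au ua').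
    apply: nz; exists (ch ((n, a), (n', a'))); split; first by exists ((n, a), (n', a')).
      by rewrite -(oleMn _ _ n0); apply: le_trans u0a h1.
    rewrite -(oltMn _ _ n0') -embMn; apply: le_lt_trans ax'.
    by rewrite emb_le.
  have d0 : 0 < x *+ n - emb (teval v a) by apply: (olt1 ax); zmod.
  have bd : big (x *+ n - emb (teval v a)).
    apply: not_near_one => // z e.
    have [|w] := @emb_pure U X n x (teval v a + pres_one U *~ z) n0; last exact: nx.
    by rewrite embD embMz emb1 -e; zmod.
  (* A positive element of U at most nx - a would leave room for a small e with a + e divisible by
     n, and (a + e)/n would lie between a/n and x. *)
  have fz : fills (set1 (0 : U)) (x *+ n - emb (teval v a)).
    split=> [_ ->|u /(_ 0 erefl) u00]; first by rewrite emb0.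
    rewrite oltNge; apply/negP => hu.
    have [D hD] := tiny_unif regG n0.
    have [d [d00 dD dx]] : exists d, [/\ 0 < d, pres_one U *+ D <= d &
        emb d <= x *+ n - emb (teval v a)].
      have [h|h] := oltP (pres_one U *+ D) u; first by exists u; rewrite ltW.
      have o1 : 0 < pres_one U.
        rewrite lt_def pres_one_ge0 andbT; apply/eqP => e.
        by move: h; rewrite e mul0rn oleNgt u00.
      exists (pres_one U *+ D.+1); split; first exact: omuln_gt0.
        by apply: omuln_geS => //; exact: ltW.
      by rewrite embMn emb1; apply: ltW; apply: bd.
    have [e [e0 ed [w hw]]] := hD U GU d (- teval v a) d00 dD.
    have ew : w *+ n = teval v a + e by rewrite -hw; zmod.
    apply: (nou w); first by rewrite ew; apply: (ole1 (ltW e0)); zmod.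
    rewrite -(oltMn _ _ n0) -embMn ew embD.
    have ed' : emb e < emb d by rewrite emb_lt.
    by apply: (olt2 ed' dx); zmod.
  exists n, (teval v a), (set1 0); split=> //.
  - split; first by split=> // _ _ -> ->; rewrite subrr.
    by move=> y z w -> -> h1 h2; apply/eqP; rewrite eq_le h2.
  - move=> u ux; exists (teval v a); split=> //; first by left; exists a.
    rewrite oleNgt; apply/negP => au.
    have : x *+ n - emb (teval v a) < emb (u - teval v a).
      by apply: fz.2 => _ ->; apply: (olt1 au); zmod.
    rewrite embD embN => h; apply: (@oltF _ (0 : X)).
    by apply: (olt2 h (ltW ux)); zmod.
  by left.
move=> t nx; have [rat|rat] := rational_cut nx.
  have [k [a [H [k0 cH cof hH]]]] := left t nx rat.
  by exists t, k, a, H; split=> //; left.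
(* Negation exchanges the two sides of the cut. *)
have [||k [a [H [k0 cH cof hH]]]] := left (TOpp t).
- by move=> u /= e; apply: (nx (- u)); rewrite embN -e opprK.
- move=> u /= ux; have [|n [a [n0 h1 h2]]] := rat (- u).
    by rewrite embN; apply: (olt1 ux); zmod.
  exists n, (TOpp a); split=> //=.
    by apply: (ole1 h1); rewrite mulNrn; zmod.
  by apply: (olt1 h2); rewrite embN mulNrn; zmod.
by exists (TOpp t), k, a, H; split=> //; right.
Qed.

End InvariantCut.

(** * Matching residue classes *)

Section IndependentPowers.
Variables (G : oagType) (regG : regular G) (U : oagType) (GU : elem_equiv G U).
Variables (I : Type) (q : ftype I U) (c : realization q).
Variables (l : nat) (pl : prime l) (B : set c).
Hypotheses (BD : B `<=` dcl (base c)) (indB : kindep l B).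
Local Notation emb := (@emb U c).

Lemma kindep_fam (T : eqType) (s : seq T) (h : T -> c) (z : T -> int) :
  uniq s -> {in s &, injective h} -> (forall e, e \in s -> B (h e)) ->
  kappa_sub l c (\sum_(e <- s) h e *~ z e) -> forall e, e \in s -> (l %| z e)%Z.
Proof.
move=> us injh sB hs e0 es0.
pose z' (y : c) := z (nth e0 s (index y (map h s))).
have hz e : e \in s -> z' (h e) = z e.
  move=> es; congr z; have hi : (index (h e) (map h s) < size s)%N.
    by rewrite -(size_map h) index_mem map_f.
  by apply: injh; rewrite ?mem_nth // -(nth_map _ 0) // nth_index ?map_f.
rewrite -(hz e0 es0); apply: (indB (s := map h s)) (map_f h es0).
- by rewrite map_inj_in_uniq.
- by move=> y /mapP[e es ->]; apply: sB.
rewrite big_map; congr (kappa_sub l c _): hs.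
by apply: eq_big_seq => e /hz ->.
Qed.

(** Independence modulo ℓ makes all z e divisible by ℓ, purity of U does the same for u, and
    torsion-freeness allows dividing the whole sum by ℓ. *)
Lemma kindep_pow (T : eqType) (s : seq T) (h : T -> c) m u (z : T -> int) :
  uniq s -> {in s &, injective h} -> (forall e, e \in s -> B (h e)) ->
  dvdby (l ^ m) (emb u + \sum_(e <- s) h e *~ z e) ->
  (forall e, e \in s -> ((l ^ m)%:Z %| z e)%Z) /\ dvdby (l ^ m) u.
Proof.
move=> us injh sB; elim: m u z => [|m ih] u z hd.
  by split=> [e _|]; [rewrite expn0 dvd1z|apply: dvdby1].
have l0 := prime_gt0 pl.
have lz : forall e, e \in s -> (l %| z e)%Z.
  apply: (kindep_fam us injh sB); apply/(subP regG GU pl).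
    elim: (s) sB => [|e' s' ih'] sB; first by rewrite big_nil; apply: (D0 regG GU).
    rewrite big_cons; apply: (D_D regG GU).
      by apply: (DMz regG GU); apply: BD; apply: sB; rewrite mem_head.
    by apply: ih' => x xs; apply: sB; rewrite inE xs orbT.
  exists (- u); rewrite embN opprK addrC.
  by apply: dvdbyW hd; rewrite expnS dvdn_mulr.
pose z' e := (z e %/ l)%Z.
have ez e : e \in s -> z e = z' e * l by move=> /lz; rewrite /z' => h'; rewrite divzK.
have es : \sum_(e <- s) h e *~ z e = (\sum_(e <- s) h e *~ z' e) *+ l.
  rewrite -sumrMnl; apply: eq_big_seq => e /ez ->.
  by rewrite mulrzA -pmulrn.
rewrite es in hd.
have [u' eu] : dvdby l u.
  apply/(emb_dvdby c); set S := \sum_(_ <- _) _ in hd.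
  rewrite (_ : emb u = emb u + S *+ l - S *+ l); last by zmod.
  apply: dvdbyB; last exact: dvdby_mul.
  by apply: dvdbyW hd; rewrite expnS dvdn_mulr.
have {hd} /ih[h1 h2] : dvdby (l ^ m) (emb u' + \sum_(e <- s) h e *~ z' e).
  by apply/(dvdbyM _ _ l0); rewrite -expnSr mulrnDl -embMn -eu.
split=> [e es'|]; last by rewrite eu expnSr; apply/dvdbyM.
by rewrite (ez e es') expnSr PoszM dvdz_mul // h1.
Qed.

End IndependentPowers.

Section Matching.
Variables (G : oagType) (regG : regular G) (U : oagType) (GU : elem_equiv G U).
Variables (I J : Type) (p : ftype I U) (q : ftype J U).
Variables (rq : realization q) (rp : realization p).
Variables (l : nat) (pl : prime l) (B : set rq) (C : set rp).
Hypotheses (bB : kappa_basis l B) (bC : kappa_basis l C).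
Variables (f : rq -> rp) (injf : {in B &, injective f}).
Hypothesis fC : forall e, B e -> C (f e).
Local Notation D := (dcl (base rq)).
Local Notation D' := (dcl (base rp)).
Local Notation embq := (@emb U rq).
Local Notation embp := (@emb U rp).

(* The subgroup matching ⟨U, c⟩ with ⟨U, b⟩ modulo l^m along f. *)
Inductive mrel (m : nat) : rq -> rp -> Prop :=
| mrelU u : mrel m (embq u) (embp u)
| mrelB e : B e -> mrel m e (f e)
| mrelN d d' : D d -> D' d' -> mrel m (d *+ l ^ m) (d' *+ l ^ m)
| mrelS x g x' g' : mrel m x g -> mrel m x' g' -> mrel m (x - x') (g - g').

Let BD : B `<=` D. Proof. by case: bB. Qed.
Let CD : C `<=` D'. Proof. by case: bC. Qed.
Let indB : kindep l B. Proof. by have [] := (kbasisP regG GU pl BD).1 bB. Qed.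
Let indC : kindep l C. Proof. by have [] := (kbasisP regG GU pl CD).1 bC. Qed.
Let spB : forall x, D x -> kspan l B x.
Proof. by have [] := (kbasisP regG GU pl BD).1 bB. Qed.

Lemma mrel0 m : mrel m 0 0.
Proof. by rewrite -(emb0 rq) -(emb0 rp); apply: mrelU. Qed.

Lemma mrelOpp m x g : mrel m x g -> mrel m (- x) (- g).
Proof. by move=> h; rewrite -(sub0r x) -(sub0r g); apply: mrelS h; apply: mrel0. Qed.

Lemma mrelD m x g x' g' : mrel m x g -> mrel m x' g' -> mrel m (x + x') (g + g').
Proof. by move=> h /mrelOpp h'; rewrite -(opprK x') -(opprK g'); apply: mrelS. Qed.

Lemma mrelMn m x g n : mrel m x g -> mrel m (x *+ n) (g *+ n).
Proof.
move=> h; elim: n => [|n ih]; first by rewrite !mulr0n; apply: mrel0.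
by rewrite !mulrS; apply: mrelD.
Qed.

Lemma mrelMz m x g z : mrel m x g -> mrel m (x *~ z) (g *~ z).
Proof.
by case: z => n h; rewrite ?NegzE ?mulrNz -!pmulrn; [|apply: mrelOpp]; apply: mrelMn.
Qed.

Lemma mrel_D m x g : mrel m x g -> D' g.
Proof.
elim=> [u|e Be|d d' _ Dd'|x' g' x'' g'' _ h1 _ h2].
- exact: (D_emb regG GU).
- by apply: CD; apply: fC.
- by rewrite pmulrn; apply: (DMz regG GU).
- exact: (DB regG GU).
Qed.

(** The same u and the same integers occur on both sides, so divisibility of either side by ℓ^m
    reduces to theirs. *)
Lemma mrel_normal m x g : mrel m x g -> exists u (s : seq rq) (z : rq -> int) d d',
  [/\ uniq s, forall e, e \in s -> B e,
     x = embq u + \sum_(e <- s) e *~ z e + d *+ l ^ m &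
     g = embp u + \sum_(e <- s) f e *~ z e + d' *+ l ^ m].
Proof.
elim=> [u|e Be|d d' Dd Dd'|{}x {}g x' g' _ [u [s [z [d [d' [us sB -> ->]]]]]]
   _ [u' [s' [z' [d2 [d2' [us' sB' -> ->]]]]]]].
- by exists u, [::], (fun=> 0), 0, 0; rewrite !big_nil !mul0rn !addr0.
- exists 0, [:: e], (fun=> 1), 0, 0; rewrite !big_seq1 !mul0rn !emb0 !mulr1z.
  by rewrite !addr0 !add0r; split=> // x'; rewrite inE => /eqP ->.
- by exists 0, [::], (fun=> 0), d, d'; rewrite !big_nil !emb0 !addr0 !add0r.
pose w e : int := (if e \in s then z e else 0) - (if e \in s' then z' e else 0).
exists (u - u'), (undup (s ++ s')), w, (d - d2), (d' - d2').
have key (M : oagType) (h : rq -> M) : \sum_(e <- undup (s ++ s')) h e *~ w e =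
    \sum_(e <- s) h e *~ z e - \sum_(e <- s') h e *~ z' e.
  have one (t : seq rq) (y : rq -> int) : uniq t -> {subset t <= undup (s ++ s')} ->
     \sum_(e <- undup (s ++ s')) h e *~ (if e \in t then y e else 0) =
     \sum_(e <- t) h e *~ y e.
    move=> ut st; rewrite (eq_bigr (fun e => if e \in t then h e *~ y e else 0)).
      rewrite -big_mkcond -big_filter; apply: perm_big.
      apply: uniq_perm => // [|e]; first by rewrite filter_uniq ?undup_uniq.
      rewrite mem_filter; apply: andb_idr; exact: st.
    by move=> e _; case: ifP.
  rewrite -(one s z) // -?(one s' z') // => [|e es|e es].
  - by rewrite -sumrB; apply: eq_bigr => e _; rewrite -mulrzBr.
  - by rewrite mem_undup mem_cat es orbT.
  - by rewrite mem_undup mem_cat es.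
split.
- exact: undup_uniq.
- by move=> e; rewrite mem_undup mem_cat => /orP[/sB|/sB'].
- by rewrite (key _ id) embD embN mulrnBl; zmod.
- by rewrite (key _ f) embD embN mulrnBl; zmod.
Qed.

Lemma mrel_dvd m x g : mrel m x g -> dvdby (l ^ m) x <-> dvdby (l ^ m) g.
Proof.
move=> /mrel_normal[u [s [z [d [d' [us sB -> ->]]]]]].
have dr (M : oagType) (a y : M) : dvdby (l ^ m) (a + y *+ l ^ m) <-> dvdby (l ^ m) a.
  by apply: dvdby_congr; rewrite addrC addKr; apply: dvdby_mul.
have sumd (M : oagType) (h : rq -> M) (e0 : U -> M) :
    (forall e, e \in s -> ((l ^ m)%:Z %| z e)%Z) ->
    dvdby (l ^ m) (\sum_(e <- s) h e *~ z e).
  move=> hz; rewrite big_seq; elim/big_ind: _ => [||e es]; first exact: dvdby0.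
    by move=> ? ?; apply: dvdbyD.
  have /dvdzP[w ->] := hz e es.
  by rewrite mulrzA -pmulrn; apply: dvdby_mul.
rewrite !dr; split=> h.
  have [|||hz hu] := kindep_pow regG GU pl BD indB (s := s) (h := id) (m := m) (u := u) (z := z) us.
  - by [].
  - exact: sB.
  - exact: h.
  apply: dvdbyD; first by apply/emb_dvdby.
  exact: (sumd _ f embp).
have [|||hz hu] := kindep_pow regG GU pl CD indC (s := s) (h := f) (m := m) (u := u) (z := z) us.
- by move=> e e' es es'; apply: injf; rewrite inE; apply: sB.
- by move=> e /sB/fC.
- exact: h.
apply: dvdbyD; first by apply/emb_dvdby.
exact: (sumd _ id embq).
Qed.

Lemma mrel_mul m x g : mrel m x g -> mrel m.+1 (x *+ l) (g *+ l).
Proof.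
elim=> [u|e Be|d d' Dd Dd'|x' g' x'' g'' _ h1 _ h2].
- by apply: mrelMn; apply: mrelU.
- by apply: mrelMn; apply: mrelB.
- by rewrite -!mulrnA -expnSr; apply: mrelN.
- by rewrite !mulrnBl; apply: mrelS.
Qed.

Lemma mrelW m m' x g : (m <= m')%N -> mrel m' x g -> mrel m x g.
Proof.
move=> mm; elim=> [u|e Be|d d' Dd Dd'|x' g' x'' g'' _ h1 _ h2].
- exact: mrelU.
- exact: mrelB.
- rewrite -(subnK mm) expnD !mulrnA; apply: mrelN.
    by rewrite pmulrn; apply: (DMz regG GU).
  by rewrite pmulrn; apply: (DMz regG GU).
- exact: mrelS.
Qed.

(** An element of D is a combination of [B], plus ℓd, plus an element of U; ℓ times a partner of d
    modulo ℓ^m is a partner of ℓd modulo ℓ^(m + 1). *)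
Lemma mrel_total m x : D x -> exists g, mrel m x g.
Proof.
elim: m x => [|m ih] x Dx.
  exists 0; have := mrelN 0 Dx (D0 regG GU rp).
  by rewrite mul0rn expn0 mulr1n.
have [s [z [us sB [d [Dd [u hd]]]]]] := spB Dx.
have [g hg] := ih d Dd.
have sums : mrel m.+1 (\sum_(e <- s) e *~ z e) (\sum_(e <- s) f e *~ z e).
  elim: s sB {us hd} => [|e s ihs] sB; first by rewrite !big_nil; apply: mrel0.
  rewrite !big_cons; apply: mrelD.
    by apply: mrelMz; apply: mrelB; apply: sB; rewrite mem_head.
  by apply: ihs => y ys; apply: sB; rewrite inE ys orbT.
exists (\sum_(e <- s) f e *~ z e + (g *+ l + embp u)).
have -> : x = \sum_(e <- s) e *~ z e + (d *+ l + embq u) by rewrite -hd; zmod.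
apply: mrelD => //; apply: mrelD; last exact: mrelU.
exact: mrel_mul.
Qed.

End Matching.

(** * Matching modulo all integers over given realizations *)

Section MatchingFamily.
Variables (G : oagType) (regG : regular G) (U : oagType) (GU : elem_equiv G U).
Variables (I J : Type) (p : ftype I U) (q : ftype J U).
Hypotheses (gp : global_type p) (gq : global_type q).
Variables (X Y : elemext U) (c : J -> X) (b : I -> Y).
Hypotheses (rc : realizes (@emb U X) c q) (rb : realizes (@emb U Y) b p).
Local Notation embx := (@emb U X).
Local Notation emby := (@emb U Y).

Lemma dvdby_transfer (T : Type) (s : ftype T U) (V V' : elemext U) (d : T -> V)
    (d' : T -> V') N (t : term (T + U)) :
  global_type s -> realizes (@emb U V) d s -> realizes (@emb U V') d' s ->
  dvdby N (teval (sjoin d (@emb U V)) t) <-> dvdby N (teval (sjoin d' (@emb U V')) t).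
Proof.
move=> gs rd rd'.
have h : holds (sjoin d (@emb U V)) (FCong N t TZero) <->
   holds (sjoin d' (@emb U V')) (FCong N t TZero).
  by rewrite !(realizes_iff gs).
by move: h; rewrite /= !subr0.
Qed.

Lemma matching_prime l : prime l -> kappa_le l q p ->
  exists R : nat -> X -> Y -> Prop,
  (forall m x g x' g', R m x g -> R m x' g' -> R m (x - x') (g - g')) /\
  (forall m u, R m (embx u) (emby u)) /\
  (forall m t, exists g, R m (teval (sjoin c embx) t) g) /\
  (forall m x g, R m x g -> dvdby (l ^ m) x <-> dvdby (l ^ m) g) /\
  (forall m x g, R m x g -> phull (sjoin b emby) g) /\
  (forall m d, phull (sjoin b emby) d -> R m 0 (d *+ l ^ m)) /\
  (forall m m' x g, (m <= m')%N -> R m' x g -> R m x g).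
Proof.
move=> pl [rq [B [rp [C [bB bC /card_le_injE[f0 injf0]]]]]].
have /choice[f hf] (e : rq) : exists y : rp, forall h : e \in B,
    y = val (f0 (exist (fun e => e \in B) e h)).
  have [h|h] := pselect (e \in B); last by exists 0 => h'; case: h.
  by exists (val (f0 (exist _ e h))) => h'; congr (val (f0 _)); apply: val_inj.
have injf : {in B &, injective f}.
  by move=> e e' Be Be'; rewrite (hf e Be) (hf e' Be') => /val_inj/injf0[].
have fC e : B e -> C (f e).
  move=> Be; rewrite (hf e (mem_set Be)); exact: set_mem (valP (f0 _)).
have rrq : realizes (@emb U rq) (rtup rq) q by case: (rq).
have rrp : realizes (@emb U rp) (rtup rp) p by case: (rp).
pose cq := sjoin (rtup rq) (@emb U rq); pose bp := sjoin (rtup rp) (@emb U rp).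
pose R m x g := exists (t : term (J + U)) n (a : term (I + U)) g',
  [/\ (0 < n)%N, x = teval (sjoin c embx) t, g *+ n = teval (sjoin b emby) a,
      g' *+ n = teval bp a & mrel l B f m (teval cq t) g'].
have dt t : dcl (base rq) (teval cq t).
  by apply/(dcl_base regG GU); apply: phull_teval.
have dvt N a : dvdby N (teval bp a) <-> dvdby N (teval (sjoin b emby) a).
  exact: dvdby_transfer gp rrp rb.
exists R.
refine (conj _ (conj _ (conj _ (conj _ (conj _ (conj _ _)))))).
- move=> m x g x' g' [t [n [a [y [n0 -> ea ey hy]]]]]
    [t' [n' [a' [y' [n0' -> ea' ey' hy']]]]].
  exists (TAdd t (TOpp t')), (n * n')%N, (TAdd (TMuln a n') (TOpp (TMuln a' n))), (y - y').
  rewrite muln_gt0 n0 n0' /= !teval_muln -ea -ea' -ey -ey' -!mulrnA.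
  by rewrite !mulrnBl [(n' * n)%N]mulnC; split=> //; apply: mrelS.
- move=> m u; exists (TVar (inr u)), 1%N, (TVar (inr u)), (@emb U rp u).
  by split=> //; apply: mrelU.
- move=> m t; have [y hy] := mrel_total regG GU pl bB f m (dt t).
  have /(dcl_base regG GU)[n [a [n0 ha]]] := mrel_D regG GU bC fC hy.
  have /dvt[g hg] : dvdby n (teval bp a) by exists y.
  by exists g, t, n, a, y; split.
- move=> m x g [t [n [a [y [n0 -> ea ey hy]]]]].
  rewrite (dvdby_transfer (l ^ m) t gq rc rrq).
  rewrite (mrel_dvd regG GU pl bB bC injf fC hy).
  by rewrite -(dvdbyM (l ^ m) g n0) -(dvdbyM (l ^ m) y n0) ea ey dvt.
- by move=> m x g [t [n [a [y [n0 _ ea _ _]]]]]; exists n, a.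
- move=> m d [n [a [n0 ha]]].
  have /dvt[d' hd'] : dvdby n (teval (sjoin b emby) a) by exists d.
  exists TZero, n, (TMuln a (l ^ m)), (d' *+ l ^ m); rewrite !teval_muln -ha hd'.
  split=> //; rewrite ?[(_ *+ l ^ m) *+ n]mulrnAC //=.
  have Dd' : dcl (base rp) d'.
    by apply/(dcl_base regG GU); exists n, a.
  by have := mrelN l B f m (D0 regG GU rq) Dd'; rewrite mul0rn.
- move=> m m' x g mm [t [n [a [y [n0 ex ea ey hy]]]]].
  by exists t, n, a, y; split=> //; apply: mrelW hy.
Qed.

Lemma dvdby_primes (M : zmodType) (x : M) N : (0 < N)%N ->
  (forall l m, prime l -> (l ^ m %| N)%N -> dvdby (l ^ m) x) -> dvdby N x.
Proof.
elim/ltn_ind: N => N ih N0 h.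
have [N1|N1] := leqP N 1%N.
  have -> : N = 1%N by lia.
  exact: dvdby1.
have pl := pdiv_prime N1; set l := pdiv N in pl.
have [n' cn eN] := pfactor_coprime pl N0.
have s0 : (0 < logn l N)%N by rewrite logn_gt0 mem_primes pl N0 pdiv_dvd.
have n'N : (n' %| N)%N by rewrite eN dvdn_mulr.
have n0 : (0 < n')%N by apply: dvdn_gt0 n'N.
have ls : (1 < l ^ logn l N)%N by rewrite -(exp1n (logn l N)) ltn_exp2r // prime_gt1.
rewrite eN; apply: dvdby_coprime.
- by rewrite coprime_sym coprimeXl.
- apply: ih => //; first by rewrite [X in (_ < X)%N]eN -[X in (X < _)%N]muln1 ltn_pmul2l.
  by move=> l' m pl' hm; apply: h => //; apply: dvdn_trans n'N.
- by apply: h => //; rewrite [X in (_ %| X)%N]eN dvdn_mull.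
Qed.

(** Being related for N means being matched for every prime power dividing N. Partners for coprime
    factors combine by the Chinese remainder theorem, because a partner modulo ℓ^m may be changed by
    ℓ^m times an element of the pure hull of b. *)
Lemma matching_family : (forall l, prime l -> kappa_le l q p) ->
  exists R : nat -> X -> Y -> Prop,
  (forall N x g x' g', R N x g -> R N x' g' -> R N (x - x') (g - g')) /\
  (forall N u, R N (embx u) (emby u)) /\
  (forall N t, (0 < N)%N -> exists g, R N (teval (sjoin c embx) t) g) /\
  (forall N x g, (0 < N)%N -> R N x g -> dvdby N x <-> dvdby N g) /\
  (forall N x g, R N x g -> phull (sjoin b emby) g) /\
  (forall N N' x g, (N %| N')%N -> R N' x g -> R N x g).
Proof.
move=> hk.
have /choice[R0 hR0] (l : nat) : exists R : nat -> X -> Y -> Prop, prime l ->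
  (forall m x g x' g', R m x g -> R m x' g' -> R m (x - x') (g - g')) /\
  (forall m u, R m (embx u) (emby u)) /\
  (forall m t, exists g, R m (teval (sjoin c embx) t) g) /\
  (forall m x g, R m x g -> dvdby (l ^ m) x <-> dvdby (l ^ m) g) /\
  (forall m x g, R m x g -> phull (sjoin b emby) g) /\
  (forall m d, phull (sjoin b emby) d -> R m 0 (d *+ l ^ m)) /\
  (forall m m' x g, (m <= m')%N -> R m' x g -> R m x g).
  have [pl|npl] := boolP (prime l); last by exists (fun _ _ _ => True).
  by have [R hR] := matching_prime pl (hk l pl); exists R.
exists (fun N x g => forall l m, prime l -> (l ^ m %| N)%N -> R0 l m x g).
have hull N x g : (forall l m, prime l -> (l ^ m %| N)%N -> R0 l m x g) ->
    phull (sjoin b emby) g.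
  move=> h; have [_ [_ [_ [_ [h5 _]]]]] := hR0 2 isT.
  exact: (h5 0%N x g (h 2 0%N isT (dvd1n N))).
refine (conj _ (conj _ (conj _ (conj _ (conj _ _))))).
- move=> N x g x' g' h h' l m pl hm; have [h1 _] := hR0 l pl.
  exact: h1 (h l m pl hm) (h' l m pl hm).
- by move=> N u l m pl hm; have [_ [h2 _]] := hR0 l pl.
- move=> N t; set x := teval _ t; elim/ltn_ind: N => N ih N0.
  have adj l m g d : prime l -> R0 l m x g -> phull (sjoin b emby) d ->
      R0 l m x (g - d *+ l ^ m).
    move=> pl hg hd; have [h1 [_ [_ [_ [_ [h6 _]]]]]] := hR0 l pl.
    by rewrite -[x]subr0; apply: h1 => //; apply: h6.
  have [N1|N1] := leqP N 1%N.
    have -> : N = 1%N by lia.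
    exists 0 => l m pl; rewrite dvdn1 => /eqP lm.
    have [_ [_ [h3 [_ [h5 _]]]]] := hR0 l pl.
    have [g hg] := h3 m t; have := adj l m g g pl hg (h5 _ _ _ hg).
    by rewrite lm mulr1n subrr.
  have pl := pdiv_prime N1; set l := pdiv N in pl.
  have [n' cn eN] := pfactor_coprime pl N0; set s := logn l N in eN.
  have s0 : (0 < s)%N by rewrite logn_gt0 mem_primes pl N0 pdiv_dvd.
  have n'N : (n' %| N)%N by rewrite eN dvdn_mulr.
  have n0 : (0 < n')%N by apply: dvdn_gt0 n'N.
  have ls : (1 < l ^ s)%N by rewrite -(exp1n s) ltn_exp2r // prime_gt1.
  have [|g2 hg2] := ih n' _ n0; first by rewrite [X in (_ < X)%N]eN -[X in (X < _)%N]muln1 ltn_pmul2l.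
  have [_ [_ [h3 [_ [h5 [_ h7]]]]]] := hR0 l pl.
  have [g1 hg1] := h3 s t.
  have cop : coprime n' (l ^ s) by rewrite coprime_sym coprimeXl.
  have [al [be [hal hbe hab]]] : exists al be : int,
      [/\ (n'%:Z %| al)%Z, ((l ^ s)%:Z %| be)%Z & al + be = 1].
    have [u [w h]] := bezout_coprime cop.
    by exists (u * n'%:Z), (w * (l ^ s)%:Z); rewrite !dvdz_mull.
  have /dvdzP[al' eal] := hal; have /dvdzP[be' ebe] := hbe.
  have dg : phull (sjoin b emby) (g1 - g2).
    by apply: phullB; [apply: h5 hg1|apply: hull hg2].
  exists (g1 *~ al + g2 *~ be) => l' m pl' hm.
  (* Seen as a correction of [g1] by a multiple of ℓ^s, and below as one of [g2] by a multiple of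
     n', the new partner inherits both relations. *)
  have e1 : g1 *~ al + g2 *~ be = g1 - ((g1 - g2) *~ be') *+ l ^ s.
    have -> : (g1 - g2) *~ be' *+ l ^ s = (g1 - g2) *~ be.
      by rewrite pmulrn -mulrzA -ebe.
    have -> : al = 1 - be by rewrite -hab addrK.
    by rewrite mulrzBr mulr1z mulrzBl; zmod.
  have e2 : g1 *~ al + g2 *~ be = g2 - ((g2 - g1) *~ al') *+ n'.
    have -> : (g2 - g1) *~ al' *+ n' = (g2 - g1) *~ al.
      by rewrite pmulrn -mulrzA -eal.
    have -> : be = 1 - al by rewrite -hab addrC addKr.
    by rewrite mulrzBr mulr1z mulrzBl; zmod.
  have [ell|ne] := eqVneq l' l.
    rewrite ell in hm *; apply: (h7 m s).
      by rewrite -(pfactor_dvdn m pl N0).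
    by rewrite e1; apply: adj => //; apply: phullMz.
  have hm' : (l' ^ m %| n')%N.
    move: hm; rewrite eN Gauss_dvdl // coprimeXl // coprimeXr //.
    by rewrite prime_coprime // dvdn_prime2.
  rewrite e2; have /dvdnP[k ek] := hm'.
  rewrite ek mulrnA; apply: adj => //; first exact: hg2.
  apply: phullMn; apply: phullMz; rewrite -opprB; exact: phullN.
- move=> N x g N0 h; split=> hd; apply: dvdby_primes => // l m pl hm.
    have [_ [_ [_ [h4 _]]]] := hR0 l pl.
    by apply/(h4 m x g (h l m pl hm)); apply: dvdbyW hd.
  have [_ [_ [_ [h4 _]]]] := hR0 l pl.
  by apply/(h4 m x g (h l m pl hm)); apply: dvdbyW hd.
- exact: hull.
- by move=> N N' x g NN h l m pl hm; apply: h => //; apply: dvdn_trans NN.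
Qed.

End MatchingFamily.

(** * Finite perturbations *)

Definition within (M : oagType) (e x : M) := - e <= x /\ x <= e.

Lemma within_bound (M : oagType) (e x : M) n : (0 < n)%N -> 0 <= e ->
  within e (x *+ n) -> within e x.
Proof.
move=> n0 e0 [h1 h2]; split; rewrite oleNgt; apply/negP => h.
  have x0 : 0 <= - x by apply: (ole2 (ltW h) e0); zmod.
  have h3 := ole_mulnr x0 n0; rewrite mulNrn in h3.
  by apply: (@oltF _ (0 : M)); apply: (olt3 h h1 h3); zmod.
have x0 : 0 <= x by apply: le_trans e0 (ltW h).
have h3 := ole_mulnr x0 n0.
by apply: (@oltF _ (0 : M)); apply: (olt3 h h2 h3); zmod.
Qed.

Lemma within_le (M : oagType) (e e' x : M) : e <= e' -> within e x -> within e' x.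
Proof.
move=> le [h1 h2]; split; last exact: le_trans h2 le.
by apply: (ole2 h1 le); zmod.
Qed.

Lemma teval_within V (t : term V) : exists C, forall (M : oagType) (c c' : V -> M) e,
  0 <= e -> (forall x, within e (c' x - c x)) ->
  within (e *+ C) (teval c' t - teval c t).
Proof.
elim: t => [x|||a [C h]|a [C h] b [C' h']].
- by exists 1%N => M c c' e _; apply.
- by exists 0%N => M c c' e _ _ /=; rewrite mulr0n subrr /within oppr0.
- by exists 0%N => M c c' e _ _ /=; rewrite mulr0n subrr /within oppr0.
- exists C => M c c' e e0 hc; have [h1 h2] := h M c c' e e0 hc; split=> /=.
    by apply: (ole1 h2); zmod.
  by apply: (ole1 h1); zmod.
exists (C + C')%N => M c c' e e0 hc.
have [h1 h2] := h M c c' e e0 hc; have [h3 h4] := h' M c c' e e0 hc.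
split=> /=; rewrite mulrnDr.
  by apply: (ole2 h1 h3); zmod.
by apply: (ole2 h2 h4); zmod.
Qed.

Lemma teval_dvdby V (M : oagType) (c c' : V -> M) N (t : term V) :
  (forall x, tocc x t -> dvdby N (c x - c' x)) -> dvdby N (teval c t - teval c' t).
Proof.
elim: t => /= [x h|_|_|a ih h|a iha b ihb h].
- exact: h.
- by rewrite subrr; apply: dvdby0.
- by rewrite subrr; apply: dvdby0.
- rewrite (_ : _ - _ = - (teval c a - teval c' a)); last by zmod.
  by apply: dvdbyN; apply: ih.
rewrite (_ : _ - _ = (teval c a - teval c' a) + (teval c b - teval c' b)).
  by apply: dvdbyD; [apply: iha|apply: ihb] => x hx; apply: h; [left|right].
by zmod.
Qed.

Definition tsplit V (j : V) (t : term V) : term (option V) :=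
  trename (fun i => if pselect (i = j) then None else Some i) t.

Lemma tsplitE V (j : V) (t : term V) (M : oagType) (c : V -> M) :
  teval c t = c j *~ tcoef (tsplit j t) + teval c (trest (tsplit j t)).
Proof.
rewrite -teval_coef teval_rename; congr teval; apply: funext => i /=.
by case: pselect => [ij|] //=; rewrite ij.
Qed.

Lemma tocc_trest V (t : term (option V)) i : tocc i (trest t) -> tocc (Some i) t.
Proof.
elim: t => //= [[y|] //= ->|a iha b ihb [/iha|/ihb]] //; by [left|right].
Qed.

Lemma tocc_tsplit V (j i : V) (t : term V) :
  tocc i (trest (tsplit j t)) -> tocc i t /\ i <> j.
Proof.
move=> h0; have [y hy] := tocc_rename (tocc_trest h0).
by case: pselect => // ne [<-].
Qed.

Lemma big_min (M : oagType) (etas : seq M) (d : M) :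
  big d -> (forall x, x \in etas -> big x) ->
  exists2 d', big d' & forall x, x \in etas -> d' <= x.
Proof.
move=> bd; elim: etas => [|x s ih] h; first by exists d.
have [y ys|d' bd' hd'] := ih; first by apply: h; rewrite inE ys orbT.
have bx : big x by apply: h; rewrite mem_head.
have /orP[le|le] := ole_total x d'.
  exists x => // y; rewrite inE => /orP[/eqP ->//|/hd']; exact: le_trans.
by exists d' => // y; rewrite inE => /orP[/eqP ->//|/hd'].
Qed.

Section FinitePerturbation.
Variables (G : oagType) (regG : regular G) (U : oagType) (GU : elem_equiv G U).
Variables (X : elemext U) (J : Type) (c : J -> X) (g : nat -> J -> X).
Local Notation emb := (@emb U X).
Let GX := emb_equiv X GU.
Definition inU (x : X) := exists u, x = emb u.

(** [g N j] is the residue wanted for c j modulo N. Such residues must be compatible and respect the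
    linear relations of c over U, or no perturbation keeping these relations could reach them. *)
Hypothesis coh : forall N N' j, (0 < N')%N -> (N %| N')%N -> dvdby N (g N' j - g N j).
Hypothesis rel : forall L (t : term J), (0 < L)%N -> inU (teval c t) ->
  dvdby L (teval c t - teval (g L) t).

Lemma inUB x y : inU x -> inU y -> inU (x - y).
Proof. by move=> [u ->] [u' ->]; exists (u - u'); rewrite embD embN. Qed.

Lemma inUMz x z : inU x -> inU (x *~ z).
Proof. by move=> [u ->]; exists (u *~ z); rewrite embMz. Qed.

Lemma inUMn x n : inU x -> inU (x *+ n).
Proof. by move=> [u ->]; exists (u *+ n); rewrite embMn. Qed.

Lemma inU_pure x n : (0 < n)%N -> inU (x *+ n) -> inU x.
Proof. by move=> n0 [u hu]; apply: emb_pure n0 hu. Qed.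

Lemma not_inU_big x : ~ inU x -> big x \/ big (- x).
Proof.
move=> nx; have nz z : x <> pres_one X *~ z.
  by move=> e; apply: nx; exists (pres_one U *~ z); rewrite embMz emb1.
case: (otrichotomy x 0) => h.
- right; apply: not_near_one => [z e|]; last by apply: (olt1 h); zmod.
  by apply: (nz (- z)); rewrite mulrNz -e opprK.
- by case: (nz 0); rewrite h mulr0z.
by left; apply: not_near_one.
Qed.

(** The data are thresholds, a factor, a modulus and a list of variables. Terms with value in U are
    kept exactly: minus that value they are 0, a sign that no move preserves. *)
Definition good (d : seq X * nat * nat * seq J) (c' : J -> X) := exists e,
  [/\ 0 <= e, forall x, x \in d.1.1.1 -> e *+ d.1.1.2 < x,
     forall j, within e (c' j - c j),
     forall j, List.In j d.2 -> dvdby d.1.2 (c' j - g d.1.2 j) &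
     forall t, (forall i, tocc i t -> List.In i d.2) -> inU (teval c t) ->
       teval c' t = teval c t].

Lemma goodW etas k N js etas' k' N' js' c' :
  (forall x, x \in etas -> x \in etas') -> (k <= k')%N -> (0 < N')%N -> (N %| N')%N ->
  (forall j, List.In j js -> List.In j js') ->
  good (etas', k', N', js') c' -> good (etas, k, N, js) c'.
Proof.
move=> se kk N0 NN sj [e /= [e0 he hc hN ht]]; exists e; split=> //=.
- move=> x /se/he; apply: le_lt_trans; exact: omuln_geS.
- move=> j /sj hj; rewrite (_ : _ - _ = (c' j - g N' j) + (g N' j - g N j)).
    by apply: dvdbyD; [apply: dvdbyW NN (hN j hj)|apply: coh].
  by zmod.
- by move=> t hvars; apply: ht => i /hvars/sj.
Qed.

(* Variables are treated one at a time.  A variable depending on the previous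
   ones modulo U moves along with them, which is why finer congruences are
   needed for those; an independent one is moved by a tiny amount. *)
Lemma good_exists etas k N js : (forall x, x \in etas -> big x) ->
  (0 < k)%N -> (0 < N)%N -> exists c', good (etas, k, N, js) c'.
Proof.
move=> betas; elim: js k N => [|j js ih] k N k0 N0.
  exists c, 0; split=> //= [x /betas/big_gt0|i]; first by rewrite mul0rn.
    by rewrite subrr /within oppr0.
have [jin|jnin] := pselect (List.In j js).
  have [c' hc'] := ih k N k0 N0; exists c'.
  by apply: goodW hc' => // i [<-|].
have [[s [M [M0 svars [u hu]]]]|indep] := pselect (exists s M,
    [/\ (0 < M)%N, forall i, tocc i s -> List.In i js &
       inU (c j *+ M - teval c s)]).
  have [C hC] := teval_within s.
  (* The move of c j is bounded by eC, so e (C + 1) bounds it together with the previous ones. *)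
  have kC : (0 < k * C.+1)%N by rewrite muln_gt0 k0.
  have MN : (0 < M * N)%N by rewrite muln_gt0 M0.
  have [c' [e /= [e0 he hc hN ht]]] := ih _ _ kC MN.
  pose L := (M * N)%N; pose y := teval c' s - teval c s.
  have [z hz] : dvdby L (y - (g L j - c j) *+ M).
    have h1 : dvdby L (teval c' s - teval (g L) s).
      by apply: teval_dvdby => i /svars/hN.
    have := rel (L := L) (t := TAdd (TMuln (TVar j) M) (TOpp s)) MN.
    rewrite /= !teval_muln /= => /(_ (ex_intro _ u hu)) h2.
    rewrite (_ : _ - _ = (teval c' s - teval (g L) s) +
       (c j *+ M - teval c s - (g L j *+ M - teval (g L) s))).
      exact: dvdbyD.
    by rewrite /y mulrnBl; zmod.
  (* This is y/M, written so that its residue modulo N shows: it takes c j to the class of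
     [g L j]. *)
  pose d := g L j - c j + z *+ N.
  have dM : d *+ M = y by rewrite mulrnDl -mulrnA [(N * M)%N]mulnC -hz; zmod.
  have wd : within (e *+ C) d.
    by apply: (within_bound M0) (omuln_ge0 _ e0) _; rewrite dM; apply: hC.
  pose c2 i := if pselect (i = j) then c j + d else c' i.
  have c2j : c2 j = c j + d by rewrite /c2; case: pselect.
  have c2i i : i <> j -> c2 i = c' i by rewrite /c2; case: pselect.
  exists c2, (e *+ C.+1); split=> /=.
  - exact: omuln_ge0.
  - by move=> x /he; rewrite -mulrnA mulnC.
  - move=> i; have [->|ne] := pselect (i = j).
      rewrite c2j (_ : _ - _ = d); last by zmod.
      by apply: within_le wd; apply: omuln_geS.
    by rewrite c2i //; apply: within_le (hc i); apply: ole_mulnr.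
  - move=> i [<-|hi].
      rewrite c2j (_ : _ - _ = z *+ N + (g L j - g N j)); last by rewrite /d; zmod.
      by apply: dvdbyD; [apply: dvdby_mul|apply: coh => //; rewrite dvdn_mull].
    rewrite c2i; last by move=> e1; apply: jnin; rewrite -e1.
    rewrite (_ : _ - _ = (c' i - g L i) + (g L i - g N i)); last by zmod.
    apply: dvdbyD; last by apply: coh => //; rewrite dvdn_mull.
    by apply: dvdbyW (hN i hi); rewrite dvdn_mull.
  move=> t tvars tU; apply: (omuln_inj M0) => /=.
  set m := tcoef (tsplit j t); set w := trest (tsplit j t).
  have wv i : tocc i w -> List.In i js /\ i <> j.
    by move=> hi; have [hi' ne] := tocc_tsplit hi; case: (tvars i hi') => [ji|//]; case: ne.
  have e2 : teval c2 w = teval c' w.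
    by apply: teval_occ => i /wv[_ /c2i].
  have : teval c' (TAdd (TMulz s m) (TMuln w M)) =
         teval c (TAdd (TMulz s m) (TMuln w M)).
    apply: ht => [i|].
      have tz (v : term J) (q : int) : tocc i (TMulz v q) -> tocc i v.
        have tn n : tocc i (TMuln v n) -> tocc i v.
          by elim: n => //= n ihn [].
        by case: q => n; [apply: tn|move=> /= h; apply: (tn n.+1)].
      by case=> [/tz/svars//|/(tz w (Posz M))/wv[]].
    rewrite /= teval_mulz teval_muln.
    have -> : teval c s *~ m + teval c w *+ M =
       teval c t *+ M - (c j *+ M - teval c s) *~ m.
      rewrite (tsplitE j t) -/m -/w mulrnDl mulrzBl !pmulrn -!mulrzA.
      by rewrite [m * _]mulrC; zmod.
    by apply: inUB; [apply: inUMn|apply: inUMz; exists u].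
  rewrite /= !teval_mulz !teval_muln => eq.
  rewrite !(tsplitE j t) -/m -/w e2 c2j !mulrnDl mulrzDl mulrnDl.
  have -> : d *~ m *+ M = teval c' s *~ m - teval c s *~ m.
    rewrite pmulrn -mulrzA mulrC mulrzA -pmulrn dM -mulrzBl //.
  set a1 := teval c' s *~ m in eq *; set a2 := teval c s *~ m in eq *.
  set b1 := teval c' w *+ M in eq *; set b2 := teval c w *+ M in eq *.
  rewrite (_ : _ + b1 = c j *~ m *+ M + (a1 + b1) - a2); last by zmod.
  by rewrite eq; zmod.
have bj : big (c j) \/ big (- c j).
  apply: not_inU_big => [[u hu]]; apply: indep; exists TZero, 1%N.
  by split=> //=; exists u; rewrite subr0.
have [d0 bd0] : exists d : X, big d by case: bj => h; [exists (c j)|exists (- c j)].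
have [d bd hd] := big_min bd0 betas.
(* The previous moves and the new one each get half of every threshold. *)
have kk : (0 < k * 2)%N by rewrite muln_gt0 k0.
have [c' [e /= [e0 he hc hN ht]]] := ih _ _ kk N0.
have [y [y0 yd yN]] := tiny_mul regG GX (g N j - c j) N0 kk bd.
pose c2 i := if pselect (i = j) then c j + y else c' i.
have c2j : c2 j = c j + y by rewrite /c2; case: pselect.
have c2i i : i <> j -> c2 i = c' i by rewrite /c2; case: pselect.
exists c2, (e + y); split=> /=.
- exact: oadd_ge0 e0 (ltW y0).
- move=> x xe; rewrite -(oltMn _ _ (isT : 0 < 2)%N) -mulrnA mulrnDl mulr2n.
  by apply: (olt3 (he x xe) (ltW yd) (hd x xe)); zmod.
- move=> i; have [->|ne] := pselect (i = j).
    rewrite c2j (_ : _ - _ = y); last by zmod.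
    split; first by apply: (ole3 e0 (ltW y0) (ltW y0)); zmod.
    by apply: (ole1 e0); zmod.
  rewrite c2i //; apply: within_le (hc i).
  by apply: (ole1 (ltW y0)); zmod.
- move=> i [<-|hi].
    by rewrite c2j (_ : _ - _ = y - (g N j - c j)) //; zmod.
  rewrite c2i; first exact: hN.
  by move=> e1; apply: jnin; rewrite -e1.
move=> t tvars tU.
set m := tcoef (tsplit j t); set w := trest (tsplit j t).
have wv i : tocc i w -> List.In i js /\ i <> j.
  by move=> hi; have [hi' ne] := tocc_tsplit hi; case: (tvars i hi') => [ji|//]; case: ne.
have e2 : teval c2 w = teval c' w.
  by apply: teval_occ => i /wv[_ /c2i].
have et : teval c t = c j *~ m + teval c w by apply: tsplitE.
(* A term with value in U cannot involve the independent variable. *)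
have m0 : m = 0.
  case: (m) et => [[|n]|n] // et; exfalso; apply: indep.
    exists (TOpp w), n.+1; split=> //= [i /wv[] //|].
    by move: tU; rewrite et -pmulrn opprK.
  exists w, n.+1; split=> // [i /wv[] //|].
  rewrite (_ : _ - _ = 0 - teval c t); last by rewrite et NegzE mulrNz -pmulrn; zmod.
  by apply: inUB => //; exists 0; rewrite emb0.
rewrite (tsplitE j t) -/m -/w m0 mulr0z add0r e2 et m0 mulr0z add0r.
apply: ht => [i /wv[] //|]; by move: tU; rewrite et m0 mulr0z add0r.
Qed.

Lemma good_combine n (d : 'I_n -> seq X * nat * nat * seq J) :
  (forall k, [/\ forall x, x \in (d k).1.1.1 -> big x, (0 < (d k).1.1.2)%N &
    (0 < (d k).1.2)%N]) -> exists c', forall k, good (d k) c'.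
Proof.
move=> hd.
suff [etas [k [N [js [h1 h2 h3 h4]]]]] : exists etas k N js,
    [/\ forall x, x \in etas -> big x, (0 < k)%N, (0 < N)%N &
      forall c', good (etas, k, N, js) c' -> forall i, good (d i) c'].
  by have [c' hc'] := good_exists js h1 h2 h3; exists c'; apply: h4.
elim: n d hd => [|n ih] d hd.
  by exists [::], 1%N, 1%N, [::]; split=> // c' _ [].
have [etas [k [N [js [h1 h2 h3 h4]]]]] := ih (fun i => d (lift ord0 i)) (fun i => hd _).
case E : (d ord0) (hd ord0) => [[[etas0 k0] N0] js0] /= [g1 g2 g3].
exists (etas0 ++ etas), (k0 + k)%N, (N0 * N)%N, (js0 ++ js).
rewrite addn_gt0 g2 muln_gt0 g3 h3; split=> //.
  by move=> x; rewrite mem_cat => /orP[/g1|/h1].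
move=> c' hc' i; case: (unliftP ord0 i) => [i' ->|->].
  apply: h4; apply: goodW hc'.
  - by move=> x xs; rewrite mem_cat xs orbT.
  - by rewrite leq_addl.
  - by rewrite muln_gt0 g3.
  - by rewrite dvdn_mull.
  - by move=> j hj; apply/List.in_app_iff; right.
rewrite E; apply: goodW hc'.
- by move=> x xs; rewrite mem_cat xs.
- by rewrite leq_addr.
- by rewrite muln_gt0 g3.
- by rewrite dvdn_mulr.
- by move=> j hj; apply/List.in_app_iff; left.
Qed.

End FinitePerturbation.

(** * The inequalities imply domination *)

Local Notation elt A h := (@exist _ (fun z => z \in A) _ (mem_set h)).

(** One rewritten term serves all models, as it is evaluated at b, at a copy of b in U, and at other
    realizations of p. *)
Lemma terms_over_small K (slK : strong_limit K) (U : oagType) T I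
    (F : T -> term (I + U)) : small K [set: T] ->
  exists2 P : set U, small K P & forall A : set U, P `<=` A -> forall t,
    exists a : term (I + A), forall (M : oagType) (d : I -> M) (e : U -> M),
      teval (sjoin d e) (F t) = teval (sjoin d (fun a : A => e (val a))) a.
Proof.
move=> sT.
have /choice[f hf] t : exists x : seq U * term (I + nat),
    F t = trename (sjoin inl (fun n => inr (nth 0 x.1 n))) x.2.
  by have [l [t' e]] := params_list (F t) 0; exists (l, t').
pose h (x : T * nat) := nth 0 (f x.1).1 x.2.
exists (range h).
  by apply: small_range; apply: (small_prod slK) => //; apply: (small_nat slK).
move=> A PA t.
have hA n : A (h (t, n)) by apply: PA; exists (t, n).
exists (trename (sjoin inl (fun n => inr (elt A (hA n)))) (f t).2).
move=> M d e; rewrite hf !teval_rename; congr teval; apply: funext => -[i|n] //=.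
Qed.

Lemma teval_split W J (t : term (J + W)) : exists (s : term J) (a : term W),
  forall (M : oagType) (d : J -> M) (e : W -> M),
    teval (sjoin d e) t = teval d s + teval e a.
Proof.
elim: t => [[j|w]|||t [s [a h]]|t [s [a h]] t' [s' [a' h']]].
- by exists (TVar j), TZero => M d e /=; rewrite addr0.
- by exists TZero, (TVar w) => M d e /=; rewrite add0r.
- by exists TZero, TZero => M d e /=; rewrite addr0.
- by exists TZero, TOne => M d e /=; rewrite add0r.
- by exists (TOpp s), (TOpp a) => M d e /=; rewrite h opprD.
- by exists (TAdd s s'), (TAdd a a') => M d e /=; rewrite h h'; zmod.
Qed.

Lemma fills_cut (U : oagType) (X : elemext U) (H : set U) (x : X) u :
  fills H x -> (@emb U X u < x <-> ~ above H u) /\ (x < @emb U X u <-> above H u).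
Proof.
move=> [f1 f2].
have na : ~ above H u -> emb X u < x.
  move=> /existsNP[h /not_implyP[Hh /negP]]; rewrite -oleNgt => uh.
  by apply: le_lt_trans (f1 h Hh); rewrite emb_le.
split; split.
- by move=> h /f2 h'; have := lt_trans h h'; rewrite ltxx.
- exact: na.
- by move=> h; apply: contrapT => /na h'; have := lt_trans h h'; rewrite ltxx.
- exact: f2.
Qed.

Section Backward.
Variables (G : oagType) (regG : regular G) (K : Type) (slK : strong_limit K).
Variables (U : oagType) (GU : elem_equiv G U) (satU : saturated K U).
Variables (I J : Type) (p : ftype I U) (q : ftype J U).
Hypotheses (sI : small K [set: I]) (sJ : small K [set: J]).
Hypotheses (gp : global_type p) (gq : global_type q).
Variables (A1 : set U) (sA1 : small K A1).
Hypothesis inv : forall (n : nat) (d d' : 'I_n -> U), equiv_over A1 d d' ->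
      forall phi : formula (J + 'I_n), q (inst d phi) <-> q (inst d' phi).
Hypothesis hH : Hset q `<=` Hset p.
Hypothesis hk : forall l, prime l -> kappa_le l q p.
Variables (X : elemext U) (c : J -> X) (rc : realizes (@emb U X) c q).
Variables (Y : elemext U) (b : I -> Y) (rb : realizes (@emb U Y) b p).
Local Notation embx := (@emb U X).
Local Notation emby := (@emb U Y).
Local Notation evb := (teval (sjoin b emby)).
Let GX := emb_equiv X GU.

(** Some y(b) fills the convex subgroup attached to the cut of k t'(c), and w is a + y or a - y
    according to the side of a. *)
Lemma matched_cut : exists Z : set U, small K Z /\
  forall t : term J, ~ inU (teval c t) ->
  exists (t' : term J) k (w : term (I + U)), [/\ t' = t \/ t' = TOpp t, (0 < k)%N,
    forall u, embx u < teval c t' *+ k ->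
      exists z, [/\ Z z, u <= z & embx z < teval c t' *+ k] &
    forall u, (embx u < teval c t' *+ k <-> emby u < evb w) /\
       (teval c t' *+ k < embx u <-> evb w < emby u)].
Proof.
have [Z [sZ hZ]] := cut_set regG slK GU satU gq sA1 inv rc.
exists Z; split=> // t nt.
have [|t' [k [a [H [tt k0 cH cof hf]]]]] := hZ t.
  by move=> u e; apply: nt; exists u.
have cH' : Hset q H.
  apply/(HsetP _ gq rc); split=> //.
  pose s : term (J + U) := TAdd (TMuln (trename inl t') k) (TOpp (TVar (inr a))).
  have es : teval (sjoin c embx) s = teval c t' *+ k - embx a.
    by rewrite /= teval_muln teval_rename.
  case: hf => hf; first by exists s; rewrite es.
  exists (TOpp s).
  by have -> : teval (sjoin c embx) (TOpp s) = embx a - teval c t' *+ k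
    by rewrite -opprB -es.
have /hH/(HsetP _ gp rb)[_ [y fy]] := cH'.
case: hf => hf.
  exists t', k, (TAdd (TVar (inr a)) y); split=> // u.
  have [h1 h2] := fills_cut (u - a) hf; have [h3 h4] := fills_cut (u - a) fy.
  split.
    have -> : (embx u < teval c t' *+ k) =
        (embx (u - a) < teval c t' *+ k - embx a).
      by apply/idP/idP => h; apply: (olt1 h); rewrite embD embN; zmod.
    have -> : (emby u < evb (TAdd (TVar (inr a)) y)) =
        (emby (u - a) < evb y).
      by apply/idP/idP => /= h; apply: (olt1 h); rewrite embD embN; zmod.
    by rewrite h1 h3.
  have -> : (teval c t' *+ k < embx u) =
        (teval c t' *+ k - embx a < embx (u - a)).
    by apply/idP/idP => h; apply: (olt1 h); rewrite embD embN; zmod.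
  have -> : (evb (TAdd (TVar (inr a)) y) < emby u) =
        (evb y < emby (u - a)).
    by apply/idP/idP => /= h; apply: (olt1 h); rewrite embD embN; zmod.
  by rewrite h2 h4.
exists t', k, (TAdd (TVar (inr a)) (TOpp y)); split=> // u.
have [h1 h2] := fills_cut (a - u) hf; have [h3 h4] := fills_cut (a - u) fy.
split.
  have -> : (embx u < teval c t' *+ k) =
        (embx a - teval c t' *+ k < embx (a - u)).
    by apply/idP/idP => h; apply: (olt1 h); rewrite embD embN; zmod.
  have -> : (emby u < evb (TAdd (TVar (inr a)) (TOpp y))) =
        (evb y < emby (a - u)).
    by apply/idP/idP => /= h; apply: (olt1 h); rewrite embD embN; zmod.
  by rewrite h2 h4.
have -> : (teval c t' *+ k < embx u) =
        (embx (a - u) < embx a - teval c t' *+ k).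
  by apply/idP/idP => h; apply: (olt1 h); rewrite embD embN; zmod.
have -> : (evb (TAdd (TVar (inr a)) (TOpp y)) < emby u) =
        (emby (a - u) < evb y).
  by apply/idP/idP => /= h; apply: (olt1 h); rewrite embD embN; zmod.
by rewrite h1 h3.
Qed.

Lemma backward : dominates K p q.
Proof.
have [Z [sZ hZ]] := matched_cut.
have [R [r1 [r2 [r3 [r4 [r5 r7]]]]]] := matching_family regG GU gp gq rc rb hk.
have sT : small K [set: term J] by apply: (small_term slK).
(* Values of terms at c that lie in U become parameters, so that q restricted to [A] fixes them. *)
have /choice[us hus] (t : term J) : exists u, inU (teval c t) -> teval c t = embx u.
  by have [[u hu]|nu] := pselect (inU (teval c t)); [exists u|exists 0].
have /choice[cut hcut] (t : term J) : exists x : term J * nat * term (I + U),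
    ~ inU (teval c t) -> [/\ x.1.1 = t \/ x.1.1 = TOpp t, (0 < x.1.2)%N,
    forall u, embx u < teval c x.1.1 *+ x.1.2 ->
      exists z, [/\ Z z, u <= z & embx z < teval c x.1.1 *+ x.1.2] &
    forall u, (embx u < teval c x.1.1 *+ x.1.2 <-> emby u < evb x.2) /\
       (teval c x.1.1 *+ x.1.2 < embx u <-> evb x.2 < emby u)].
  have [i|ni] := pselect (inU (teval c t)); first by exists (t, 0%N, TZero).
  by have [t' [k [w hw]]] := hZ t ni; exists (t', k, w).
(* For a term t and a modulus N this is (n, a, g), where the partner g of t(c) is the fraction a/n
   over b. *)
have /choice[res hres] (x : term J * nat) : exists y : nat * term (I + U) * Y,
    (0 < x.2)%N -> [/\ (0 < y.1.1)%N, y.2 *+ y.1.1 = evb y.1.2 &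
      R x.2 (teval c x.1) y.2].
  have [x0|nx] := pselect (0 < x.2)%N; last by exists (0%N, TZero, 0).
  have [g hg] := r3 x.2 (trename inl x.1) x0; rewrite teval_rename in hg.
  have [n [a [n0 ha]]] := r5 _ _ _ hg.
  by exists (n, a, g).
have [P1 sP1 hP1] := terms_over_small slK (fun t => (cut t).2) sT.
have [P2 sP2 hP2] := terms_over_small slK (fun x => (res x).1.2)
  (small_prod slK sT (small_nat slK)).
pose A := (Z `|` range us) `|` (P1 `|` P2).
have sA : small K A.
  apply: (small_setU slK); apply: (small_setU slK) => //.
  exact: small_range.
have ZA : Z `<=` A by move=> z; left; left.
have usA t : A (us t) by left; right; exists t.
have /choice[w hw] t := hP1 A (fun x h => or_intror (or_introl h)) t.
have /choice[ro hro] x := hP2 A (fun x h => or_intror (or_intror h)) x.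
pose aus t : A := elt A (usA t).
pose g t N := (res (t, N)).2; pose n_ t N := (res (t, N)).1.1.
have gP t N : (0 < N)%N -> [/\ (0 < n_ t N)%N,
    g t N *+ n_ t N = teval (sjoin b (over emby A)) (ro (t, N)) &
    R N (teval c t) (g t N)].
  by move=> N0; have [h1 h2 h3] := hres (t, N) N0; rewrite -hro.
(* Only upper bounds k t' < w are imposed: the lower side of the cut is decided by elements of [Z],
   hence by q restricted to [A]. The congruences carry the factor n because the partner of t is a
   fraction a/n. *)
pose S : set (formula ((I + J) + A)) := [set phi |
  [\/ exists2 psi, restr A p psi & phi = frename (sjoin (fun i => inl (inl i)) inr) psi,
      exists2 psi, restr A q psi & phi = frename (sjoin (fun j => inl (inr j)) inr) psi,
      exists2 t, ~ inU (teval c t) &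
        phi = FLt (TMuln (trename (inl \o inr) (cut t).1.1) (cut t).1.2)
                  (trename (sjoin (fun i => inl (inl i)) inr) (w t)) |
      exists t N, (0 < N)%N /\
        phi = FCong (n_ t N * N) (TMuln (trename (inl \o inr) t) (n_ t N))
                  (trename (sjoin (fun i => inl (inl i)) inr) (ro (t, N)))]].
have jl (T : Type) (d : I -> T) (d' : J -> T) (e : A -> T) :
    sjoin (sjoin d d') e \o sjoin (fun i => inl (inl i)) inr = sjoin d e.
  by apply: funext => -[].
have jr (T : Type) (d : I -> T) (d' : J -> T) (e : A -> T) :
    sjoin (sjoin d d') e \o sjoin (fun i => inl (inr i)) inr = sjoin d' e.
  by apply: funext => -[].
have jj (T : Type) (d : I -> T) (d' : J -> T) (e : A -> T) :
    sjoin (sjoin d d') e \o (inl \o inr) = d'.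
  by [].
have hinst (V : elemext U) T (d : T -> V) phi :
    holds (sjoin d (@emb U V)) (inst (vals A) phi) <->
    holds (sjoin d (over (@emb U V) A)) phi.
  rewrite holds_rename; have -> : sjoin d (@emb U V) \o
    sjoin inl (fun w0 : A => inr (val w0)) = sjoin d (over (@emb U V) A).
    by apply: funext => -[].
  by [].
have fS : finsat (vals A) S.
  move=> m phi hphi.
  have eA : elem_eq (over emby A) (vals A).
    by apply: elem_eq_sym; apply: (emb_elem' Y (vals A)).
  (* A copy of b in U over [A], so that only the second tuple has to be perturbed. *)
  have [bh hbh] := realize_tuple slK satU b sI (small_type sA) eA.
  pose link (y : Y) (u : U) := exists n (a : term (I + A)), [/\ (0 < n)%N,
    y *+ n = teval (sjoin b (over emby A)) a &
    u *+ n = teval (sjoin bh (vals A)) a].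
  have linkB y u y' u' : link y u -> link y' u' -> link (y - y') (u - u').
    move=> [n [a [n0 ea eu]]] [n' [a' [n0' ea' eu']]].
    exists (n * n')%N, (TAdd (TMuln a n') (TOpp (TMuln a' n))).
    rewrite muln_gt0 n0 n0' /= !teval_muln -ea -ea' -eu -eu' -!mulrnA.
    by rewrite !mulrnBl [(n' * n)%N]mulnC.
  have link_emb (a : A) : link (emby (val a)) (val a).
    by exists 1%N, (TVar (inr a)).
  have link0 : link 0 0 by exists 1%N, TZero.
  have linkN y u : link y u -> link (- y) (- u).
    by move=> h; rewrite -(sub0r y) -(sub0r u); apply: linkB.
  have linkD y u y' u' : link y u -> link y' u' -> link (y + y') (u + u').
    by move=> h /linkN h'; rewrite -(opprK y') -(opprK u'); apply: linkB.
  have link1 : link (pres_one Y) (pres_one U) by exists 1%N, TOne.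
  have link_dvd N y u : link y u -> dvdby N y <-> dvdby N u.
    move=> [n [a [n0 ea eu]]].
    rewrite -(dvdbyM N y n0) -(dvdbyM N u n0) ea eu.
    by have := hbh (FCong (N * n) a TZero); rewrite /= !subr0.
  have /choice[gh hgh] (x : term J * nat) : exists u, (0 < x.2)%N ->
      link (g x.1 x.2) u /\
      u *+ n_ x.1 x.2 = teval (sjoin bh (vals A)) (ro x).
    have [x0|nx] := pselect (0 < x.2)%N; last by exists 0.
    have [n0 eg _] := gP x.1 x.2 x0.
    have := hbh (FCong (n_ x.1 x.2) (ro x) TZero); rewrite /= !subr0.
    case: x x0 n0 eg => t N /= N0 n0 eg => -[h _].
    have [|u hu] := h; first by exists (g t N).
    by exists u => _; split=> //; exists (n_ t N), (ro (t, N)).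
  (* The residues wanted for c: those of the partners, moved into U along [link]. *)
  pose Gam N j := embx (gh (TVar j, N)).
  have Reval N t : (0 < N)%N ->
      R N (teval c t) (teval (fun j => g (TVar j) N) t).
    move=> N0; have R0 : R N 0 0.
      by rewrite -(emb0 X) -(emb0 Y); apply: r2.
    have RN x y : R N x y -> R N (- x) (- y).
      by move=> h; rewrite -(sub0r x) -(sub0r y); apply: r1.
    have RD x y x' y' : R N x y -> R N x' y' -> R N (x + x') (y + y').
      by move=> h /RN h'; rewrite -(opprK x') -(opprK y'); apply: r1.
    elim: t => /= [j|||t h|t h t' h'].
    - by have [_ _] := gP (TVar j) N N0.
    - exact: R0.
    - by rewrite -(emb1 X) -(emb1 Y); apply: r2.
    - exact: RN.
    - exact: RD.
  have leval N t : (0 < N)%N -> link (teval (fun j => g (TVar j) N) t)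
      (teval (fun j => gh (TVar j, N)) t).
    move=> N0; elim: t => /= [j|||t h|t h t' h'].
    - by case: (hgh (TVar j, N) N0).
    - exact: link0.
    - exact: link1.
    - exact: linkN.
    - exact: linkD.
  (* Two partners of one x differ by a multiple of N, so their copies in U have a well-defined
     class. *)
  have key N x y y' u u' : (0 < N)%N -> R N x y -> R N x y' -> link y u ->
      link y' u' -> dvdby N (u - u').
    move=> N0 h h' l l'; apply/(link_dvd N _ _ (linkB _ _ _ _ l l')).
    apply/(r4 N (x - x) _ N0 (r1 _ _ _ _ _ h h')).
    by rewrite subrr; apply: dvdby0.
  have coh N N' j : (0 < N')%N -> (N %| N')%N -> dvdby N (Gam N' j - Gam N j).
    move=> N0' NN; have N0 : (0 < N)%N by apply: dvdn_gt0 NN.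
    rewrite /Gam -embN -embD emb_dvdby.
    apply: (key N (c j) (g (TVar j) N') (g (TVar j) N)) => //.
    - by apply: r7 NN _; have [_ _] := gP (TVar j) N' N0'.
    - by have [_ _] := gP (TVar j) N N0.
    - by case: (hgh (TVar j, N') N0').
    - by case: (hgh (TVar j, N) N0).
  have evG N t : teval (Gam N) t = embx (teval (fun j => gh (TVar j, N)) t).
    exact: emb_teval.
  have rel L t : (0 < L)%N -> inU (teval c t) ->
      dvdby L (teval c t - teval (Gam L) t).
    move=> L0 ht; rewrite evG (hus t ht) -embN -embD emb_dvdby.
    apply: (key L (embx (us t)) (emby (us t)) (teval (fun j => g (TVar j) L) t)) => //.
    - by rewrite -(hus t ht); apply: Reval.
    - exact: (link_emb (aus t)).
    - exact: leval.
  have hcongA t (al : term A) N : (0 < N)%N ->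
      dvdby N (teval c t + embx (teval (vals A) al)) <->
      dvdby N (teval (Gam N) t + embx (teval (vals A) al)).
    move=> N0; set u := teval _ al.
    have lu : link (emby u) u.
      exists 1%N, (trename inr al); rewrite !mulr1n !teval_rename; split=> //.
      by rewrite -emb_teval.
    rewrite evG -embD emb_dvdby.
    rewrite -(link_dvd N _ _ (linkD _ _ _ _ (leval N t N0) lu)).
    apply: r4 => //; have := r1 _ _ _ _ _ (Reval N t N0) (r2 N (- u)).
    by rewrite !embN !opprK.
  (* Truth at all sufficiently fine perturbations of c; [good_combine] gives a common one for
     finitely many formulas. *)
  pose ok (phi : formula ((I + J) + A)) := exists d : seq X * nat * nat * seq J,
    [/\ forall x, x \in d.1.1.1 -> big x, (0 < d.1.1.2)%N, (0 < d.1.2)%N &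
     forall c', good c Gam d c' ->
       holds (sjoin (sjoin (fun i => embx (bh i)) c') (over embx A)) phi].
  have hbX psi : holds (sjoin b (over emby A)) psi ->
      holds (sjoin (fun i => embx (bh i)) (over embx A)) psi.
    move=> /hbh /(emb_elem' X).
    have -> // : embx \o sjoin bh (vals A) =
       sjoin (fun i => embx (bh i)) (over embx A).
    by apply: funext => -[].
  have tbX t : teval (sjoin (fun i => embx (bh i)) (over embx A)) t =
      embx (teval (sjoin bh (vals A)) t).
    by rewrite -emb_teval; congr teval; apply: funext => -[].
  have okS psi : S psi -> ok psi.
    case=> [[chi hchi ->]|[chi hchi ->]|[t nt ->]|[t [N [N0 ->]]]].
    - exists ([::], 1%N, 1%N, [::]); split=> // c' _.
      rewrite holds_rename jl; apply: hbX.
      by apply/hinst; apply: rb.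
    - have [T [N [N0 hT]]] := qe_agree regG chi.
      have atom t : exists etas k js, [/\ forall x, x \in etas -> big x, (0 < k)%N &
          forall c', good c Gam (etas, k, N, js) c' ->
          agree N (teval (sjoin c (over embx A)) t)
            (teval (sjoin c' (over embx A)) t)].
        have [s [al hs]] := teval_split t; have [C hC] := teval_within s.
        have [js hjs] := tocc_fin s.
        set u := teval (vals A) al.
        have eu : teval (over embx A) al = embx u by apply: emb_teval.
        have dv c' etas k : good c Gam (etas, k, N, js) c' ->
            dvdby N (teval c s + embx u) <-> dvdby N (teval c' s + embx u).
          move=> [e [_ _ _ /= hN _]]; rewrite hcongA //.
          apply: iff_sym; apply: dvdby_congr.
          rewrite (_ : _ - _ = teval c' s - teval (Gam N) s); last by zmod.
          by apply: teval_dvdby => i /hjs/hN.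
        have [i|ni] := pselect (inU (teval c s)).
          exists [::], 1%N, js; split=> // c' gc'.
          rewrite !hs !eu; have := dv _ _ _ gc'; case: gc' => e [_ _ _ _ /= ht].
          by rewrite (ht s hjs i).
        pose y := teval c s + embx u.
        have ny : ~ inU y.
          move=> hy; apply: ni; rewrite (_ : teval c s = y - embx u).
            by apply: inUB => //; exists u.
          by rewrite /y; zmod.
        have [eta beta heta] : exists2 eta, big eta & eta = y \/ eta = - y.
          by case: (not_inU_big ny) => h; [exists y|exists (- y)] => //; [left|right].
        exists [:: eta], C.+1, js; split=> // [x|c' gc'].
          by rewrite inE => /eqP ->.
        rewrite !hs !eu -/y; have dvc := dv _ _ _ gc'.
        case: gc' => e [/= e0 he hc _ _].
        have eC : e *+ C < eta.
          apply: le_lt_trans (he eta (mem_head _ _)).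
          exact: omuln_geS.
        have [w1 w2] := hC X c c' e e0 hc.
        case: heta => ey; rewrite ey in eC beta.
          have y0 := big_gt0 beta.
          have y0' : 0 < teval c' s + embx u.
            by apply: (olt2 eC w1); rewrite /y; zmod.
          by split; rewrite // ?y0 ?y0' ?(lt_gtF y0) ?(lt_gtF y0').
        have y0 : y < 0 by apply: (olt1 (big_gt0 beta)); zmod.
        have y0' : teval c' s + embx u < 0.
          by apply: (olt2 eC w2); rewrite /y; zmod.
        by split; rewrite // ?y0 ?y0' ?(lt_gtF y0) ?(lt_gtF y0').
      have [etas [k [js [h1 h2 h3]]]] : exists etas k js,
          [/\ forall x, x \in etas -> big x, (0 < k)%N &
          forall c', good c Gam (etas, k, N, js) c' -> forall t, List.In t T ->
          agree N (teval (sjoin c (over embx A)) t)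
            (teval (sjoin c' (over embx A)) t)].
        elim: (T) => [|t T' [etas [k [js [h1 h2 h3]]]]].
          by exists [::], 1%N, [::]; split=> // c' _ t [].
        have [etas' [k' [js' [h1' h2' h3']]]] := atom t.
        exists (etas ++ etas'), (k + k')%N, (js ++ js'); rewrite addn_gt0 h2.
        split=> // [x|c' gc' t0 [<-|ht0]].
        + by rewrite mem_cat => /orP[/h1|/h1'].
        + apply: h3'; apply: (goodW coh) gc' => //.
          * by move=> x hx; rewrite mem_cat hx orbT.
          * by rewrite leq_addl.
          * by move=> j hj; apply/List.in_app_iff; right.
        apply: h3 => //; apply: (goodW coh) gc' => //.
        * by move=> x hx; rewrite mem_cat hx.
        * by rewrite leq_addr.
        * by move=> j hj; apply/List.in_app_iff; left.
      exists (etas, k, N, js); split=> // c' gc'.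
      rewrite holds_rename jr.
      have [+ _] := hT X X GX GX _ _ (h3 c' gc'); apply.
      by apply/hinst; apply: rc.
    - have [ht' k0 cof hc] := hcut t nt.
      set t' := (cut t).1.1 in ht' cof hc *; set k := (cut t).1.2 in k0 cof hc *.
      pose wh := teval (sjoin bh (vals A)) (w t).
      have nt' : ~ inU (teval c t' *+ k).
        move=> /(inU_pure k0) h; apply: nt; case: ht' => e'; rewrite e' // in h.
        rewrite (_ : teval c t = 0 - teval c (TOpp t)); last by rewrite /=; zmod.
        by apply: inUB => //; exists 0; rewrite emb0.
      (* Were [wh] below k t'(c), some z of [Z] with z at least [wh] would be below k t'(c) too.
         Then z < w(b), which passes to z < [wh]. *)
      have lt : teval c t' *+ k < embx wh.
        case: (otrichotomy (teval c t' *+ k) (embx wh)) => // [e|h].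
          by case: nt'; exists wh.
        have [z [Zz uz hz]] := cof _ h.
        have := hbh (FLt (TVar (inr (elt A (ZA z Zz)))) (w t)).
        rewrite /= -hw => -[+ _]; rewrite -(hc z).1 => /(_ hz).
        by rewrite -/wh oltNge uz.
      have [C hC] := teval_within (TMuln t' k).
      exists ([:: embx wh - teval c t' *+ k], C.+1, 1%N, [::]); split=> // [x|c' gc'].
        rewrite inE => /eqP -> /=; have d0 : 0 < embx wh - teval c t' *+ k.
          by apply: (olt1 lt); zmod.
        apply: not_near_one => // z e; apply: nt'.
        exists (wh - pres_one U *~ z); rewrite embD embN embMz emb1 -e; zmod.
      case: gc' => e [/= e0 he hc' _ _].
      have [_ w2] := hC X c c' e e0 hc'.
      rewrite !teval_muln in w2 *; rewrite !teval_rename jj jl tbX -/wh.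
      have eC : e *+ C < embx wh - teval c t' *+ k.
        apply: le_lt_trans (he _ (mem_head _ _)).
        exact: omuln_geS.
      by apply: (olt2 eC w2); zmod.
    have [js hjs] := tocc_fin t.
    exists ([::], 1%N, N, js); split=> // c' [e [_ _ _ /= hN _]].
    have [n0 eg hg] := gP t N N0.
    rewrite teval_muln !teval_rename jj jl tbX.
    have [lg <-] := hgh (t, N) N0; rewrite /= embMn -mulrnBl mulnC.
    suff : dvdby (N * n_ t N) ((teval c' t - embx (gh (t, N))) *+ n_ t N) by [].
    apply/(dvdbyM _ _ n0).
    rewrite (_ : _ - _ = (teval c' t - teval (Gam N) t) +
       (teval (Gam N) t - embx (gh (t, N)))); last by zmod.
    apply: dvdbyD; first by apply: teval_dvdby => i /hjs/hN.
    rewrite evG -embN -embD emb_dvdby.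
    apply: (key N (teval c t) (teval (fun j => g (TVar j) N) t) (g t N)) => //.
    - exact: Reval.
    - exact: leval.
  have /choice[d hd] k : exists d : seq X * nat * nat * seq J,
    [/\ forall x, x \in d.1.1.1 -> big x, (0 < d.1.1.2)%N, (0 < d.1.2)%N &
     forall c', good c Gam d c' ->
       holds (sjoin (sjoin (fun i => embx (bh i)) c') (over embx A)) (phi k)].
    exact: okS (hphi k).
  have [|c' hc'] := good_combine regG GU coh rel (d := d).
    by move=> k; have [h1 h2 h3 _] := hd k; split.
  have [l hl] := all_conj phi.
  have [chi hchi] := exists_closure (FConj l).
  have : holds (over embx A) chi.
    apply/hchi; exists (sjoin (fun i => embx (bh i)) c'); apply/holds_conj => a /hl[k ->].
    by have [_ _ _ h] := hd k; apply: h.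
  move=> /(emb_elem' X (vals A))/hchi[c0 /holds_conj hc0].
  by exists c0 => k; apply: hc0; apply/hl; exists k.
have [r cr Sr] := finsat_complete fS.
exists A => //; exists r; split=> //.
- by move=> phi hphi; apply: Sr; constructor 1; exists phi.
- by move=> phi hphi; apply: Sr; constructor 2; exists phi.
move=> V b2 c2 rb2 rbc2.
have embV := @emb U V.
have hq phi : holds (sjoin c (over embx A)) phi ->
    holds (sjoin c2 (over (@emb U V) A)) phi.
  move=> h; have : restr A q phi by apply/(realizes_iff gq rc); apply/hinst.
  move=> hr; have := rbc2 _ (Sr _ (Or42 _ _ _ (ex_intro2 _ _ phi hr erefl))).
  by rewrite holds_rename jr.
have hu t : inU (teval c t) -> teval c2 t = @emb U V (us t).
  move=> ht; have := hq (FEq (trename inl t) (TVar (inr (aus t)))).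
  by rewrite /= !teval_rename; apply; apply: hus.
have hp phi : holds (sjoin b emby) phi -> holds (sjoin b2 (@emb U V)) phi.
  by move=> /(realizes_iff gp rb) /rb2.
have hp' phi : holds (sjoin b emby) phi <-> holds (sjoin b2 (@emb U V)) phi.
  by rewrite !(realizes_iff gp).
(* For t' the lower bounds come from [Z] through q restricted to [A], and the upper ones from k t' <
   w and the type of b; for t' = -t they are exchanged. *)
have hcutV t : ~ inU (teval c t) -> forall u,
    (embx u < teval c t -> @emb U V u < teval c2 t) /\
    (teval c t < embx u -> teval c2 t < @emb U V u).
  move=> nt; have [ht' k0 cof hc] := hcut t nt.
  set t' := (cut t).1.1 in ht' cof hc; set k := (cut t).1.2 in k0 cof hc.
  have lt2 : teval c2 t' *+ k < teval (sjoin b2 (@emb U V)) (cut t).2.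
    have := rbc2 _ (Sr _ (Or43 _ _ _ (ex_intro2 _ _ t nt erefl))).
    by rewrite /= teval_muln !teval_rename jj jl hw.
  have lo u : embx u < teval c t' -> @emb U V u < teval c2 t'.
    move=> h; have h' : embx (u *+ k) < teval c t' *+ k.
      by rewrite embMn oltMn.
    have [z [Zz uz hz]] := cof _ h'.
    have := hq (FLt (TVar (inr (elt A (ZA z Zz))))
      (TMuln (trename inl t') k)).
    rewrite /= !teval_muln !teval_rename => /(_ hz) h2.
    rewrite -(oltMn _ _ k0) -embMn; apply: le_lt_trans h2.
    by rewrite emb_le.
  have hi u : teval c t' < embx u -> teval c2 t' < @emb U V u.
    move=> h; have h' : teval c t' *+ k < embx (u *+ k).
      by rewrite embMn oltMn.
    rewrite -(oltMn _ _ k0) -embMn; apply: lt_trans lt2 _.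
    have /(hc _).2 := h'.
    exact: (hp (FLt (cut t).2 (TVar (inr (u *+ k))))).
  case: ht' => et' u; rewrite et' in lo hi; first by split; [exact: lo|exact: hi].
  split=> h.
    have := hi (- u); rewrite /= embN embN => hh.
    have {}hh : - teval c2 t < - @emb U V u by apply: hh; apply: (olt1 h); zmod.
    by apply: (olt1 hh); zmod.
  have := lo (- u); rewrite /= embN embN => hh.
  have {}hh : - @emb U V u < - teval c2 t by apply: hh; apply: (olt1 h); zmod.
  by apply: (olt1 hh); zmod.
(* t(c) has the residue of its partner a/n, and r makes n t(y) congruent modulo nN to a evaluated at
   the new realization of p. *)
have hcong t N u : (0 < N)%N ->
    dvdby N (teval c t + embx u) <-> dvdby N (teval c2 t + @emb U V u).
  move=> N0; have [n0 eg hg] := gP t N N0.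
  have e1 : dvdby N (teval c t + embx u) <-> dvdby N (g t N + emby u).
    apply: r4 => //; have := r1 _ _ _ _ _ hg (r2 N (- u)).
    by rewrite !embN !opprK.
  have e2 : dvdby N (g t N + emby u) <->
      dvdby (N * n_ t N) (teval (sjoin b2 (@emb U V)) (res (t, N)).1.2 +
         @emb U V u *+ n_ t N).
    rewrite -(dvdbyM N (_ + _) n0) mulrnDl eg -hro.
    have := hp' (FCong (N * n_ t N) (TAdd (res (t, N)).1.2
      (TMuln (TVar (inr u)) (n_ t N))) TZero).
    by rewrite /= !teval_muln /= !subr0.
  rewrite e1 e2 -(dvdbyM N (_ + _) n0) mulrnDl; apply: dvdby_congr.
  rewrite mulnC.
  have := rbc2 _ (Sr _ (Or44 _ _ _ (ex_intro _ t (ex_intro _ N (conj N0 erefl))))).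
  rewrite /= teval_muln !teval_rename jj jl -hro => -[z hz].
  exists (- z); rewrite mulNrn -hz; zmod.
move=> theta qt.
have [T [N [N0 hT]]] := qe_agree regG theta.
apply/(hT _ _ GX (emb_equiv V GU) (sjoin c embx)); last exact: rc.
move=> t _; have [s [a hs]] := teval_split t.
rewrite !hs !(emb_teval _ id) -/(teval _ _).
set u := teval id a.
have [i|ni] := pselect (inU (teval c s)).
  rewrite (hus s i) (hu s i) -!embD.
  have e0 (V' : elemext U) : (0 < @emb U V' (us s + u)) = (0 < us s + u).
    by rewrite -(emb0 V') emb_lt.
  have e0' (V' : elemext U) : (@emb U V' (us s + u) < 0) = (us s + u < 0).
    by rewrite -(emb0 V') emb_lt.
  by split; rewrite ?e0 ?e0' ?emb_dvdby.
have [h1 h2] := hcutV s ni (- u).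
rewrite embN in h1 h2; rewrite embN in h1 h2.
have dv := hcong s N u N0.
case: (otrichotomy (teval c s + embx u) 0) => h.
- have h3 : teval c2 s < - @emb U V u by apply: h2; apply: (olt1 h); zmod.
  have h4 : teval c2 s + @emb U V u < 0 by apply: (olt1 h3); zmod.
  by split; rewrite // ?h ?h4 ?(lt_gtF h) ?(lt_gtF h4).
- case: ni; exists (- u); rewrite embN.
  by apply/eqP; rewrite -subr_eq0 opprK; apply/eqP.
have h3 : - @emb U V u < teval c2 s by apply: h1; apply: (olt1 h); zmod.
have h4 : 0 < teval c2 s + @emb U V u by apply: (olt1 h3); zmod.
by split; rewrite // ?h ?h4 ?(lt_gtF h) ?(lt_gtF h4).
Qed.

End Backward.

Lemma domination_iff (G : oagType) (regG : regular G) (K : Type) (U : oagType)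
    (GU : elem_equiv G U) (monU : monster K U)
    (I J : Type) (p : ftype I U) (q : ftype J U) :
  small K [set: I] -> small K [set: J] ->
  global_type p -> global_type q -> invariant_type K q ->
  dominates K p q <->
    Hset q `<=` Hset p /\ forall l : nat, prime l -> kappa_le l q p.
Proof.
case: monU => slK satU _ sI sJ gp gq [A1 sA1 inv]; split.
  move=> [A sA [r [cr pr _ ent]]].
  have [|X [b [c [rb rbc _]]]] :=
    joint_realization gp cr (eta := FEq TZero TZero).
    move=> psi phi ppsi rphi; have [d [h1 h2]] := joint_sat gp cr pr ppsi rphi.
    by exists d.
  split; first exact: (forward_H regG slK GU satU sI gp gq sA cr ent rb rbc).
  by move=> l; apply: (forward_kappa regG slK GU satU sI gp gq sA cr ent rb rbc).
(* [kappa_le] is existential, so its instance at the prime 2 supplies realizations of both types. *)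
move=> [hH hk]; have [rq [_ [rp _]]] := hk 2 isT.
have rc : realizes (@emb U rq) (rtup rq) q by case: (rq).
have rb : realizes (@emb U rp) (rtup rp) p by case: (rp).
exact: (backward regG slK GU satU sI sJ gp gq sA1 inv hH hk rc rb).
Qed.

Theorem theorem3p35 (G : oagType) (regG : regular G)
    (K : Type) (U : oagType) (GU : elem_equiv G U) (monU : monster K U) :
  (forall (I J : Type) (p : ftype I U) (q : ftype J U),
     small K [set: I] -> small K [set: J] ->
     global_type p -> invariant_type K p ->
     global_type q -> invariant_type K q ->
     (dominates K p q <->
        Hset q `<=` Hset p /\
        forall l : nat, prime l -> kappa_le l q p)) /\
  (forall (I J : Type) (q : ftype I U) (q' : ftype J U),
     small K [set: I] -> small K [set: J] ->
     global_type q -> invariant_type K q ->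
     global_type q' -> invariant_type K q' ->
     Hset q = Hset q' ->
     (forall l : nat, prime l -> kappa_eq l q q') ->
     dom_equiv K q q').
Proof.
split=> [I J p q sI sJ gp _ gq iq|I J q q' sI sJ gq iq gq' iq' eH ek].
  exact: (domination_iff regG GU monU sI sJ gp gq iq).
split.
  apply/(domination_iff regG GU monU sI sJ gq gq' iq'); rewrite eH; split=> // l.
  move=> /ek[c [B [d [C [bB bC BC]]]]]; exists d, C, c, B; split=> //.
  by rewrite (card_le_eql (card_esym BC)).
apply/(domination_iff regG GU monU sJ sI gq' gq iq); rewrite eH; split=> // l.
move=> /ek[c [B [d [C [bB bC BC]]]]]; exists c, B, d, C; split=> //.
by rewrite (card_le_eql BC).
Qed.
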